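(* Let $T:\Sigma\to\Sigma$ be a topologically mixing two-sided subshift of finite type and let $\mathcal{A}:\Sigma\to GL(k,\mathbb{R})$ belong to the set $\mathcal{W}$ of typical functions. Let $\Omega=\{\chi(\mu,\mathcal{A}):\mu\in\mathcal{M}(\Sigma,T)\}$ and $E(\alpha)=\{x\in\Sigma:\lim_{n\to\infty}\frac1n\log\|\mathcal{A}^n(x)\|=\alpha\}$. Then for every $\alpha$ in the interior $\mathring{\Omega}$ of $\Omega$, $$h_{top}(E(\alpha))=\sup\{h_\mu(T):\mu\in\mathcal{M}(\Sigma,T),\ \chi(\mu,\mathcal{A})=\alpha\}=\inf\{P_{\Phi_{\mathcal{A}}}(q)-\alpha q:\ q\in\mathbb{R}\}.$$
   Context: Subshift: for a $0$-$1$ matrix $Q$, $\Sigma=\{(x_i)_{i\in\mathbb{Z}}: Q_{x_i,x_{i+1}}=1\ \forall i\}$ with left shift $T$. Fix $\omega\in(0,1)$ and the metric $d(x,y)=\omega^{m}$, where $m$ is the largest integer with $x_i=y_i$ for all $|i|<m$. $W^s_{loc}(x)=\{y:y_n=x_n\ \forall n\ge0\}$, $W^u_{loc}(x)=\{y:y_n=x_n\ \forall n<0\}$; $W^s(x)=\{y: T^ny\in W^s_{loc}(T^nx)\text{ for some }n\ge0\}$, $W^u(x)=\{y:T^ny\in W^u_{loc}(T^nx)\text{ for some }n\le0\}$. Cocycles: for $\mathcal{A}:\Sigma\to GL(k,\mathbb{R})$, $\mathcal{A}^n(x)=\mathcal{A}(T^{n-1}x)\cdots\mathcal{A}(x)$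 and $\mathcal{A}^{-n}(x)=\mathcal{A}(T^{-n}x)^{-1}\cdots\mathcal{A}(T^{-1}x)^{-1}$ for $n\ge1$; $\|\cdot\|$ is the Euclidean operator norm. Fix $r>0$. $H^r_b(\Sigma,GL(k,\mathbb{R}))$ is the set of $r$-Hölder maps $\mathcal{A}:\Sigma\to GL(k,\mathbb{R})$ that are fiber bunched: $\|\mathcal{A}(x)\|\,\|\mathcal{A}(x)^{-1}\|\,\omega^r<1$ for all $x$. For such $\mathcal{A}$ the canonical holonomies $H^s_{y\leftarrow x}=\lim_{n\to\infty}\mathcal{A}^n(y)^{-1}\mathcal{A}^n(x)$ ($y\in W^s_{loc}(x)$) and $H^u_{y\leftarrow x}=\lim_{n\to-\infty}\mathcal{A}^n(y)^{-1}\mathcal{A}^n(x)$ ($y\in W^u_{loc}(x)$) exist; they extend to $y\in W^{s}(x)$ (resp. $W^u(x)$) by $H^{s/u}_{y\leftarrow x}=\mathcal{A}^n(y)^{-1}H^{s/u}_{T^ny\leftarrow T^nx}\mathcal{A}^n(x)$ with $n$ (resp. $-n$) large. Typical cocycles: $\mathcal{A}\in H^r_b(\Sigma,GL(k,\mathbb{R}))$ is 1-typical if there are a periodic point $p$ and a homoclinic point $z\in W^s(p)\cap W^u(p)$, $z\ne p$, such that (i) the eigenvalues of $P:=\mathcal{A}^{per(p)}(p)$ have multiplicity 1 and distinct absolute values, with eigenvectors $v_1,\dots,v_k$; (ii) with $\psi:=H^s_{p\leftarrow z}\circ H^u_{z\leftarrow p}$, for all $1\le i,j\le k$, $\psi(v_i)$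 is not in the hyperplane spanned by all the $v_l$ with $l\ne j$. A 1-typical $\mathcal{A}$ is $t$-typical ($2\le t\le k-1$) if, for the same $p,z$: (I) all products of $t$ distinct eigenvalues of $P$ are distinct; (II) the induced map $\psi^{\wedge t}$ on $\wedge^t\mathbb{R}^k$ satisfies the analogue of (ii) with respect to the eigenvectors $\{v_{i_1}\wedge\dots\wedge v_{i_t}\}_{i_1<\dots<i_t}$ of $P^{\wedge t}$. $\mathcal{A}$ is typical if it is $t$-typical for all $1\le t\le k-1$ (same $p,z$); $\mathcal{W}\subset H^r_b(\Sigma,GL(k,\mathbb{R}))$ is the set of typical maps. $\mathcal{M}(\Sigma,T)$: $T$-invariant Borel probability measures; $h_\mu(T)$: measure-theoretic entropy; $\chi(\mu,\mathcal{A})=\lim_{n\to\infty}\frac1n\int\log\|\mathcal{A}^n(x)\|\,d\mu(x)$. Topological entropy of a subset $Y\subset\Sigma$ (Bowen): let $d_n(x,y)=\max_{0\le j<n}d(T^jx,T^jy)$, $B_n(x,\epsilon)$ the open $d_n$-ball. $S(Y,s,N,\epsilon)=\inf\sum_ie^{-sn_i}$ over countable covers of $Y$ by balls $B_{n_i}(x_i,\epsilon)$ with all $n_i\ge N$; $S(Y,s,\epsilon)=\lim_{N\to\infty}S(Y,s,N,\epsilon)$; $h_{top}(T,Y,\epsilon)$ is the critical $s$ at which $S(Y,s,\epsilon)$ jumps from $\infty$ to $0$; $h_{top}(Y)=\lim_{\epsilon\to0}h_{top}(T,Y,\epsilon)$. Pressure: $\Phi_{\mathcal{A}}=\{\log\|\mathcal{A}^n\|\}_{n\ge1}$,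 and for $q\in\mathbb{R}$, $P_{\Phi_{\mathcal{A}}}(q)$ is the topological pressure of $q\Phi_{\mathcal{A}}$: $P_{\Phi_{\mathcal{A}}}(q)=\lim_{\epsilon\to0}\limsup_{n\to\infty}\frac1n\log\sup\{\sum_{x\in E}\|\mathcal{A}^n(x)\|^q: E\subset\Sigma\ (n,\epsilon)\text{-separated}\}$, where $E$ is $(n,\epsilon)$-separated if $d_n(x,y)>\epsilon$ for distinct $x,y\in E$. *)

(* Defs.v *)
(* MathComp / MathComp-Analysis *)
From HB Require Import structures.
From mathcomp Require Import all_boot all_order all_algebra.
From mathcomp Require Import all_classical all_reals all_analysis.

Set Implicit Arguments.
Unset Strict Implicit.
Unset Printing Implicit Defensive.

Import Order.TTheory GRing.Theory Num.Theory.
Import numFieldNormedType.Exports.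

Local Open Scope classical_set_scope.
Local Open Scope ring_scope.

(* [sft_nonempty] is there because MathComp-Analysis measurable types are
   pointed; on an empty subshift there is no probability measure at all. *)
Record sft (R : realType) := SFT {
  sft_card : nat;
  sft_mx : 'M[bool]_sft_card;
  sft_omega : R;
  sft_omega_gt0 : 0 < sft_omega;
  sft_omega_lt1 : sft_omega < 1;
  sft_nonempty :
    exists x : int -> 'I_sft_card, forall i, sft_mx (x i) (x (i + 1)) }.

Definition admissible (R : realType) (X : sft R)
  (x : int -> 'I_(sft_card X)) : Prop := forall i, sft_mx X (x i) (x (i + 1)).

Definition shift_space (R : realType) (X : sft R) : Type :=
  {x : int -> 'I_(sft_card X) | admissible x}.

Section shift_space.
Context {R : realType} {X : sft R}.
Local Notation Sigma := (shift_space X).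
Local Notation omega := (sft_omega X).
Implicit Types (x y z : Sigma).

Definition coord x (i : int) : 'I_(sft_card X) := sval x i.

Lemma coord_inj x y : (forall i, coord x i = coord y i) -> x = y.
Proof.
by case: x y => x px [y py] /= xy; apply: eq_exist; apply: funext => i; exact: xy.
Qed.

HB.instance Definition _ := gen_eqMixin Sigma.
HB.instance Definition _ := gen_choiceMixin Sigma.
HB.instance Definition _ := isPointed.Build Sigma
  (exist _ (sval (cid (sft_nonempty X))) (svalP (cid (sft_nonempty X)))).

Definition agree x y (m : nat) : Prop :=
  forall i : int, `|i| < m%:Z -> coord x i = coord y i.

Definition largest_agree x y : set nat :=
  [set m | agree x y m /\ forall m', agree x y m' -> (m' <= m)%N].

Definition sft_dist x y : R :=
  if x == y then 0 else omega ^+ xget 0%N (largest_agree x y).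

Lemma agreeW x y m n : (m <= n)%N -> agree x y n -> agree x y m.
Proof. by move=> mn xy i im; apply: xy; apply: lt_le_trans im _; rewrite lez_nat. Qed.

Lemma agree_sym x y : agree x y = agree y x.
Proof.
by apply/funext => m; apply/propext; split => xy i /xy.
Qed.

Lemma agreeP x y : x <> y -> exists m, largest_agree x y m.
Proof.
move=> xy.
have [i xyi] : exists i, coord x i <> coord y i.
  by apply: contra_notP xy => /forallNP h; apply: coord_inj => i; apply: contrapT.
have ub m : `[< agree x y m >] -> (m <= `|i|%N)%N.
  move=> /asboolP h; rewrite leqNgt; apply/negP => im.
  by apply: xyi; apply: h; rewrite -abszE ltz_nat.
have ex0 : exists m, `[< agree x y m >].
  by exists 0%N; apply/asboolP => j; rewrite ltNge normr_ge0.
case: (ex_maxnP ex0 ub) => m /asboolP xym mmax.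
by exists m; split => // m' /asboolP; exact: mmax.
Qed.

Lemma sft_dist_neq x y :
  x <> y -> exists2 m, largest_agree x y m & sft_dist x y = omega ^+ m.
Proof.
move=> xy; have [m xym] := agreeP xy.
exists (xget 0%N (largest_agree x y)); first by apply: (xgetPex 0%N); exists m.
by rewrite /sft_dist; case: eqP.
Qed.

Let sft_distxx x : sft_dist x x = 0.
Proof. by rewrite /sft_dist eqxx. Qed.

Let sft_dist_ge0 x y : 0 <= sft_dist x y.
Proof.
by rewrite /sft_dist; case: ifP => // _; rewrite exprn_ge0// ltW// sft_omega_gt0.
Qed.

Let sft_dist_positivity x y : sft_dist x y = 0 -> x = y.
Proof.
rewrite /sft_dist; case: eqP => // _ /eqP.
by rewrite gt_eqF// exprn_gt0// sft_omega_gt0.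
Qed.

Let sft_dist_sym x y : sft_dist x y = sft_dist y x.
Proof. by rewrite /sft_dist /largest_agree eq_sym agree_sym. Qed.

Let sft_dist_triangle y x z : sft_dist x z <= sft_dist x y + sft_dist y z.
Proof.
have [->|xz] := pselect (x = z); first by rewrite sft_distxx addr_ge0.
have [->|xy] := pselect (x = y); first by rewrite sft_distxx add0r.
have [<-|yz] := pselect (y = z); first by rewrite sft_distxx addr0.
have [m [_ mmax] ->] := sft_dist_neq xz.
have [n [xyn _] xyE] := sft_dist_neq xy.
have [p [yzp _] yzE] := sft_dist_neq yz.
have hmin : (minn n p <= m)%N.
  apply: mmax => i ip; rewrite (agreeW (geq_minl n p) xyn)//.
  by rewrite (agreeW (geq_minr n p) yzp).
have w0 := ltW (sft_omega_gt0 X); have w1 := ltW (sft_omega_lt1 X).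
apply: (@le_trans _ _ (omega ^+ minn n p)).
  by apply: ler_wiXn2l.
rewrite xyE yzE /minn; case: ifP => _.
  by rewrite lerDl exprn_ge0.
by rewrite lerDr exprn_ge0.
Qed.

HB.instance Definition _ := isMetric.Build R Sigma
  sft_distxx sft_dist_positivity sft_dist_sym sft_dist_triangle.

Lemma shift_subproof (n : int) x : admissible (fun i => coord x (i + n)).
Proof. by move=> i; rewrite addrAC; exact: (svalP x). Qed.

(* [shift n] is T^n; the shift map itself is [shift 1]. *)
Definition shift (n : int) x : Sigma := exist _ _ (shift_subproof n x).

Definition topologically_mixing : Prop :=
  forall U V : set Sigma, open U -> open V -> U !=set0 -> V !=set0 ->
  exists N : nat, forall n : nat, (N <= n)%N ->
    (shift n @` U) `&` V !=set0.

Definition Ws_loc x : set Sigma :=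
  [set y | forall n : int, 0 <= n -> coord y n = coord x n].
Definition Wu_loc x : set Sigma :=
  [set y | forall n : int, n < 0 -> coord y n = coord x n].
Definition Ws x : set Sigma :=
  [set y | exists n : nat, Ws_loc (shift n x) (shift n y)].
Definition Wu x : set Sigma :=
  [set y | exists n : nat, Wu_loc (shift (- n%:Z) x) (shift (- n%:Z) y)].

Definition homoclinic p : set Sigma := [set z | [/\ Ws p z, Wu p z & z <> p]].

Definition least_period p (n : nat) : Prop :=
  [/\ (0 < n)%N, shift n p = p &
      forall m : nat, (0 < m < n)%N -> shift m p <> p].

End shift_space.

Arguments topologically_mixing {R} X.

Section euclidean_norm.
Context {R : realType}.

Definition eucl_norm n (v : 'cV[R]_n) : R :=
  Num.sqrt (\sum_(i < n) v i 0 ^+ 2).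

Definition op_norm m n (M : 'M[R]_(m, n)) : R :=
  sup [set eucl_norm (M *m v) | v in [set v : 'cV[R]_n | eucl_norm v <= 1]].

End euclidean_norm.

(* The t-th exterior power of R^k is identified with the column space
   'cV[R]_#|incr t k| through its basis e_(i_1) /\ ... /\ e_(i_t), indexed by
   the increasing t-tuples. *)
Section exterior_power.
Context {R : realType} (t k : nat).

Definition incr : {set t.-tuple 'I_k} :=
  [set s : t.-tuple 'I_k | sorted ltn (map val s)].

(* u_1 /\ ... /\ u_t : the coordinates are the maximal minors. *)
Definition wedge (u : 'I_t -> 'cV[R]_k) : 'cV[R]_#|incr| :=
  \col_I \det (\matrix_(a < t, b < t) u b (tnth (enum_val I) a) 0).

(* The induced map: e_J is sent to M e_(j_1) /\ ... /\ M e_(j_t). *)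
Definition ext_map (M : 'M[R]_k) : 'M[R]_#|incr| :=
  \matrix_(I, J) wedge (fun b => col (tnth (enum_val J) b) M) I 0.

End exterior_power.

Section cocycles.
Context {R : realType} {X : sft R} {k : nat}.
Local Notation Sigma := (shift_space X).
Local Notation omega := (sft_omega X).
Implicit Types (A : Sigma -> 'M[R]_k) (x y p z : Sigma).

Fixpoint cocycle_pos A (n : nat) x : 'M[R]_k :=
  if n is m.+1 then A (shift m x) *m cocycle_pos A m x else 1%:M.

Fixpoint cocycle_neg A (n : nat) x : 'M[R]_k :=
  if n is m.+1 then invmx (A (shift (- m.+1%:Z) x)) *m cocycle_neg A m x
  else 1%:M.

Definition cocycle A (n : int) x : 'M[R]_k :=
  match n with
  | Posz m => cocycle_pos A m x
  | Negz m => cocycle_neg A m.+1 x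
  end.

Definition holder (r : R) A : Prop :=
  exists C : R, forall x y, op_norm (A x - A y) <= C * (mdist x y) `^ r.

Definition fiber_bunched (r : R) A : Prop :=
  forall x, op_norm (A x) * op_norm (invmx (A x)) * omega `^ r < 1.

Definition Hrb (r : R) : set (Sigma -> 'M[R]_k) :=
  [set A | [/\ forall x, A x \in unitmx, holder r A & fiber_bunched r A]].

(* [Hs A y x] and [Hu A y x] are the holonomies from x to y. Their value does
   not depend on the exponent n with T^n y in the local stable (unstable) set
   of T^n x, and an arbitrary one is picked. *)
Definition Hs_loc A y x : 'M[R]_k :=
  lim ((fun n : nat => invmx (cocycle A n y) *m cocycle A n x) @ \oo).

Definition Hu_loc A y x : 'M[R]_k :=
  lim ((fun n : nat => invmx (cocycle A (- n%:Z) y) *m cocycle A (- n%:Z) x)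
       @ \oo).

Definition Hs A y x : 'M[R]_k :=
  let n : int := xget 0%N [set n : nat | Ws_loc (shift n x) (shift n y)] in
  invmx (cocycle A n y) *m Hs_loc A (shift n y) (shift n x) *m cocycle A n x.

Definition Hu A y x : 'M[R]_k :=
  let n : int := - (xget 0%N
    [set n : nat | Wu_loc (shift (- n%:Z) x) (shift (- n%:Z) y)])%:Z in
  invmx (cocycle A n y) *m Hu_loc A (shift n y) (shift n x) *m cocycle A n x.

(* lam lists the roots of the characteristic polynomial with multiplicity.
   All eigenvalues can be taken real: a non-real one would share its absolute
   value with its conjugate. Distinct absolute values force simplicity. *)
Definition simple_spectrum (P : 'M[R]_k) (lam : 'I_k -> R)
    (v : 'I_k -> 'cV[R]_k) : Prop :=
  [/\ char_poly P = \prod_i ('X - (lam i)%:P),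
      injective (fun i => `|lam i|) &
      forall i, v i != 0 /\ P *m v i = lam i *: v i].

Definition twisting n (M : 'M[R]_n) (w : 'I_n -> 'cV[R]_n) : Prop :=
  forall i j, M *m w i \notin <<[seq w l | l <- enum 'I_n & l != j]>>%VS.

Definition one_typical_at A p z (lam : 'I_k -> R) (v : 'I_k -> 'cV[R]_k) :
    Prop :=
  [/\ exists2 n, least_period p n & simple_spectrum (cocycle A n p) lam v,
      homoclinic p z &
      twisting (Hs A p z *m Hu A z p) v].

Definition t_typical_at (t : nat) A p z (lam : 'I_k -> R)
    (v : 'I_k -> 'cV[R]_k) : Prop :=
  {in incr t k &, injective (fun I => \prod_(a < t) lam (tnth I a))} /\
  twisting (ext_map t (Hs A p z *m Hu A z p))
    (fun I => wedge (fun a => v (tnth (enum_val I) a))).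

Definition typical (r : R) : set (Sigma -> 'M[R]_k) :=
  [set A | Hrb r A /\ exists p z lam v, one_typical_at A p z lam v /\
     forall t : nat, (2 <= t <= k.-1)%N -> t_typical_at t A p z lam v].

End cocycles.

Section entropy.
Context {R : realType} {X : sft R}.
Local Notation Sigma := (shift_space X).

Definition borel_space := g_sigma_algebraType (@open Sigma).

Definition invariant_measure (mu : probability borel_space R) : Prop :=
  forall B : set borel_space, measurable B -> mu (shift 1 @^-1` B) = mu B.

(* A finite measurable partition is given by a map c to 'I_m, its atoms being
   the fibers of c. [word_atom c w] is the atom of the join of the T^-j c,
   j < n, with label w. *)
Definition word_atom m (c : Sigma -> 'I_m) n (w : n.-tuple 'I_m) :
    set borel_space :=
  [set x | forall j : 'I_n, c (shift j x) = tnth w j].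

Definition partition_entropy (mu : probability borel_space R) m
    (c : Sigma -> 'I_m) (n : nat) : R :=
  - \sum_(w : n.-tuple 'I_m)
      fine (mu (word_atom c w)) * ln (fine (mu (word_atom c w))).

Definition measure_entropy (mu : probability borel_space R) : \bar R :=
  ereal_sup [set h | exists (m : nat) (c : Sigma -> 'I_m),
    (forall i, measurable (c @^-1` [set i] : set borel_space)) /\
    h = (lim ((fun n : nat => n%:R^-1 * partition_entropy mu c n) @ \oo))%:E].

Definition bowen_dist (n : nat) (x y : Sigma) : R :=
  \big[Num.max/0]_(j < n) mdist (shift j x) (shift j y).

Definition bowen_ball (n : nat) (x : Sigma) (e : R) : set Sigma :=
  [set y | bowen_dist n x y < e].

Definition bowen_cover (Y : set Sigma) (N : nat) (e : R)
    (C : set (nat * Sigma)) : Prop :=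
  [/\ countable C, forall c, C c -> (N <= c.1)%N &
      Y `<=` \bigcup_(c in C) bowen_ball c.1 c.2 e].

Definition bowen_S (Y : set Sigma) (s : R) (N : nat) (e : R) : \bar R :=
  ereal_inf [set (\esum_(c in C) (expR (- s * c.1%:R))%:E)%E |
             C in bowen_cover Y N e].

Definition bowen_S_lim (Y : set Sigma) (s e : R) : \bar R :=
  lim ((fun N : nat => bowen_S Y s N e) @ \oo).

Definition htop_eps (Y : set Sigma) (e : R) : \bar R :=
  ereal_inf [set s%:E | s in [set s : R | bowen_S_lim Y s e = 0%E]].

Definition htop (Y : set Sigma) : \bar R :=
  lim (htop_eps Y e @[e --> 0^'+]).

Definition separated (n : nat) (e : R) (E : set Sigma) : Prop :=
  forall x y, E x -> E y -> x <> y -> e < bowen_dist n x y.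

End entropy.

Arguments borel_space {R} X.

Section thermodynamics.
Context {R : realType} {X : sft R} {k : nat}.
Variable A : shift_space X -> 'M[R]_k.

Definition lyapunov (mu : probability (borel_space X) R) : R :=
  lim ((fun n : nat =>
    n%:R^-1 * \int[mu]_x ln (op_norm (cocycle A n x))) @ \oo).

Definition lyapunov_spectrum : set R :=
  [set lyapunov mu | mu in [set mu | invariant_measure mu]].

Definition level_set (alpha : R) : set (shift_space X) :=
  [set x | (fun n : nat => n%:R^-1 * ln (op_norm (cocycle A n x))) @ \oo
           --> alpha].

Definition pressure_eps (q e : R) : \bar R :=
  limn_esup (fun n : nat => (n%:R^-1)%:E *
    lne (ereal_sup [set (\esum_(x in E) ((op_norm (cocycle A n x)) `^ q)%:E)%E |
                    E in separated n e]))%E.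

Definition pressure (q : R) : \bar R :=
  lim (pressure_eps q e @[e --> 0^'+]).

End thermodynamics.

(* Main.v *)
(* Bounded distortion (fiber bunching) makes [ln |A^n x|] depend on [x_0 .. x_(n-1)] up to
   a constant. Typicality makes it quasi-multiplicative: two orbit segments can be joined by a
   connecting word of bounded length, following the homoclinic orbit, with a bounded loss in the
   norm of the product. From then on only this almost additive potential matters.

   Upper bounds. Cylinders on which [|A^n|] is about [exp (n alpha)] cover the level set, so
   [htop (E alpha) <= P q - alpha q]. Gibbs' inequality gives [h_mu + q chi_mu <= P q].

   Lower bounds. Call [(b, t)] rich if there are [exp (n t)] orbit segments of length [n] with
   average [b], up to small errors, that can be freely concatenated. Concatenation shows that the
   set of rich pairs is convex. For every [q] it contains a point of the line [t + q b = P q], and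
   since [alpha] is interior it contains [(b, 0)] with [b] on both sides of [alpha]. By separation
   it contains [(alpha, s)] for all [s < inf_q (P q - alpha q)]. A tree of concatenations whose
   stages grow slowly has its branches in the level set and entropy [s]. Empirical averages along
   the tree of a single stage have limits that are invariant measures of entropy at least about
   [s], and a convex combination of two of them has exponent exactly [alpha]. *)

From HB Require Import structures.
From mathcomp Require Import all_boot all_order all_algebra.
From mathcomp Require Import all_classical all_reals all_analysis.
From mathcomp Require Import ring lra zify.
Require Import Defs.

Set Implicit Arguments.
Unset Strict Implicit.
Unset Printing Implicit Defensive.

Import Order.TTheory GRing.Theory Num.Theory.
Import numFieldNormedType.Exports.

Local Open Scope classical_set_scope.
Local Open Scope ring_scope.

(** * Operator norms *)

(** Connecting words have different lengths, depending on both segments, so joined orbits cannot be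
    compared at a fixed time. One length is selected by the pigeonhole principle and the segments
    are padded to a common length, at the cost of a bounded factor in their number. All losses of a
    connection are charged to the segment that follows it. Being bounded, they vanish per unit of
    time for long segments, however many segments are joined.

    The value [alpha] is reached not through equilibrium states but through convexity of the set of
    rich pairs. An interior [alpha] has rich pairs on both sides, which keeps the slope of a
    separating line finite.

    Entropy is a supremum over all Borel partitions. In the variational inequality a partition is
    replaced by one into cylinder sets, and a noisy channel in Gibbs' inequality pays for the points
    where the two disagree. In the other direction the limits of empirical averages are finitely
    additive; cylinder sets are open and compact, so finite additivity on them already yields a
    measure. *)

Section op_norm.
Context {R : realType}.

Lemma eucl_norm_ge0 n (v : 'cV[R]_n) : 0 <= eucl_norm v.
Proof. exact: sqrtr_ge0. Qed.

Lemma eucl_norm_sqr n (v : 'cV[R]_n) : eucl_norm v ^+ 2 = \sum_(i < n) v i 0 ^+ 2.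
Proof. by rewrite sqr_sqrtr// sumr_ge0// => i _; exact: sqr_ge0. Qed.

Lemma eucl_normZ n (a : R) (v : 'cV[R]_n) : eucl_norm (a *: v) = `|a| * eucl_norm v.
Proof.
rewrite /eucl_norm -sqrtr_sqr -sqrtrM ?sqr_ge0// mulr_sumr.
by congr Num.sqrt; apply: eq_bigr => i _; rewrite mxE exprMn.
Qed.

Lemma eucl_norm0 n : eucl_norm (0 : 'cV[R]_n) = 0.
Proof. by rewrite -(scale0r (0 : 'cV[R]_n)) eucl_normZ normr0 mul0r. Qed.

Lemma le_eucl_norm_entry n (v : 'cV[R]_n) i : `|v i 0| <= eucl_norm v.
Proof.
rewrite -sqrtr_sqr ler_sqrt ?sumr_ge0// => [|j _]; last exact: sqr_ge0.
by rewrite (bigD1 i)//= lerDl sumr_ge0// => j _; exact: sqr_ge0.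
Qed.

Lemma eucl_norm_eq0 n (v : 'cV[R]_n) : eucl_norm v = 0 -> v = 0.
Proof.
move=> v0; apply/colP => i; rewrite mxE; apply/eqP.
by rewrite -normr_le0 -v0 le_eucl_norm_entry.
Qed.

Lemma eucl_normD n (u v : 'cV[R]_n) : eucl_norm (u + v) <= eucl_norm u + eucl_norm v.
Proof.
have [u0|u0] := eqVneq (eucl_norm u) 0.
  by rewrite (eucl_norm_eq0 u0) add0r eucl_norm0 add0r.
have [v0|v0] := eqVneq (eucl_norm v) 0.
  by rewrite (eucl_norm_eq0 v0) addr0 eucl_norm0 addr0.
have s0 : 0 < eucl_norm u by rewrite lt_def u0 eucl_norm_ge0.
have t0 : 0 < eucl_norm v by rewrite lt_def v0 eucl_norm_ge0.
rewrite -(@ler_pXn2r _ 2)// ?nnegrE ?addr_ge0 ?eucl_norm_ge0//.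
rewrite sqrrD !eucl_norm_sqr.
set s := eucl_norm u in s0 u0 *; set t := eucl_norm v in t0 v0 *.
(* Cauchy-Schwarz from a weighted arithmetic-geometric inequality: the weights [t / s] and [s / t]
   make the right side sum to exactly [s * t]. *)
have cs : \sum_i u i 0 * v i 0 <= s * t.
  have -> : s * t = \sum_i (t / s * u i 0 ^+ 2 + s / t * v i 0 ^+ 2) / 2.
    rewrite -mulr_suml big_split/= -!mulr_sumr -!eucl_norm_sqr -/s -/t.
    by field; rewrite u0 v0.
  apply: ler_sum => i _; rewrite -subr_ge0.
  have -> : (t / s * u i 0 ^+ 2 + s / t * v i 0 ^+ 2) / 2 - u i 0 * v i 0 =
    (t * u i 0 - s * v i 0) ^+ 2 / (2 * s * t) by field; rewrite u0 v0.
  by rewrite divr_ge0 ?sqr_ge0// !mulr_ge0// ltW.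
have -> : \sum_i (u + v) i 0 ^+ 2 =
   \sum_i u i 0 ^+ 2 + (\sum_i u i 0 * v i 0) *+ 2 + \sum_i v i 0 ^+ 2.
  rewrite -sumrMnl -!big_split/=; apply: eq_bigr => i _.
  by rewrite mxE sqrrD.
by rewrite lerD2r lerD2l lerMn2r.
Qed.

Lemma eucl_norm_delta n (i : 'I_n) : eucl_norm (delta_mx i 0 : 'cV[R]_n) = 1.
Proof.
rewrite /eucl_norm (bigD1 i)//= big1 ?addr0 ?mxE ?eqxx ?expr1n ?sqrtr1//.
by move=> j ji; rewrite mxE (negPf ji) expr0n.
Qed.

Lemma eucl_norm_le_sum n (v : 'cV[R]_n) : eucl_norm v <= \sum_i `|v i 0|.
Proof.
rewrite {1}(matrix_sum_delta v).
under eq_bigr do rewrite big_ord1.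
elim/big_ind2 : _ => [|a b c d ab cd|i _]; first by rewrite eucl_norm0.
  by apply: le_trans (eucl_normD _ _) _; exact: lerD.
by rewrite eucl_normZ eucl_norm_delta mulr1.
Qed.

Lemma eucl_norm_mul_le_sum m n (M : 'M[R]_(m, n)) v :
  eucl_norm v <= 1 -> eucl_norm (M *m v) <= \sum_i \sum_j `|M i j|.
Proof.
move=> v1; apply: le_trans (eucl_norm_le_sum _) _.
apply: ler_sum => i _; rewrite mxE; apply: le_trans (ler_norm_sum _ _ _) _.
apply: ler_sum => j _; rewrite normrM ler_piMr//.
by apply: le_trans v1; exact: le_eucl_norm_entry.
Qed.

Let has_sup_op m n (M : 'M[R]_(m, n)) :
  has_sup [set eucl_norm (M *m v) | v in [set v : 'cV[R]_n | eucl_norm v <= 1]].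
Proof.
split; first by exists (eucl_norm (M *m 0)); exists 0 => //=; rewrite eucl_norm0.
by exists (\sum_i \sum_j `|M i j|) => _ [v /= v1 <-]; exact: eucl_norm_mul_le_sum.
Qed.

Lemma op_norm_ge0 m n (M : 'M[R]_(m, n)) : 0 <= op_norm M.
Proof.
apply: le_trans (sup_upper_bound (has_sup_op M) _); last first.
  by exists 0 => //=; rewrite eucl_norm0.
exact: eucl_norm_ge0.
Qed.

Lemma le_op_norm m n (M : 'M[R]_(m, n)) v :
  eucl_norm (M *m v) <= op_norm M * eucl_norm v.
Proof.
have [v0|v0] := eqVneq (eucl_norm v) 0.
  by rewrite (eucl_norm_eq0 v0) mulmx0 !eucl_norm0 mulr0.
have v_gt0 : 0 < eucl_norm v by rewrite lt_def v0 eucl_norm_ge0.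
rewrite -ler_pdivrMr// mulrC.
have -> : (eucl_norm v)^-1 * eucl_norm (M *m v) = eucl_norm (M *m ((eucl_norm v)^-1 *: v)).
  by rewrite -scalemxAr eucl_normZ gtr0_norm// invr_gt0.
apply: (sup_upper_bound (has_sup_op M)); exists ((eucl_norm v)^-1 *: v) => //=.
by rewrite eucl_normZ gtr0_norm ?invr_gt0// mulVf.
Qed.

Lemma op_norm_le m n (M : 'M[R]_(m, n)) c : 0 <= c ->
  (forall v, eucl_norm (M *m v) <= c * eucl_norm v) -> op_norm M <= c.
Proof.
move=> c0 Mc; apply: ge_sup; first by case: (has_sup_op M).
move=> _ [v /= v1 <-]; apply: le_trans (Mc v) _.
by rewrite ler_piMr.
Qed.

Lemma op_norm_le_sum m n (M : 'M[R]_(m, n)) : op_norm M <= \sum_i \sum_j `|M i j|.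
Proof.
apply: ge_sup; first by case: (has_sup_op M).
by move=> _ [v /= v1 <-]; exact: eucl_norm_mul_le_sum.
Qed.

Lemma op_normM m n p (M : 'M[R]_(m, n)) (N : 'M[R]_(n, p)) :
  op_norm (M *m N) <= op_norm M * op_norm N.
Proof.
apply: op_norm_le => [|v]; first by rewrite mulr_ge0// op_norm_ge0.
rewrite -mulmxA -mulrA; apply: le_trans (le_op_norm _ _) _.
by rewrite ler_wpM2l ?op_norm_ge0 ?le_op_norm.
Qed.

Lemma op_normD m n (M N : 'M[R]_(m, n)) : op_norm (M + N) <= op_norm M + op_norm N.
Proof.
apply: op_norm_le => [|v]; first by rewrite addr_ge0// op_norm_ge0.
rewrite mulmxDl mulrDl; apply: le_trans (eucl_normD _ _) _.
by rewrite lerD// le_op_norm.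
Qed.

Lemma op_normZ_le m n a (M : 'M[R]_(m, n)) : op_norm (a *: M) <= `|a| * op_norm M.
Proof.
apply: op_norm_le => [|v]; first by rewrite mulr_ge0// op_norm_ge0.
by rewrite -scalemxAl eucl_normZ -mulrA ler_wpM2l// le_op_norm.
Qed.

Lemma op_normN m n (M : 'M[R]_(m, n)) : op_norm (- M) = op_norm M.
Proof.
apply/eqP; rewrite eq_le -{3}(opprK M) -(scaleN1r M) -(scaleN1r (-1 *: M)).
rewrite (le_trans (op_normZ_le _ _)) ?normrN1 ?mul1r//.
by rewrite (le_trans (op_normZ_le _ _)) ?normrN1 ?mul1r.
Qed.

Lemma op_norm0 m n : op_norm (0 : 'M[R]_(m, n)) = 0.
Proof.
apply/eqP; rewrite eq_le op_norm_ge0 andbT.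
by apply: op_norm_le => // v; rewrite mul0mx eucl_norm0 mul0r.
Qed.

Lemma op_norm1_le n : op_norm (1%:M : 'M[R]_n) <= 1.
Proof. by apply: op_norm_le => // v; rewrite mul1mx mul1r. Qed.

Lemma op_norm_sum m n (I : Type) (s : seq I) (P : pred I) (F : I -> 'M[R]_(m, n)) :
  op_norm (\sum_(i <- s | P i) F i) <= \sum_(i <- s | P i) op_norm (F i).
Proof.
elim/big_ind2 : _ => [|a b c d ab cd|i _]; rewrite ?op_norm0//.
by apply: le_trans (op_normD _ _) _; exact: lerD.
Qed.

Lemma op_norm_distC m n (M N : 'M[R]_(m, n)) : op_norm (M - N) = op_norm (N - M).
Proof. by rewrite -op_normN opprB. Qed.

Lemma op_norm_dist m n (M N : 'M[R]_(m, n)) :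
  `|op_norm M - op_norm N| <= op_norm (M - N).
Proof.
have h (A B : 'M[R]_(m, n)) : op_norm A - op_norm B <= op_norm (A - B).
  by rewrite lerBlDr (le_trans _ (op_normD _ _))// subrK.
by rewrite ler_norml h andbT lerNl opprB op_norm_distC.
Qed.

Lemma le_op_norm_entry m n (M : 'M[R]_(m, n)) i j : `|M i j| <= op_norm M.
Proof.
have -> : M i j = (M *m delta_mx j 0 : 'cV_m) i 0.
  rewrite mxE (bigD1 j)//= mxE !eqxx mulr1 big1 ?addr0// => l lj.
  by rewrite mxE (negPf lj) mulr0.
apply: le_trans (le_eucl_norm_entry _ _) _.
by apply: le_trans (le_op_norm _ _) _; rewrite eucl_norm_delta mulr1.
Qed.

Lemma op_norm_le_entries m n (M : 'M[R]_(m, n)) c :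
  (forall i j, `|M i j| <= c) -> op_norm M <= m%:R * n%:R * c.
Proof.
move=> Mc; apply: le_trans (op_norm_le_sum _) _.
have -> : m%:R * n%:R * c = \sum_(i < m) \sum_(j < n) c.
  by rewrite !sumr_const !card_ord -mulrnA mulnC -natrM mulr_natl.
by apply: ler_sum => i _; apply: ler_sum => j _.
Qed.

End op_norm.

(** * The shift space *)

Section shift_space_topology.
Context {R : realType} {X : sft R}.
Local Notation Sigma := (shift_space X).
Local Notation omega := (sft_omega X).
Implicit Types (x y z : Sigma).

Lemma coord_shift (n : int) x i : coord (shift n x) i = coord x (i + n).
Proof. by []. Qed.

Lemma shift_shift (m n : int) x : shift m (shift n x) = shift (m + n) x.
Proof. by apply: coord_inj => i; rewrite !coord_shift addrA. Qed.

Lemma shift0 x : shift 0 x = x.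
Proof. by apply: coord_inj => i; rewrite coord_shift addr0. Qed.

Lemma mdist_le_agree x y m : agree x y m -> mdist x y <= omega ^+ m.
Proof.
move=> xym; have w0 := sft_omega_gt0 X; have w1 := ltW (sft_omega_lt1 X).
rewrite -[mdist x y]/(sft_dist x y).
have [->|xy] := pselect (x = y); first by rewrite /sft_dist eqxx exprn_ge0// ltW.
have [M [_ Mmax] ->] := sft_dist_neq xy.
by rewrite ler_wiXn2l// ?ltW// Mmax.
Qed.

(** Distances are powers of [omega], so a distance below [omega ^+ m] is at most [omega ^+ m.+1].
    With [m = 0]: at distance less than 1 the coordinates at 0 agree. *)
Lemma agree_mdist_lt x y m : mdist x y < omega ^+ m -> agree x y m.+1.
Proof.
have w0 := sft_omega_gt0 X; have w1 := sft_omega_lt1 X.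
rewrite -[mdist x y]/(sft_dist x y).
have [->|xy] := pselect (x = y); first by [].
have [M [xyM _] ->] := sft_dist_neq xy.
by rewrite ltr_iXn2l// => mM; exact: agreeW xyM.
Qed.

Lemma exists_omega_exp_lt (e : R) : 0 < e -> exists m, omega ^+ m < e.
Proof.
move=> e0; have : (fun m => omega ^+ m) @ \oo --> (0 : R).
  by apply: cvg_expr; rewrite gtr0_norm ?sft_omega_gt0 ?sft_omega_lt1.
move=> /cvgrPdist_lt /(_ _ e0) [m _ /(_ m (leqnn m))]; rewrite sub0r normrN => h.
by exists m; apply: le_lt_trans h; rewrite ler_norm.
Qed.

Lemma nbhs_agreeP x (U : set Sigma) :
  nbhs x U <-> exists m, forall y, agree x y m -> U y.
Proof.
split => [/nbhs_ballP[e /= e0 xU]|[m mU]]; last apply/nbhs_ballP.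
  have [m me] := exists_omega_exp_lt e0; exists m => y xym; apply: xU.
  by rewrite ballEmdist /=; exact: le_lt_trans (mdist_le_agree xym) me.
exists (omega ^+ m) => /=; first by rewrite exprn_gt0// sft_omega_gt0.
move=> y; rewrite ballEmdist /= => /agree_mdist_lt h.
by apply: mU; exact: agreeW h.
Qed.

Lemma agree_trans y x z m : agree x y m -> agree y z m -> agree x z m.
Proof. by move=> h1 h2 i im; rewrite h1// h2. Qed.

Lemma open_agreeP (U : set Sigma) :
  open U <-> forall x, U x -> exists m, forall y, agree x y m -> U y.
Proof.
rewrite openE; split => [h x /h /nbhs_agreeP//|h x /h ?].
exact/nbhs_agreeP.
Qed.

(** An ultrafilter selects one symbol at each coordinate. Neighbouring selections are admissible
    because some point realises both of them. *)
Lemma compact_shift_space : compact [set: Sigma].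
Proof.
rewrite compact_ultra => F FU _.
have FF : ProperFilter F := @ultra_proper _ _ FU.
have sym i : exists a, F [set x | coord x i = a].
  apply: contrapT => /forallNP h.
  have : \near F, forall a, coord F i <> a.
    apply: filter_forall => a; have [/h //|] := in_ultra_setVsetC [set x | coord x i = a] FU.
    by apply: filterS => x /= xa.
  by move=> /filter_ex[x /(_ (coord x i))].
have [f fP] := choice sym.
have adm : forall i, sft_mx X (f i) (f (i + 1)).
  move=> i; have /filter_ex[x [<- <-]] : F [set x | coord x i = f i /\ coord x (i + 1) = f (i + 1)].
    exact: (filterI (fP i) (fP (i + 1))).
  exact: (svalP x).
pose x : Sigma := exist _ f adm.
exists x; split => // U /nbhs_agreeP[m mU]; apply: filterS mU _.
elim: m => [|m IH]; first by apply: filterE => y i /=; rewrite ltNge normr_ge0.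
apply: filterS (filterI IH (filterI (fP m%:Z) (fP (- m%:Z)))).
move=> y [ym [/= y1 y2]] i im; have [|] := ltrP `|i| m%:Z; first exact: ym.
move=> mi; have : i = m%:Z \/ i = - m%:Z by lia.
by case=> ->; rewrite /coord/= -/(coord _ _).
Qed.

Lemma continuous_agreeP (f : Sigma -> R) :
  (forall x (e : R), 0 < e -> exists m, forall y, agree x y m -> `|f x - f y| < e) ->
  continuous f.
Proof.
move=> h x; apply/(@cvgrPdist_lt _ _ Sigma (nbhs x) (nbhs_filter x)) => e e0; apply/nbhs_agreeP.
have [m hm] := h x e e0; exists m => y; exact: hm.
Qed.

Lemma shift_space_max (f : Sigma -> R) : continuous f ->
  exists x, forall y, f y <= f x.
Proof.
move=> cf; have [|x _ xmax] := compact_EVT_max _ compact_shift_space (continuous_subspaceT cf).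
  by exists point.
by exists x => y; apply: xmax; rewrite inE.
Qed.

(** Admissibility concerns neighbouring symbols only, so one may pass from [x] to [y] at a
    coordinate where they agree. *)
Lemma splice x y (n : int) : coord x n = coord y n ->
  exists z, (forall i : int, i <= n -> coord z i = coord x i) /\
            (forall i : int, n <= i -> coord z i = coord y i).
Proof.
move=> xyn; pose f (i : int) := if i <= n then coord x i else coord y i.
have adm i : sft_mx X (f i) (f (i + 1)).
  rewrite /f; case: ifPn => i1; case: ifPn => i2.
  - exact: (svalP x).
  - have -> : i = n by lia.
    by rewrite xyn; exact: (svalP y).
  - lia.
  - exact: (svalP y).
exists (exist _ f adm); split => i ni; rewrite /coord/= /f; first by rewrite ni.
case: ifPn => // i2; have -> : i = n by lia.
by [].
Qed.

(** Only the two symbols at the ends of the gap matter. There are finitely many pairs, and the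
    largest of their mixing times serves for all of them. *)
Lemma mixing_glue : topologically_mixing X -> exists t : nat, forall x y,
  exists z, (forall i : int, i < 0 -> coord z i = coord x i) /\
            (forall i : int, 0 <= i -> coord z (i + t%:Z) = coord y i).
Proof.
move=> mix; pose C (a : 'I_(sft_card X)) := [set u : Sigma | coord u 0 = a].
have Copen a : open (C a).
  by apply/open_agreeP => u ua; exists 1%N => v uv; rewrite /C/= -uv.
have /choice[N hN] (ab : 'I_(sft_card X) * 'I_(sft_card X)) : exists N : nat,
    forall n : nat, (N <= n)%N -> C ab.1 !=set0 -> C ab.2 !=set0 ->
    (shift n @` C ab.1) `&` C ab.2 !=set0.
  have [[h1 h2]|h] := pselect (C ab.1 !=set0 /\ C ab.2 !=set0); last first.
    by exists 0%N => n _ h1 h2; exfalso; exact: h.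
  by have [N hN] := mix _ _ (Copen ab.1) (Copen ab.2) h1 h2; exists N => n /hN.
exists (\max_ab N ab) => x y; set t := \max_ab N ab.
(* The gap leads from coordinate [-1] to coordinate [t], which takes [t.+1] steps. *)
have [|||_ [[u /= ua <-] /= ub]] := hN (coord x (-1), coord y 0) t.+1.
- by rewrite (leq_trans (leq_bigmax _))// leqnSn.
- by exists (shift (-1) x).
- by exists y.
have [z1 [z1x z1u]] : exists z, (forall i : int, i <= -1 -> coord z i = coord x i) /\
    (forall i : int, -1 <= i -> coord z i = coord (shift 1 u) i).
  by apply: splice; rewrite coord_shift -ua.
have [z [zz1 zy]] : exists z, (forall i : int, i <= t%:Z -> coord z i = coord z1 i) /\
    (forall i : int, t%:Z <= i -> coord z i = coord (shift (- t%:Z) y) i).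
  apply: splice; rewrite z1u; last by lia.
  rewrite !coord_shift subrr -ub coord_shift add0r; congr (coord u _); lia.
exists z; split => i i0.
- by rewrite zz1 ?z1x//; lia.
- by rewrite zy ?coord_shift ?addrK//; lia.
Qed.

Definition word n x : n.-tuple 'I_(sft_card X) := [tuple coord x i%:Z | i < n].

Lemma eq_wordP n x y :
  word n x = word n y <-> forall i : nat, (i < n)%N -> coord x i%:Z = coord y i%:Z.
Proof.
split => [h i ni|h]; last by apply: eq_from_tnth => i; rewrite !tnth_mktuple h.
by move: (congr1 (fun w => tnth w (Ordinal ni)) h); rewrite !tnth_mktuple.
Qed.

Lemma eq_word_le m n x y : (m <= n)%N -> word n x = word n y -> word m x = word m y.
Proof.
move=> mn /eq_wordP h; apply/eq_wordP => i im.
by apply: h; exact: leq_trans mn.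
Qed.

End shift_space_topology.

(** * Products of invertible matrices *)

Section matrix_products.
Context {R : realType} {k : nat}.
Implicit Types (a b : nat -> 'M[R]_k).

Fixpoint mprod a (n : nat) : 'M[R]_k :=
  if n is m.+1 then a m *m mprod a m else 1%:M.

Lemma mprod_unit a n : (forall i, a i \in unitmx) -> mprod a n \in unitmx.
Proof. by move=> ua; elim: n => [|n IH] /=; rewrite ?unitmx1// unitmx_mul ua IH. Qed.

Lemma invmxM (M N : 'M[R]_k) : M \in unitmx -> N \in unitmx ->
  invmx (M *m N) = invmx N *m invmx M.
Proof.
move=> uM uN; apply: (row_full_inj (A := M *m N)).
  by rewrite row_full_unit unitmx_mul uM.
rewrite mulmxV ?unitmx_mul ?uM//.
by rewrite -mulmxA (mulmxA N) mulmxV// mul1mx mulmxV.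
Qed.

Lemma invmx_sub (M N : 'M[R]_k) : M \in unitmx -> N \in unitmx ->
  invmx N - invmx M = invmx M *m (M - N) *m invmx N.
Proof. by move=> uM uN; rewrite mulmxBr mulVmx// mulmxBl mul1mx mulmxK. Qed.

Lemma prod_1Dgeo_le (c p : R) n : 0 <= c -> 0 <= p -> p < 1 ->
  \prod_(i < n) (1 + c * p ^+ i) <= expR (c / (1 - p)).
Proof.
move=> c0 p0 p1.
apply: (@le_trans _ _ (expR (\sum_(i < n) c * p ^+ i))).
  rewrite expR_sum; apply: ler_prod => i _.
  by rewrite addr_ge0 ?mulr_ge0 ?exprn_ge0//= expR_ge1Dx.
rewrite ler_expR -mulr_sumr ler_wpM2l// -[X in X <= _]mulr1.
have p1' : 0 < 1 - p by rewrite subr_gt0.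
rewrite -[_^-1]mul1r ler_pdivlMr// mulr1 mulrC.
have -> : (1 - p) * \sum_(i < n) p ^+ i = 1 - p ^+ n.
  by rewrite -[RHS]opprB subrX1 -mulNr opprB.
by rewrite lerBlDr lerDl exprn_ge0.
Qed.

End matrix_products.

(** * Holonomies and bounded distortion *)

Section holonomy_estimate.
Context {R : realType} {k : nat}.
Variables (a b : nat -> 'M[R]_k) (C B rho theta : R).
Hypothesis rho_gt0 : 0 < rho.
Hypothesis rho_lt1 : rho < 1.
Hypothesis theta_ge0 : 0 <= theta.
Hypothesis theta_lt1 : theta < 1.
Hypothesis C_ge0 : 0 <= C.
Hypothesis B_ge0 : 0 <= B.
Hypothesis ua : forall i, a i \in unitmx.
Hypothesis ub : forall i, b i \in unitmx.
Hypothesis ab_close : forall i, op_norm (a i - b i) <= C * rho ^+ i.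
Hypothesis a_bunched : forall i, op_norm (a i) * op_norm (invmx (a i)) * rho <= theta.
Hypothesis b_bounded : forall i, op_norm (invmx (b i)) <= B.

Let D n := invmx (mprod b n) *m mprod a n.
Let K := B * C * expR (B * C / (1 - rho)).

(** If [b] were [a], bunching would give a factor [theta / rho] at each step. Passing from the
    inverse of [a n] to that of [b n] costs a factor [1 + B * C * rho ^+ n], and the product of
    these converges. *)
Let growth n : op_norm (invmx (mprod b n)) * op_norm (mprod a n) <=
  (theta / rho) ^+ n * \prod_(i < n) (1 + B * C * rho ^+ i).
Proof.
elim: n => [|n IH].
  rewrite big_ord0 expr0 mulr1 /= invmx1 -[leRHS]mulr1.
  by apply: ler_pM; rewrite ?op_norm_ge0 ?op_norm1_le.
rewrite big_ord_recr /= invmxM ?mprod_unit// exprSr.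
set P := \prod_(i < n) _ in IH *.
have -> : (theta / rho) ^+ n * (theta / rho) * (P * (1 + B * C * rho ^+ n)) =
  (theta / rho) ^+ n * P * (theta / rho * (1 + B * C * rho ^+ n)) by ring.
apply: (@le_trans _ _ ((op_norm (invmx (mprod b n)) * op_norm (mprod a n)) *
    (op_norm (invmx (b n)) * op_norm (a n)))).
  rewrite mulrACA (mulrC (op_norm (mprod a n))).
  by apply: ler_pM; rewrite ?op_norm_ge0 ?op_normM.
apply: ler_pM => //; rewrite ?mulr_ge0 ?op_norm_ge0//.
have hb : op_norm (invmx (b n)) <= op_norm (invmx (a n)) * (1 + B * C * rho ^+ n).
  have -> : invmx (b n) = invmx (a n) + invmx (a n) *m (a n - b n) *m invmx (b n).
    by rewrite -invmx_sub// addrC subrK.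
  apply: le_trans (op_normD _ _) _; rewrite mulrDr mulr1 lerD2l.
  apply: le_trans (op_normM _ _) _.
  have -> : op_norm (invmx (a n)) * (B * C * rho ^+ n) =
    (op_norm (invmx (a n)) * (C * rho ^+ n)) * B by ring.
  apply: ler_pM; rewrite ?op_norm_ge0//.
  by apply: le_trans (op_normM _ _) _; rewrite ler_wpM2l ?op_norm_ge0.
apply: (@le_trans _ _ (op_norm (invmx (a n)) * (1 + B * C * rho ^+ n) * op_norm (a n))).
  by rewrite ler_wpM2r ?op_norm_ge0.
rewrite mulrAC ler_wpM2r//; last by rewrite ler_pdivlMr// (mulrC (op_norm (invmx _))).
by rewrite addr_ge0 ?mulr_ge0 ?exprn_ge0// ltW.
Qed.

(** The increment is the difference [a n - b n], of order [rho ^+ n], between products that grow at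
    most like [(theta / rho) ^+ n]; the powers of [rho] cancel. *)
Lemma holonomy_step n : op_norm (D n.+1 - D n) <= K * theta ^+ n.
Proof.
have -> : D n.+1 - D n =
    invmx (mprod b n) *m (invmx (b n) *m (a n - b n)) *m mprod a n.
  by rewrite /D /= invmxM ?mprod_unit// mulmxBr mulVmx// mulmxBr mulmx1 mulmxBl !mulmxA.
apply: le_trans (op_normM _ _) _.
apply: (@le_trans _ _ (op_norm (invmx (mprod b n)) * (B * (C * rho ^+ n)) *
    op_norm (mprod a n))).
  rewrite ler_wpM2r ?op_norm_ge0//; apply: le_trans (op_normM _ _) _.
  rewrite ler_wpM2l ?op_norm_ge0//; apply: le_trans (op_normM _ _) _.
  by apply: ler_pM; rewrite ?op_norm_ge0.
rewrite mulrAC.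
have E : K * theta ^+ n = (theta / rho) ^+ n * expR (B * C / (1 - rho)) * (B * (C * rho ^+ n)).
  rewrite /K expr_div_n; field.
  by rewrite expf_neq0 ?gt_eqF.
rewrite E ler_wpM2r ?mulr_ge0 ?exprn_ge0// ?(ltW rho_gt0)//.
apply: le_trans (growth n) _; rewrite ler_wpM2l ?exprn_ge0 ?divr_ge0 ?(ltW rho_gt0)//.
by apply: prod_1Dgeo_le => //; [rewrite mulr_ge0|rewrite ltW].
Qed.

Lemma holonomy_cauchy m n : (m <= n)%N ->
  op_norm (D n - D m) <= K / (1 - theta) * theta ^+ m.
Proof.
move=> /subnKC <-; move: (n - m)%N => d {n}.
have t1 : 0 < 1 - theta by rewrite subr_gt0.
have K0 : 0 <= K by rewrite /K !mulr_ge0// expR_ge0.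
(* The factor [1 - theta ^+ d] makes the induction on [d] close exactly. *)
suff h : op_norm (D (m + d) - D m) <= K / (1 - theta) * theta ^+ m * (1 - theta ^+ d).
  apply: le_trans h _; rewrite ler_piMr ?mulr_ge0 ?exprn_ge0 ?invr_ge0 ?(ltW t1)//.
  by rewrite lerBlDr lerDl exprn_ge0.
elim: d => [|d IH]; first by rewrite addn0 subrr op_norm0 expr0 subrr mulr0.
rewrite addnS.
have -> : D (m + d).+1 - D m = (D (m + d).+1 - D (m + d)%N) + (D (m + d)%N - D m).
  by rewrite addrA subrK.
apply: le_trans (op_normD _ _) _; apply: le_trans (lerD (holonomy_step _) IH) _.
rewrite le_eqVlt; apply/orP; left; apply/eqP.
by rewrite exprD exprS; field; rewrite gt_eqF.
Qed.

End holonomy_estimate.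

Section cocycle_bounds.
Context {R : realType} {X : sft R} {k : nat}.
Local Notation Sigma := (shift_space X).
Local Notation omega := (sft_omega X).
Implicit Types (A : Sigma -> 'M[R]_k) (x y z : Sigma).

(* [Hrb] with [rho] for [omega `^ r]; the bounds are uniform by compactness. *)
Record bunched A (C B rho theta : R) : Prop := Bunched {
  bun_rho_gt0 : 0 < rho;
  bun_rho_lt1 : rho < 1;
  bun_theta_ge0 : 0 <= theta;
  bun_theta_lt1 : theta < 1;
  bun_C_ge0 : 0 <= C;
  bun_B_ge0 : 0 <= B;
  bun_unit : forall x, A x \in unitmx;
  bun_holder : forall x y m, agree x y m -> op_norm (A x - A y) <= C * rho ^+ m;
  bun_lt : forall x, op_norm (A x) * op_norm (invmx (A x)) * rho <= theta;
  bun_le : forall x, op_norm (A x) <= B;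
  bun_inv_le : forall x, op_norm (invmx (A x)) <= B }.

Lemma op_norm_unit_gt0 (M : 'M[R]_k) : (0 < k)%N -> M \in unitmx -> 0 < op_norm M.
Proof.
move=> k0 uM; rewrite lt_def op_norm_ge0 andbT; apply/eqP => M0.
have /matrixP/(_ (Ordinal k0) (Ordinal k0)) : M *m invmx M = 0.
  rewrite (_ : M = 0) ?mul0mx//; apply/matrixP => i j; rewrite mxE.
  by apply/eqP; rewrite -normr_le0 -M0 le_op_norm_entry.
by rewrite mulmxV// !mxE eqxx => /eqP; rewrite oner_eq0.
Qed.

Lemma exp_rho_le_eps (c rho e : R) : 0 <= c -> 0 < rho -> rho < 1 -> 0 < e ->
  exists m, forall n, (m <= n)%N -> c * rho ^+ n < e.
Proof.
move=> c0 p0 p1 e0; have : (fun m => c * rho ^+ m) @ \oo --> (0 : R).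
  rewrite -(mulr0 c); apply: cvgMr; apply: cvg_expr; first by rewrite gtr0_norm.
move=> /cvgrPdist_lt /(_ _ e0) [m _ hm]; exists m => n mn.
by apply: le_lt_trans (hm n mn); rewrite sub0r normrN ler_norm.
Qed.

Lemma holder_max (f : Sigma -> R) (c rho : R) : 0 <= c -> 0 < rho -> rho < 1 ->
  (forall x y m, agree x y m -> `|f x - f y| <= c * rho ^+ m) ->
  exists x, forall y, f y <= f x.
Proof.
move=> c0 p0 p1 h; apply: shift_space_max; apply: continuous_agreeP => x e e0.
have [m hm] := exp_rho_le_eps c0 p0 p1 e0.
by exists m => y /h xy; exact: le_lt_trans xy (hm m (leqnn m)).
Qed.

Lemma Hrb_bunched r A : (0 < k)%N -> 0 < r -> Hrb r A ->
  exists C B rho theta, bunched A C B rho theta.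
Proof.
move=> k0 r0 [uA [C0 hC0] fb]; have w0 := sft_omega_gt0 X.
pose rho := omega `^ r; pose C := Num.max C0 0.
have rho0 : 0 < rho by exact: powR_gt0.
have rho1 : rho < 1.
  have := @gt0_ltr_powR R r r0 omega 1; rewrite powR1; apply => //.
  - by rewrite nnegrE ltW.
  - by rewrite nnegrE.
  - exact: sft_omega_lt1.
have C_ge0 : 0 <= C by rewrite le_max lexx orbT.
have hol x y m : agree x y m -> op_norm (A x - A y) <= C * rho ^+ m.
  move=> xym; apply: le_trans (hC0 x y) _.
  have -> : rho ^+ m = (omega ^+ m) `^ r.
    elim: m {xym} => [|m IH]; first by rewrite !expr0 powR1.
    by rewrite !exprS powRM ?exprn_ge0 ?(ltW w0)// IH.
  apply: (@le_trans _ _ (C * mdist x y `^ r)).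
    by rewrite ler_wpM2r ?powR_ge0// le_max lexx.
  rewrite ler_wpM2l// ge0_ler_powR ?(ltW r0)//.
  - by rewrite nnegrE; exact: mdist_ge0.
  - by rewrite nnegrE exprn_ge0// ltW.
  - exact: mdist_le_agree.
have holN x y m : agree x y m -> `|op_norm (A x) - op_norm (A y)| <= C * rho ^+ m.
  by move=> /hol; apply: le_trans; exact: op_norm_dist.
have [xM hM] := holder_max C_ge0 rho0 rho1 holN.
have [xm hm] : exists x, forall y, - op_norm (A y) <= - op_norm (A x).
  apply: (@holder_max (fun y => - op_norm (A y)) _ _ C_ge0 rho0 rho1) => x y m xym.
  by rewrite -opprD normrN holN.
have m0 := op_norm_unit_gt0 k0 (uA xm); set m1 := op_norm (A xm) in m0 hm.
have m1rho : 0 < m1 * rho by rewrite mulr_gt0.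
(* Fiber bunching bounds the inverse, since [op_norm (A x)] is at least its minimum [m1 > 0]. *)
have inv_le x : op_norm (invmx (A x)) <= (m1 * rho)^-1.
  rewrite -[leRHS]mul1r ler_pdivlMr// mulrC.
  apply: le_trans (ltW (fb x)); rewrite -/rho mulrAC.
  by apply: (ler_wpM2r (ltW rho0)); apply: (ler_wpM2r (op_norm_ge0 _)); rewrite -lerN2.
set B1 := (m1 * rho)^-1 in inv_le.
have B1_ge0 : 0 <= B1 by rewrite invr_ge0 ltW.
have holI x y m : agree x y m ->
    op_norm (invmx (A x) - invmx (A y)) <= B1 * C * B1 * rho ^+ m.
  move=> xym; rewrite invmx_sub//; apply: le_trans (op_normM _ _) _.
  have -> : B1 * C * B1 * rho ^+ m = B1 * (C * rho ^+ m) * B1 by ring.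
  apply: ler_pM; rewrite ?op_norm_ge0//; apply: le_trans (op_normM _ _) _.
  by apply: ler_pM; rewrite ?op_norm_ge0// op_norm_distC hol.
have holI' x y m : agree x y m ->
    `|op_norm (invmx (A x)) - op_norm (invmx (A y))| <= B1 * C * B1 * rho ^+ m.
  by move=> /holI; apply: le_trans; exact: op_norm_dist.
(* The pointwise strict inequality becomes a uniform [theta < 1] because the bunching quantity
   attains its maximum. *)
have [xt ht] : exists x, forall y, op_norm (A y) * op_norm (invmx (A y)) * rho <=
    op_norm (A x) * op_norm (invmx (A x)) * rho.
  pose M := op_norm (A xM).
  have M0 : 0 <= M by exact: op_norm_ge0.
  apply: (@holder_max (fun y => op_norm (A y) * op_norm (invmx (A y)) * rho)
    ((M * (B1 * C * B1) + C * B1) * rho) _ _ rho0 rho1) => [|x y m xym].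
    by rewrite mulr_ge0 ?(ltW rho0)// addr_ge0// !mulr_ge0.
  rewrite -mulrBl normrM (gtr0_norm rho0) mulrAC ler_wpM2r ?(ltW rho0)//.
  set a := op_norm (A x); set a' := op_norm (A y).
  set b := op_norm (invmx (A x)); set b' := op_norm (invmx (A y)).
  have -> : a * b - a' * b' = a * (b - b') + (a - a') * b' by ring.
  have -> : (M * (B1 * C * B1) + C * B1) * rho ^+ m =
    M * (B1 * C * B1 * rho ^+ m) + C * rho ^+ m * B1 by ring.
  apply: le_trans (ler_normD _ _) _; rewrite !normrM.
  rewrite [`|a|]ger0_norm ?op_norm_ge0// [`|b'|]ger0_norm ?op_norm_ge0//.
  apply: lerD; apply: ler_pM; rewrite ?op_norm_ge0//.
  - exact: hM.
  - exact: holI'.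
  - exact: holN.
  - exact: inv_le.
exists C, (Num.max (op_norm (A xM)) B1), rho,
  (op_norm (A xt) * op_norm (invmx (A xt)) * rho); split => //.
- by rewrite !mulr_ge0// ?op_norm_ge0// ltW.
- by rewrite le_max op_norm_ge0.
- by move=> x; rewrite le_max hM.
- by move=> x; rewrite le_max inv_le orbT.
Qed.

Lemma cocycle_mprod A n x : cocycle A n%:Z x = mprod (fun i => A (shift i%:Z x)) n.
Proof. by elim: n => //= n <-. Qed.

Lemma cocycle_neg_mprod A n x :
  cocycle A (- n%:Z) x = mprod (fun i => invmx (A (shift (- i.+1%:Z) x))) n.
Proof.
have -> : cocycle A (- n%:Z) x = cocycle_neg A n x by case: n.
by elim: n => //= n ->.
Qed.

Lemma cocycle0 A x : cocycle A 0 x = 1%:M. Proof. by []. Qed.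

Lemma cocycleS A n x : cocycle A n.+1%:Z x = A (shift n%:Z x) *m cocycle A n%:Z x.
Proof. by []. Qed.

Lemma cocycleD A (m n : nat) x :
  cocycle A (m + n)%N%:Z x = cocycle A n%:Z (shift m%:Z x) *m cocycle A m%:Z x.
Proof.
elim: n => [|n IH]; first by rewrite addn0 mul1mx.
rewrite addnS /= -mulmxA -[cocycle_pos A (m + n) x]/(cocycle A (m + n)%N%:Z x) IH.
by rewrite shift_shift addnC.
Qed.

Lemma cocycle_unit A n x : (forall x, A x \in unitmx) -> cocycle A n%:Z x \in unitmx.
Proof. by move=> uA; rewrite cocycle_mprod; exact: mprod_unit. Qed.

Lemma cocycleN A n x : (forall x, A x \in unitmx) ->
  cocycle A (- n%:Z) x = invmx (cocycle A n%:Z (shift (- n%:Z) x)).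
Proof.
move=> uA; elim: n => [|n IH]; first by rewrite /= invmx1.
have -> : cocycle A (- n.+1%:Z) x = invmx (A (shift (- n.+1%:Z) x)) *m cocycle A (- n%:Z) x.
  by rewrite !cocycle_neg_mprod.
have -> : cocycle A n.+1%:Z (shift (- n.+1%:Z) x) =
   cocycle A n%:Z (shift (- n%:Z) x) *m A (shift (- n.+1%:Z) x).
  rewrite -add1n cocycleD shift_shift /= mulmx1 shift_shift.
  by congr (cocycle A n%:Z (shift _ x) *m A (shift _ x)); lia.
by rewrite IH invmxM ?cocycle_unit.
Qed.

Lemma op_norm_cocycle_le A B n x : 0 <= B -> (forall x, op_norm (A x) <= B) ->
  op_norm (cocycle A n%:Z x) <= B ^+ n.
Proof.
move=> B0 hB; elim: n => [|n IH]; first by rewrite expr0 op_norm1_le.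
by rewrite exprS; apply: le_trans (op_normM _ _) _; apply: ler_pM; rewrite ?op_norm_ge0.
Qed.

Section holonomies.
Variables (A : Sigma -> 'M[R]_k) (C B rho theta : R).
Hypothesis bA : bunched A C B rho theta.

(** The finite-time holonomies, whose limits are [Hs_loc] and [Hu_loc]. *)
Definition sdiff n y x := invmx (cocycle A n%:Z y) *m cocycle A n%:Z x.
Definition udiff n y x := invmx (cocycle A (- n%:Z) y) *m cocycle A (- n%:Z) x.

Lemma sdiff_cauchy : exists2 K, 0 <= K & forall x y m n,
  (forall i : int, 0 <= i -> coord x i = coord y i) -> (m <= n)%N ->
  op_norm (sdiff n y x - sdiff m y x) <= K * theta ^+ m.
Proof.
have [p0 p1 t0 t1 C0 B0 uA hol hlt hB hI] := bA.
exists (B * C * expR (B * C / (1 - rho)) / (1 - theta)).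
  by rewrite !mulr_ge0// ?expR_ge0// invr_ge0 subr_ge0 ltW.
move=> x y m n xy mn; rewrite /sdiff !cocycle_mprod.
apply: holonomy_cauchy => // i; apply: hol => j ji; rewrite !coord_shift xy//; lia.
Qed.

(** The same estimate for the inverse matrices along the past orbit: inversion preserves the
    bunching quantity and turns the Hölder constant [C] into [B * C * B]. *)
Lemma udiff_cauchy : exists2 K, 0 <= K & forall x y m n,
  (forall i : int, i < 0 -> coord x i = coord y i) -> (m <= n)%N ->
  op_norm (udiff n y x - udiff m y x) <= K * theta ^+ m.
Proof.
have [p0 p1 t0 t1 C0 B0 uA hol hlt hB hI] := bA.
exists (B * (B * C * B) * expR (B * (B * C * B) / (1 - rho)) / (1 - theta)).
  by rewrite !mulr_ge0// ?expR_ge0// ?invr_ge0 ?subr_ge0 ?ltW// !mulr_ge0.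
move=> x y m n xy mn; rewrite /udiff !cocycle_neg_mprod.
apply: (@holonomy_cauchy _ _ _ _ (B * C * B) B rho) => // [|i|i|i|i|i].
- by rewrite !mulr_ge0.
- by rewrite unitmx_inv.
- by rewrite unitmx_inv.
- rewrite invmx_sub//; apply: le_trans (op_normM _ _) _.
  have -> : B * C * B * rho ^+ i = B * (C * rho ^+ i) * B by ring.
  apply: ler_pM; rewrite ?op_norm_ge0//; apply: le_trans (op_normM _ _) _.
  apply: ler_pM; rewrite ?op_norm_ge0// op_norm_distC.
  by apply: hol => j ji; rewrite !coord_shift xy//; lia.
- by rewrite invmxK (mulrC (op_norm _)) hlt.
- by rewrite invmxK.
Qed.

Lemma sdiff0 y x : sdiff 0 y x = 1%:M.
Proof. by rewrite /sdiff !cocycle0 mulmx1 invmx1. Qed.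

Lemma udiff0 y x : udiff 0 y x = 1%:M.
Proof. by rewrite /udiff !cocycle0 mulmx1 invmx1. Qed.

Lemma udiffE n y x : udiff n y x =
  cocycle A n%:Z (shift (- n%:Z) y) *m invmx (cocycle A n%:Z (shift (- n%:Z) x)).
Proof. by have uA := bun_unit bA; rewrite /udiff !cocycleN// invmxK. Qed.

Lemma holonomy_bounded : exists2 K, 1 <= K &
  (forall x y n, (forall i : int, 0 <= i -> coord x i = coord y i) ->
     op_norm (sdiff n y x) <= K) /\
  (forall x y n, (forall i : int, i < 0 -> coord x i = coord y i) ->
     op_norm (udiff n y x) <= K).
Proof.
have [K K0 hK] := sdiff_cauchy; have [K' K'0 hK'] := udiff_cauchy.
exists (1 + K + K'); first by rewrite -addrA lerDl addr_ge0.
split => x y n xy.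
- rewrite -[sdiff n y x](subrK (sdiff 0 y x)).
  apply: le_trans (op_normD _ _) _; rewrite sdiff0 addrC.
  rewrite -addrA lerD ?op_norm1_le// -[leLHS]addr0 lerD// -[K]mulr1 -(expr0 theta).
  by rewrite -(sdiff0 y x) hK.
- rewrite -[udiff n y x](subrK (udiff 0 y x)).
  apply: le_trans (op_normD _ _) _; rewrite udiff0 addrC.
  rewrite -addrA lerD ?op_norm1_le// -[leLHS]add0r lerD// -[K']mulr1 -(expr0 theta).
  by rewrite -(udiff0 y x) hK'.
Qed.

(* The intermediate point shares the past of x and the future of y, so the two
   cocycles differ from its own by a stable and an unstable holonomy. *)
Lemma bounded_distortion : exists2 K, 1 <= K & forall x y n, word n x = word n y ->
  op_norm (cocycle A n%:Z x) <= K * op_norm (cocycle A n%:Z y).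
Proof.
have [K K1 [hs hu]] := holonomy_bounded; have K0 : 0 <= K by apply: le_trans K1.
exists (K * K) => [|x y [|n] xy]; first by rewrite -[1]mulr1 ler_pM.
  by rewrite !cocycle0 ler_peMl ?op_norm_ge0// -[1]mulr1 ler_pM.
have /eq_wordP h := xy; have uA := bun_unit bA.
have [w [wx wy]] : exists z, (forall i : int, i <= n -> coord z i = coord x i) /\
    (forall i : int, n%:Z <= i -> coord z i = coord y i).
  by apply: splice; apply: h.
have wy' (i : int) : 0 <= i -> coord w i = coord y i.
  move=> i0; have [|] := lerP n%:Z i; first exact: wy.
  by move=> ni; rewrite wx ?(ltW ni)//; case: i i0 ni => // i _ ni; apply: h; lia.
have -> : cocycle A n.+1%:Z x = udiff n.+1 (shift n.+1 x) (shift n.+1 w) *m cocycle A n.+1%:Z w.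
  by rewrite udiffE !shift_shift addNr !shift0 mulmxKV// cocycle_unit.
have -> : cocycle A n.+1%:Z w = cocycle A n.+1%:Z y *m sdiff n.+1 y w.
  by rewrite /sdiff mulmxA mulmxV ?mul1mx// cocycle_unit.
apply: le_trans (op_normM _ _) _; rewrite -mulrA ler_pM ?op_norm_ge0//.
  by apply: hu => i i0; rewrite !coord_shift wx//; lia.
rewrite mulrC; apply: le_trans (op_normM _ _) _.
by rewrite ler_wpM2l ?op_norm_ge0// hs.
Qed.

End holonomies.

End cocycle_bounds.

(** * Quasi-multiplicativity of typical cocycles *)

Section interpolation.
Context {R : realType} {k : nat}.
Variables (P M : 'M[R]_k) (lam : 'I_k -> R) (v : 'I_k -> 'cV[R]_k).
Hypothesis lam_inj : injective lam.
Hypothesis v_eigen : forall i, v i != 0 /\ P *m v i = lam i *: v i.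
Hypothesis Mv : twisting M v.
Hypothesis k_gt0 : (0 < k)%N.

Let pow i := mprod (fun=> P) i.

Let lagrange s : {poly R} :=
  \prod_(t < k | t != s) ((lam s - lam t)^-1 *: ('X - (lam t)%:P)).

Let size_lagrange s : (size (lagrange s) <= k)%N.
Proof.
apply: leq_trans (size_poly_prod_leq _ _) _.
apply: (@leq_trans ((\sum_(t < k | t != s) 2).+1 - #|[pred t | t != s]|)%N).
  rewrite leq_sub2r// ltnS; apply: leq_sum => t _.
  by apply: leq_trans (size_scale_leq _ _) _; rewrite size_XsubC.
rewrite sum_nat_const.
have -> : #|[pred t | t != s]| = k.-1.
  by rewrite -[RHS](congr1 predn (card_ord k)) -(cardC1 s); exact: eq_card.
by move: k_gt0; lia.
Qed.

Let horner_lagrange s t : (lagrange s).[lam t] = (s == t)%:R.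
Proof.
rewrite horner_prod; have [<-|st] := eqVneq s t.
  rewrite big1// => i si; rewrite hornerZ hornerXsubC mulVf// subr_eq0.
  by rewrite (inj_eq lam_inj) eq_sym.
by rewrite (bigD1 t) ?(eq_sym t)//= hornerZ hornerXsubC subrr mulr0 mul0r.
Qed.

(** The spectral projection of [P] onto the line of [v s], written as a polynomial in [P]. *)
Let E s := \sum_(i < k) (lagrange s)`_i *: pow i.

Let pow_v i t : pow i *m v t = lam t ^+ i *: v t.
Proof.
elim: i => [|i IH] /=; first by rewrite mul1mx scale1r.
by rewrite -mulmxA IH -scalemxAr (v_eigen t).2 scalerA exprSr.
Qed.

Let E_v s t : E s *m v t = (s == t)%:R *: v t.
Proof.
rewrite -horner_lagrange (horner_coef_wide _ (size_lagrange s)).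
rewrite mulmx_suml scaler_suml; apply: eq_bigr => i _.
by rewrite -scalemxAl pow_v scalerA.
Qed.

Let V := \matrix_(i < k, j < k) v j i 0.

Let mulV (c : 'cV[R]_k) : V *m c = \sum_t c t 0 *: v t.
Proof.
apply/colP => i; rewrite mxE summxE; apply: eq_bigr => t _.
by rewrite !mxE mulrC.
Qed.

Let colV t : V *m delta_mx t 0 = v t.
Proof.
rewrite mulV (bigD1 t)//= big1 ?addr0 ?mxE ?eqxx ?scale1r// => i it.
by rewrite mxE (negPf it) scale0r.
Qed.

Let V_unit : V \in unitmx.
Proof.
rewrite -unitmx_tr unitmxE unitfE; apply/negP => /det0P[c c0 cV].
have Vc : V *m c^T = 0 by rewrite -[V]trmxK -trmx_mul cV trmx0.
case/negP: c0; apply/eqP/rowP => s; rewrite mxE.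
have : E s *m (V *m c^T) = 0 by rewrite Vc mulmx0.
rewrite mulV mulmx_sumr (bigD1 s)//= big1 ?addr0 => [|t ts].
  rewrite -scalemxAr E_v eqxx scale1r => /eqP; rewrite scaler_eq0.
  by rewrite (negPf (v_eigen s).1) orbF mxE => /eqP.
by rewrite -scalemxAr E_v eq_sym (negPf ts) scale0r scaler0.
Qed.

Let E_V s : E s = V *m delta_mx s s *m invmx V.
Proof.
apply: (can_inj (mulmxK V_unit)); rewrite mulmxKV//.
apply/row_matrixP => i; apply/rowP => t; rewrite !mxE.
have /colP/(_ i) := E_v s t; rewrite mxE => E1.
under eq_bigr do rewrite [V _ _]mxE.
rewrite E1 mxE (bigD1 s)//= big1 => [|j js]; last by rewrite !mxE (negPf js) mulr0.
by rewrite !mxE eqxx addr0 eq_sym mulrC; case: eqP => [->//|]; rewrite ?mulr0 ?mul0r.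
Qed.

(** The matrix of [M] in the eigenbasis of [P]. Twisting says exactly that none of its entries
    vanishes. *)
Let Psi := invmx V *m M *m V.

Let Psi_neq0 i j : Psi j i != 0.
Proof.
apply/eqP => Pji; case/negP: (Mv i j).
have -> : M *m v i = \sum_l Psi l i *: v l.
  have -> : M *m v i = V *m (Psi *m delta_mx i 0).
    by rewrite /Psi -!mulmxA mulKVmx// colV.
  rewrite mulV; apply: eq_bigr => l _; congr (_ *: _).
  rewrite mxE (bigD1 i)//= big1 ?addr0 ?mxE ?eqxx ?mulr1// => m mi.
  by rewrite [delta_mx _ _ _ _]mxE (negPf mi) mulr0.
rewrite rpred_sum// => l _; have [->|lj] := eqVneq l j.
  by rewrite Pji scale0r mem0v.
apply: memvZ; apply: memv_span; apply/mapP; exists l => //.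
by rewrite mem_filter lj mem_enum.
Qed.

Let max_entry (G : 'M[R]_k) : exists a b, op_norm G <= k%:R * k%:R * `|G a b|.
Proof.
pose p0 := (Ordinal k_gt0, Ordinal k_gt0).
have [[a b] _ h] := @Order.TotalTheory.arg_maxP _ R _ p0 xpredT
  (fun p : 'I_k * 'I_k => `|G p.1 p.2|) isT.
by exists a, b; apply: op_norm_le_entries => i j; exact: (h (i, j)).
Qed.

(* Lagrange interpolation at the eigenvalues recovers each spectral block
   [E s *m M *m E t] from the matrices [pow i *m M *m pow j], i, j < k. *)
Lemma interpolation_lower_bound : exists2 c : R, 0 < c & forall G' G : 'M[R]_k,
  exists i j : 'I_k, c * (op_norm G' * op_norm G) <=
    op_norm (G' *m (mprod (fun=> P) i *m M *m mprod (fun=> P) j) *m G).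
Proof.
pose S := \sum_s \sum_(i < k) `|(lagrange s)`_i|.
have S_ge0 : 0 <= S by apply: sumr_ge0 => s _; exact: sumr_ge0.
have leS s : \sum_(i < k) `|(lagrange s)`_i| <= S.
  by rewrite /S [leRHS](bigD1 s)//= lerDl sumr_ge0// => t _; exact: sumr_ge0.
pose p0 := (Ordinal k_gt0, Ordinal k_gt0).
have [[a0 b0] _ hmin] := @Order.TotalTheory.arg_minP _ R _ p0 xpredT
  (fun p : 'I_k * 'I_k => `|Psi p.1 p.2|) isT.
pose mu := `|Psi a0 b0|; have mu0 : 0 < mu by rewrite normr_gt0.
have k0 : 0 < k%:R :> R by rewrite ltr0n.
pose D := k%:R ^+ 4 * (1 + op_norm (invmx V)) * (1 + op_norm V).
have n1 (N : 'M[R]_k) : 0 < 1 + op_norm N by rewrite ltr_pwDl// op_norm_ge0.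
have D0 : 0 < D by rewrite !mulr_gt0 ?exprn_gt0.
(* [mu] is the least absolute value of an entry of [Psi], [S] bounds the Lagrange coefficients and
   [D] the change to the eigenbasis. The [+ 1] makes the final contradiction strict. *)
exists (mu / (D * (S ^+ 2 + 1))).
  by rewrite divr_gt0// mulr_gt0// ltr_wpDl// sqr_ge0.
move=> G' G; apply: contrapT => h.
pose x := mu / (D * (S ^+ 2 + 1)) * (op_norm G' * op_norm G).
have {}h i j : op_norm (G' *m (pow i *m M *m pow j) *m G) < x \/ ~ ((i < k) && (j < k))%N.
  have [/andP[ik jk]|] := boolP ((i < k) && (j < k))%N; [left|by right].
  rewrite ltNge; apply/negP => xl.
  by apply: h; exists (Ordinal ik), (Ordinal jk).
have {}h (i j : 'I_k) : op_norm (G' *m (pow i *m M *m pow j) *m G) < x.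
  by case: (h i j); rewrite ?ltn_ord.
(* The largest entries of the outer factors lie in a column [s] and a row [t]. Between the blocks
   [s] and [t] the entry [(a, b)] of the product is a single term, so nothing can cancel. *)
have [a [s hs]] := max_entry (G' *m V).
have [t [b ht]] := max_entry (invmx V *m G).
have up : `|(G' *m (E s *m M *m E t) *m G) a b| <= S ^+ 2 * x.
  apply: le_trans (le_op_norm_entry _ _ _) _.
  have -> : G' *m (E s *m M *m E t) *m G = \sum_(i < k) \sum_(j < k)
     ((lagrange s)`_i * (lagrange t)`_j) *: (G' *m (pow i *m M *m pow j) *m G).
    rewrite {1}/E !mulmx_suml mulmx_sumr mulmx_suml; apply: eq_bigr => i _.
    rewrite {1}/E mulmx_sumr mulmx_sumr mulmx_suml; apply: eq_bigr => j _.
    by rewrite -!(scalemxAl, scalemxAr) scalerA mulrC.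
  apply: le_trans (op_norm_sum _ _ _) _.
  apply: (@le_trans _ _ (\sum_(i < k) \sum_(j < k)
      (`|(lagrange s)`_i| * `|(lagrange t)`_j|) * x)).
    apply: ler_sum => i _; apply: le_trans (op_norm_sum _ _ _) _.
    apply: ler_sum => j _; apply: le_trans (op_normZ_le _ _) _.
    by rewrite normrM ler_wpM2l ?mulr_ge0// ltW.
  under eq_bigr do rewrite -mulr_suml -mulr_sumr.
  rewrite -mulr_suml -mulr_suml expr2 ler_wpM2r//.
    by apply: le_trans (op_norm_ge0 _) (ltW (h (Ordinal k_gt0) (Ordinal k_gt0))).
  by apply: ler_pM; rewrite ?leS ?sumr_ge0.
have lo : mu * (op_norm G' * op_norm G) <= D * `|(G' *m (E s *m M *m E t) *m G) a b|.
  have -> : G' *m (E s *m M *m E t) *m G =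
     (G' *m V) *m delta_mx s s *m Psi *m delta_mx t t *m (invmx V *m G).
    by rewrite !E_V /Psi !mulmxA.
  have -> : ((G' *m V) *m delta_mx s s *m Psi *m delta_mx t t *m (invmx V *m G)) a b =
     (G' *m V) a s * Psi s t * (invmx V *m G) t b.
    set G1 := G' *m V; set G2 := invmx V *m G.
    rewrite mxE (bigD1 t)//= big1 ?addr0 => [|l lt]; last first.
      rewrite mxE big1 ?mul0r// => m _.
      by rewrite [delta_mx _ _ _ _]mxE (negPf lt) andbF mulr0.
    congr (_ * _); rewrite mxE (bigD1 t)//= big1 ?addr0 => [|l lt]; last first.
      by rewrite [delta_mx _ _ _ _]mxE (negPf lt) mulr0.
    rewrite [delta_mx _ _ _ _]mxE !eqxx mulr1.
    rewrite mxE (bigD1 s)//= big1 ?addr0 => [|l lt]; last first.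
      rewrite mxE big1 ?mul0r// => m _.
      by rewrite [delta_mx _ _ _ _]mxE (negPf lt) andbF mulr0.
    congr (_ * _); rewrite mxE (bigD1 s)//= big1 ?addr0 => [|l lt]; last first.
      by rewrite [delta_mx _ _ _ _]mxE (negPf lt) mulr0.
    by rewrite [delta_mx _ _ _ _]mxE !eqxx mulr1.
  rewrite !normrM.
  have h1 : op_norm G' <= op_norm (G' *m V) * (1 + op_norm (invmx V)).
    rewrite -{1}[G'](mulmxK V_unit); apply: le_trans (op_normM _ _) _.
    by rewrite ler_wpM2l ?op_norm_ge0// lerDr.
  have h2 : op_norm G <= op_norm (invmx V *m G) * (1 + op_norm V).
    rewrite -{1}[G](mulKVmx V_unit); apply: le_trans (op_normM _ _) _.
    by rewrite mulrC ler_wpM2l ?op_norm_ge0// lerDr.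
  have h3 : op_norm G' <= k%:R * k%:R * `|(G' *m V) a s| * (1 + op_norm (invmx V)).
    by apply: le_trans h1 _; rewrite ler_wpM2r// ltW.
  have h4 : op_norm G <= k%:R * k%:R * `|(invmx V *m G) t b| * (1 + op_norm V).
    by apply: le_trans h2 _; rewrite ler_wpM2r// ltW.
  apply: (@le_trans _ _ (`|Psi s t| *
     ((k%:R * k%:R * `|(G' *m V) a s| * (1 + op_norm (invmx V))) *
      (k%:R * k%:R * `|(invmx V *m G) t b| * (1 + op_norm V))))).
    apply: ler_pM.
    - exact: ltW.
    - by rewrite mulr_ge0 ?op_norm_ge0.
    - exact: (hmin (s, t) isT).
    - by apply: ler_pM; rewrite ?op_norm_ge0.
  by rewrite le_eqVlt; apply/orP; left; apply/eqP; rewrite /D; ring.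
have x0 : 0 < x by apply: le_lt_trans (op_norm_ge0 _) (h (Ordinal k_gt0) (Ordinal k_gt0)).
have S1 : 0 < S ^+ 2 + 1 by rewrite ltr_wpDl// sqr_ge0.
have xE : mu * (op_norm G' * op_norm G) = D * ((S ^+ 2 + 1) * x).
  by rewrite /x; field; rewrite !gt_eqF.
move: lo; rewrite xE; apply/negP; rewrite -ltNge ltr_pM2l//.
apply: le_lt_trans up _; rewrite mulrDl mul1r ltrDl//.
Qed.

End interpolation.

Section matrix_limits.
Context {R : realType} {k : nat}.

Lemma mulmx_close (beta e : R) : 0 < e -> exists2 d : R, 0 < d &
  forall a b a' b' : 'M[R]_k, op_norm b <= beta -> op_norm b' <= beta ->
  op_norm (a - b) < d -> op_norm (a' - b') < d -> op_norm (a *m a' - b *m b') < e.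
Proof.
move=> e0; pose b1 := Num.max beta 0; have b10 : 0 <= b1 by rewrite le_max lexx orbT.
exists (Num.min 1 (e / (2 * (b1 + 1)))).
  by rewrite lt_min ltr01 divr_gt0// mulr_gt0// ltr_wpDl.
move=> a b a' b' hb hb'; rewrite !lt_min => /andP[_ h1] /andP[h2 h3].
have -> : a *m a' - b *m b' = (a - b) *m a' + b *m (a' - b').
  by rewrite mulmxBl mulmxBr addrA subrK.
have ha' : op_norm a' <= b1 + 1.
  rewrite -(subrK b' a') addrC; apply: le_trans (op_normD _ _) _.
  by apply: lerD; [rewrite le_max hb'|exact: ltW].
have hb1 : op_norm b <= b1 + 1.
  by rewrite (@le_trans _ _ b1) ?lerDl// le_max hb.
have p0 : 0 < b1 + 1 by rewrite ltr_wpDl.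
apply: le_lt_trans (op_normD _ _) _; rewrite [ltRHS](splitr e); apply: ltrD.
  apply: le_lt_trans (op_normM _ _) _.
  apply: (@le_lt_trans _ _ (op_norm (a - b) * (b1 + 1))).
    by rewrite ler_wpM2l ?op_norm_ge0.
  by rewrite -ltr_pdivlMr//; apply: lt_le_trans h1 _; rewrite invfM mulrA.
apply: le_lt_trans (op_normM _ _) _.
apply: (@le_lt_trans _ _ ((b1 + 1) * op_norm (a' - b'))).
  by rewrite ler_wpM2r ?op_norm_ge0.
by rewrite mulrC -ltr_pdivlMr//; apply: lt_le_trans h3 _; rewrite invfM mulrA.
Qed.

Lemma geometric_cauchy_lim (E : nat -> 'M[R]_k) (K theta : R) :
  0 <= K -> 0 <= theta -> theta < 1 ->
  (forall m n, (m <= n)%N -> op_norm (E n - E m) <= K * theta ^+ m) ->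
  forall m, op_norm (lim (E @ \oo) - E m) <= K * theta ^+ m.
Proof.
move=> K0 t0 t1 hE.
have small e : 0 < e -> exists N, forall n, (N <= n)%N -> K * theta ^+ n < e.
  move=> e0; have : (fun m => K * theta ^+ m) @ \oo --> (0 : R).
    by rewrite -(mulr0 K); apply: cvgMr; apply: cvg_expr; rewrite ger0_norm.
  move=> /cvgrPdist_lt /(_ _ e0) [N _ hN]; exists N => n Nn.
  by apply: le_lt_trans (hN n Nn); rewrite sub0r normrN ler_norm.
have cvE i j : cvg ((fun n => E n i j) @ \oo).
  apply: cauchy_cvg; apply: cauchy_exP => e e0.
  have [N hN] := small e e0; exists (E N i j); exists N => // n /= Nn.
  rewrite -ball_normE /=; apply: le_lt_trans (hN N (leqnn N)).
  rewrite distrC; apply: le_trans (hE N n Nn).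
  by have := le_op_norm_entry (E n - E N) i j; rewrite !mxE.
pose L := \matrix_(i, j) lim ((fun n => E n i j) @ \oo).
have EL e : 0 < e -> \forall n \near \oo, forall i j, `|L i j - E n i j| < e.
  move=> e0; apply: filter_forall => i; apply: filter_forall => j.
  by rewrite mxE; have /cvgrPdist_lt/(_ _ e0) := cvE i j.
have -> : lim (E @ \oo) = L.
  apply/cvg_lim; first exact: norm_hausdorff.
  apply/cvg_ballP => e e0; apply: filterS (EL e e0) => n h.
  by split => // i j; rewrite -ball_normE /=.
move=> m; apply/ler_addgt0Pr => e e0.
have e1 : 0 < e / (k%:R * k%:R + 1) by rewrite divr_gt0// ltr_wpDl// mulr_ge0.
have [N _ /(_ (maxn N m) (leq_maxl _ _)) hN] := EL _ e1.
rewrite -(subrK (E (maxn N m)) L) -addrA; apply: le_trans (op_normD _ _) _.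
rewrite [leRHS]addrC; apply: lerD; last by apply: hE; exact: leq_maxr.
apply: le_trans (op_norm_le_entries (c := e / (k%:R * k%:R + 1)) _) _.
  by move=> i j; rewrite [_ i j]mxE [X in _ + X]mxE; exact: ltW.
rewrite mulrCA ler_piMr ?ltW// ltr_pdivrMr ?mul1r ?ltrDl//.
Qed.

End matrix_limits.

Section quasi_multiplicativity.
Context {R : realType} {X : sft R} {k : nat}.
Local Notation Sigma := (shift_space X).
Implicit Types (x y z p q w : Sigma).
Variables (A : Sigma -> 'M[R]_k) (C B rho theta : R).
Hypothesis bA : bunched A C B rho theta.

Let uA : forall x, A x \in unitmx. Proof. exact: (bun_unit bA). Qed.

Lemma agree_shift (s : int) m x y :
  agree x y (m + `|s|)%N -> agree (shift s x) (shift s y) m.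
Proof. by move=> xy i im; rewrite !coord_shift; apply: xy; lia. Qed.

Lemma cocycle_continuous (s : int) n x e : 0 < e -> exists m0, forall m y, (m0 <= m)%N ->
  agree x y m ->
  op_norm (cocycle A n%:Z (shift s y) - cocycle A n%:Z (shift s x)) < e.
Proof.
elim: n e => [|n IH] e e0; first by exists 0%N => m y _ _; rewrite subrr op_norm0.
pose beta := Num.max B (B ^+ n).
have [d d0 hd] := @mulmx_close R k beta e e0.
have [m0 h0] := IH d d0.
have [m1 h1] := exp_rho_le_eps (bun_C_ge0 bA) (bun_rho_gt0 bA) (bun_rho_lt1 bA) d0.
exists (maxn m0 (m1 + `|n%:Z + s|)) => m y hm xy.
rewrite !cocycleS !shift_shift; apply: hd.
- by rewrite le_max (bun_le bA).
- rewrite le_max (op_norm_cocycle_le _ _ (bun_B_ge0 bA)) ?orbT//.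
  exact: (bun_le bA).
- rewrite op_norm_distC; apply: le_lt_trans (h1 m1 (leqnn _)).
  apply: (bun_holder bA); apply: agree_shift; apply: agreeW xy.
  by move: hm; rewrite geq_max => /andP[].
- by apply: (h0 m) => //; move: hm; rewrite geq_max => /andP[].
Qed.

Lemma inv_cocycle_le n x : op_norm (invmx (cocycle A n%:Z x)) <= B ^+ n.
Proof.
elim: n => [|n IH]; first by rewrite /= invmx1 op_norm1_le.
rewrite /= invmxM ?uA ?(cocycle_unit n x uA)// exprSr.
apply: le_trans (op_normM _ _) _; apply: ler_pM; rewrite ?op_norm_ge0//.
exact: (bun_inv_le bA).
Qed.

Lemma inv_cocycle_continuous (s : int) n x e : 0 < e -> exists m0, forall m y, (m0 <= m)%N ->
  agree x y m ->
  op_norm (invmx (cocycle A n%:Z (shift s y)) - invmx (cocycle A n%:Z (shift s x))) < e.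
Proof.
move=> e0; have B0 := bun_B_ge0 bA.
have d0 : 0 < e / (B ^+ n * B ^+ n + 1).
  by rewrite divr_gt0// ltr_wpDl// mulr_ge0// exprn_ge0.
have [m0 h0] := cocycle_continuous s n x d0.
exists m0 => m y mm xy; rewrite invmx_sub ?cocycle_unit//.
apply: le_lt_trans (op_normM _ _) _.
apply: (@le_lt_trans _ _ (B ^+ n * op_norm (cocycle A n (shift s y) - cocycle A n (shift s x)) * B ^+ n)).
  apply: ler_pM (op_norm_ge0 _) (op_norm_ge0 _) _ (inv_cocycle_le _ _).
  apply: le_trans (op_normM _ _) _; rewrite op_norm_distC.
  exact: ler_wpM2r (op_norm_ge0 _) _ _ (inv_cocycle_le _ _).
rewrite mulrAC; have := h0 m y mm xy.
rewrite ltr_pdivlMr; last by rewrite ltr_wpDl// mulr_ge0// exprn_ge0.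
by apply: le_lt_trans; rewrite mulrC ler_wpM2l ?op_norm_ge0// lerDl.
Qed.

(** The bound has to hold for all times [n] at once. Holonomies converge at a rate independent of
    the points, so it suffices to compare them at one fixed time [s], where only finitely many
    coordinates matter up to a small error. *)
Lemma udiff_close z p e : (forall i : int, i < 0 -> coord p i = coord z i) -> 0 < e ->
  exists m0, forall m w w' n, (m0 <= m)%N -> (m <= n)%N -> agree z w m -> agree p w' m ->
  (forall i : int, i < 0 -> coord w' i = coord w i) ->
  op_norm (udiff A n w w' - Hu_loc A z p) < e.
Proof.
move=> pz e0; have [K K0 hK] := udiff_cauchy bA.
have t0 := bun_theta_ge0 bA; have t1 := bun_theta_lt1 bA.
have lim_close := @geometric_cauchy_lim _ _ (fun n => udiff A n z p) K theta K0 t0 t1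
  (fun m n => hK p z m n pz).
have e3 : 0 < e / 3 by rewrite divr_gt0.
have [s hs] : exists s, K * theta ^+ s < e / 3.
  have : (fun m => K * theta ^+ m) @ \oo --> (0 : R).
    by rewrite -(mulr0 K); apply: cvgMr; apply: cvg_expr; rewrite ger0_norm.
  move=> /cvgrPdist_lt /(_ _ e3) [N _ hN]; exists N.
  by apply: le_lt_trans (hN N (leqnn N)); rewrite sub0r normrN ler_norm.
have B0 := bun_B_ge0 bA.
have [d d0 hd] := @mulmx_close R k (B ^+ s) (e / 3) e3.
have [m1 h1] := cocycle_continuous (- s%:Z) s z d0.
have [m2 h2] := inv_cocycle_continuous (- s%:Z) s p d0.
exists (maxn s (maxn m1 m2)) => m w w' n; rewrite !geq_max => /and3P[sm m1m m2m] mn zw pw ww.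
rewrite -(subrK (udiff A s w w') (udiff A n w w')) -addrA.
rewrite -[X in _ + X](subrKA (udiff A s z p)) (_ : e = e / 3 + (e / 3 + e / 3)); last by field.
apply: le_lt_trans (op_normD _ _) _; apply: ltrD.
  by apply: le_lt_trans hs; apply: hK => //; exact: leq_trans mn.
apply: le_lt_trans (op_normD _ _) _; apply: ltrD.
  rewrite !(udiffE bA); apply: hd; rewrite ?inv_cocycle_le//.
  - by apply: op_norm_cocycle_le => //; exact: (bun_le bA).
  - exact: h1 m1m zw.
  - exact: h2 m2m pw.
by rewrite op_norm_distC; apply: le_lt_trans hs; exact: lim_close.
Qed.

Lemma sdiff_close z p e : (forall i : int, 0 <= i -> coord z i = coord p i) -> 0 < e ->
  exists m0, forall m w w' n, (m0 <= m)%N -> (m <= n)%N -> agree z w m -> agree p w' m ->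
  (forall i : int, 0 <= i -> coord w i = coord w' i) ->
  op_norm (sdiff A n w' w - Hs_loc A p z) < e.
Proof.
move=> pz e0; have [K K0 hK] := sdiff_cauchy bA.
have t0 := bun_theta_ge0 bA; have t1 := bun_theta_lt1 bA.
have lim_close := @geometric_cauchy_lim _ _ (fun n => sdiff A n p z) K theta K0 t0 t1
  (fun m n => hK z p m n pz).
have e3 : 0 < e / 3 by rewrite divr_gt0.
have [s hs] : exists s, K * theta ^+ s < e / 3.
  have : (fun m => K * theta ^+ m) @ \oo --> (0 : R).
    by rewrite -(mulr0 K); apply: cvgMr; apply: cvg_expr; rewrite ger0_norm.
  move=> /cvgrPdist_lt /(_ _ e3) [N _ hN]; exists N.
  by apply: le_lt_trans (hN N (leqnn N)); rewrite sub0r normrN ler_norm.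
have B0 := bun_B_ge0 bA.
have [d d0 hd] := @mulmx_close R k (B ^+ s) (e / 3) e3.
have [m1 h1] := cocycle_continuous 0 s z d0.
have [m2 h2] := inv_cocycle_continuous 0 s p d0.
exists (maxn s (maxn m1 m2)) => m w w' n; rewrite !geq_max => /and3P[sm m1m m2m] mn zw pw ww.
rewrite -(subrK (sdiff A s w' w) (sdiff A n w' w)) -addrA.
rewrite -[X in _ + X](subrKA (sdiff A s p z)) (_ : e = e / 3 + (e / 3 + e / 3)); last by field.
apply: le_lt_trans (op_normD _ _) _; apply: ltrD.
  by apply: le_lt_trans hs; apply: hK => //; exact: leq_trans mn.
apply: le_lt_trans (op_normD _ _) _; apply: ltrD.
  apply: hd; rewrite ?inv_cocycle_le//.
  - by apply: op_norm_cocycle_le => //; exact: (bun_le bA).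
  - by have := h2 m w' m2m pw; rewrite !shift0.
  - by have := h1 m w m1m zw; rewrite !shift0.
by rewrite op_norm_distC; apply: le_lt_trans hs; exact: lim_close.
Qed.

End quasi_multiplicativity.

Lemma sum7_ge (R : realDomainType) (a b c d e f g : R) :
  0 <= a -> 0 <= b -> 0 <= c -> 0 <= d -> 0 <= e -> 0 <= f -> 0 <= g ->
  [/\ a <= a + b + c + d + e + f + g, b <= a + b + c + d + e + f + g,
      c <= a + b + c + d + e + f + g & d <= a + b + c + d + e + f + g] /\
  [/\ e <= a + b + c + d + e + f + g, f <= a + b + c + d + e + f + g &
      g <= a + b + c + d + e + f + g].
Proof. by move=> *; split; split; lra. Qed.

Section homoclinic_connection.
Context {R : realType} {X : sft R} {k : nat}.
Local Notation Sigma := (shift_space X).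
Implicit Types (x y z p q w : Sigma).
Variables (A : Sigma -> 'M[R]_k) (C B rho theta : R).
Hypothesis bA : bunched A C B rho theta.
Hypothesis k_gt0 : (0 < k)%N.
Variable t : nat.
Hypothesis glue : forall x y, exists z,
  (forall i : int, i < 0 -> coord z i = coord x i) /\
  (forall i : int, 0 <= i -> coord z (i + t%:Z) = coord y i).
Variables (p z : Sigma) (n0 c0 : nat).
Hypothesis n0_gt0 : (0 < n0)%N.
Hypothesis p_per : shift n0%:Z p = p.
Let r0 := (c0 * n0)%N.
Hypothesis z_past : forall i : int, i < 0 -> coord z i = coord p i.
Hypothesis z_future : forall i : int, 0 <= i -> coord z (i + r0%:Z) = coord p i.

Let P := cocycle A n0%:Z p.
(** The excursion along [z] as a map of the fiber over [p]: unstable holonomy from [p] to [z], the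
    cocycle for time [r0], stable holonomy back to [p]. Since [r0] is a multiple of the period, [z]
    returns to the orbit of [p] in phase. *)
Let M := Hs_loc A p (shift r0%:Z z) *m cocycle A r0%:Z z *m Hu_loc A z p.

Variables (lam : 'I_k -> R) (v : 'I_k -> 'cV[R]_k).
Hypothesis lam_inj : injective lam.
Hypothesis v_eigen : forall i, v i != 0 /\ P *m v i = lam i *: v i.
Hypothesis M_twisting : twisting M v.

Let uA : forall x, A x \in unitmx. Proof. exact: (bun_unit bA). Qed.

Let p_perM j i : coord p (i + (j * n0)%N%:Z) = coord p i.
Proof.
elim: j i => [|j IH] i; first by rewrite mul0n addr0.
rewrite mulSn addnC PoszD addrA -(coord_shift n0%:Z) p_per; exact: IH.
Qed.

Let p_perN j i : coord p (i - (j * n0)%N%:Z) = coord p i.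
Proof. by rewrite -(p_perM j) subrK. Qed.

Let shift_p j : shift (j * n0)%N%:Z p = p.
Proof. by apply: coord_inj => i; rewrite coord_shift p_perM. Qed.

Let cocycle_p j : cocycle A (j * n0)%N%:Z p = mprod (fun=> P) j.
Proof. by elim: j => // j IH; rewrite mulSn addnC cocycleD shift_p IH. Qed.

(** The connecting orbit only shadows [p] and [z]. Agreement on [m0] coordinates makes its matrices
    as close as desired to the ideal ones, uniformly in the finitely many [i] and [j] and in the
    times [n] and [m]. *)
Let bracket_close e : 0 < e -> exists m0, (0 < m0)%N /\ forall (i j : 'I_k) w1 w2 w3 w4 w5 n m,
  (m0 <= n)%N -> (m0 <= m)%N ->
  agree p w1 m0 -> agree (shift r0%:Z z) w2 m0 -> agree z w3 m0 -> agree p w4 m0 -> agree p w5 m0 ->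
  (forall i : int, 0 <= i -> coord w2 i = coord w1 i) ->
  (forall i : int, i < 0 -> coord w4 i = coord w3 i) ->
  op_norm (cocycle A (i * n0)%N%:Z w1 *m sdiff A m w1 w2 *m cocycle A r0%:Z w3 *m
      udiff A n w3 w4 *m cocycle A (j * n0)%N%:Z w5 -
    mprod (fun=> P) i *m M *m mprod (fun=> P) j) < e.
Proof.
move=> e0.
pose hs := Hs_loc A p (shift r0%:Z z); pose hu := Hu_loc A z p; pose c := cocycle A r0%:Z z.
pose b0 := \sum_(i < k) op_norm (mprod (fun=> P) i).
have b0P (i : 'I_k) : op_norm (mprod (fun=> P) i) <= b0.
  by rewrite /b0 (bigD1 i)//= lerDl sumr_ge0// => l _; exact: op_norm_ge0.
have b0_ge0 : 0 <= b0 by apply: sumr_ge0 => i _; exact: op_norm_ge0.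
pose b1 := b0 * op_norm hs; pose b2 := b1 * op_norm c; pose b3 := b2 * op_norm hu.
pose beta := b0 + b1 + b2 + b3 + op_norm hs + op_norm c + op_norm hu.
have b1_ge0 : 0 <= b1 by rewrite mulr_ge0 ?op_norm_ge0.
have b2_ge0 : 0 <= b2 by rewrite mulr_ge0 ?op_norm_ge0.
have b3_ge0 : 0 <= b3 by rewrite mulr_ge0 ?op_norm_ge0.
have hs0 := op_norm_ge0 hs; have hc0 := op_norm_ge0 c; have hu0 := op_norm_ge0 hu.
have [[ge0 ge1 ge2 ge3] [ge4 ge5 ge6]] := sum7_ge b0_ge0 b1_ge0 b2_ge0 b3_ge0 hs0 hc0 hu0.
have [d4 d40 h4] := @mulmx_close R k beta e e0.
have [d3 d30 h3] := @mulmx_close R k beta _ d40.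
have [d2 d20 h2] := @mulmx_close R k beta _ d30.
have [d1 d10 h1] := @mulmx_close R k beta _ d20.
pose d := Num.min (Num.min d1 d2) (Num.min d3 d4).
have d0 : 0 < d by rewrite !lt_min d10 d20 d30 d40.
have [dd1 dd2 dd3 dd4] : [/\ d <= d1, d <= d2, d <= d3 & d <= d4].
  by split; rewrite !ge_min lexx ?orbT.
have zs : forall i : int, 0 <= i -> coord (shift r0%:Z z) i = coord p i by exact: z_future.
have zu : forall i : int, i < 0 -> coord p i = coord z i by move=> i i0; rewrite z_past.
have [m1 hm1] := sdiff_close bA zs d0.
have [m2 hm2] := udiff_close bA zu d0.
have [m3 hm3] := cocycle_continuous bA 0 r0 z d0.
have /choice[f hf] (i : 'I_k) := cocycle_continuous bA 0 (i * n0) p d0.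
pose m4 := \max_i f i.
have fm4 i : (f i <= m4)%N by exact: leq_bigmax.
exists (maxn 1 (maxn (maxn m1 m2) (maxn m3 m4))); split; first by rewrite leq_max.
set m0 := maxn _ _ => i j w1 w2 w3 w4 w5 n m nm mm pw1 zw2 zw3 pw4 pw5 w12 w34.
have [m01 m02 m03 m04] : [/\ (m1 <= m0)%N, (m2 <= m0)%N, (m3 <= m0)%N & (m4 <= m0)%N].
  by split; rewrite !leq_max leqnn ?orbT.
have c1 : op_norm (cocycle A (i * n0)%N%:Z w1 - mprod (fun=> P) i) < d.
  have := hf i m0 w1 (leq_trans (fm4 i) m04) pw1.
  by rewrite !shift0 -cocycle_p.
have c2 : op_norm (sdiff A m w1 w2 - hs) < d by exact: (hm1 m0).
have c3 : op_norm (cocycle A r0%:Z w3 - c) < d.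
  by have := hm3 m0 w3 m03 zw3; rewrite !shift0.
have c4 : op_norm (udiff A n w3 w4 - hu) < d by exact: (hm2 m0).
have c5 : op_norm (cocycle A (j * n0)%N%:Z w5 - mprod (fun=> P) j) < d.
  have := hf j m0 w5 (leq_trans (fm4 j) m04) pw5.
  by rewrite !shift0 -cocycle_p.
have n1 : op_norm (mprod (fun=> P) i *m hs) <= b1.
  exact: le_trans (op_normM _ _) (ler_wpM2r (op_norm_ge0 _) (b0P i)).
have n2 : op_norm (mprod (fun=> P) i *m hs *m c) <= b2.
  exact: le_trans (op_normM _ _) (ler_wpM2r (op_norm_ge0 _) n1).
have n3 : op_norm (mprod (fun=> P) i *m hs *m c *m hu) <= b3.
  exact: le_trans (op_normM _ _) (ler_wpM2r (op_norm_ge0 _) n2).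
have -> : mprod (fun=> P) i *m M = mprod (fun=> P) i *m hs *m c *m hu by rewrite /M !mulmxA.
apply: h4; last exact: lt_le_trans c5 dd4.
- exact: le_trans n3 ge3.
- exact: le_trans (b0P j) ge0.
apply: h3; last exact: lt_le_trans c4 dd3.
- exact: le_trans n2 ge2.
- exact: ge6.
apply: h2; last exact: lt_le_trans c3 dd2.
- exact: le_trans n1 ge1.
- exact: ge5.
apply: h1.
- exact: le_trans (b0P i) ge0.
- exact: ge4.
- exact: lt_le_trans c1 dd1.
- exact: lt_le_trans c2 dd1.
Qed.

Lemma op_norm_unit_mull (N G : 'M[R]_k) c : N \in unitmx -> op_norm (invmx N) <= c ->
  op_norm G <= c * op_norm (N *m G).
Proof.
move=> uN hc; rewrite -{1}(mulKmx uN G); apply: le_trans (op_normM _ _) _.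
by rewrite ler_wpM2r ?op_norm_ge0.
Qed.

Lemma op_norm_unit_mulr (N G : 'M[R]_k) c : N \in unitmx -> op_norm (invmx N) <= c ->
  op_norm G <= c * op_norm (G *m N).
Proof.
move=> uN hc; rewrite -{1}(mulmxK uN G); apply: le_trans (op_normM _ _) _.
by rewrite mulrC ler_wpM2r ?op_norm_ge0.
Qed.

(* The connecting orbit from x to y follows p, the homoclinic orbit z, and p
   again, with l + j and l + i turns around p: the choice of i, j < k is what
   makes the connection efficient for the given x and y. *)
Lemma connection : exists D (c : R), 0 < c /\ forall x y n m, exists w d,
  [/\ (d <= D)%N, forall i : int, i < n%:Z -> coord w i = coord x i,
    forall i : int, 0 <= i -> coord w (i + (n + d)%N%:Z) = coord y i &
    c * (op_norm (cocycle A n%:Z x) * op_norm (cocycle A m%:Z y)) <=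
    op_norm (cocycle A (n + d + m)%N%:Z w)].
Proof.
have [c1 c1_gt0 hc1] := @interpolation_lower_bound _ _ P M lam v lam_inj v_eigen M_twisting k_gt0.
have e0 : 0 < c1 / 2 by rewrite divr_gt0.
have [l [l_gt0 hl]] := bracket_close e0.
have [K K1 hK] := bounded_distortion bA; have K0 : 0 <= K by exact: le_trans K1.
have B0 := bun_B_ge0 bA.
pose s := (t + l * n0)%N.
pose B1 := K * B ^+ s + 1.
have B1_gt0 : 0 < B1 by rewrite ltr_wpDl// mulr_ge0// exprn_ge0.
exists (t + (l + k) * n0 + r0 + (l + k) * n0 + t)%N, (c1 / 2 / (B1 * B1)).
split; first by rewrite !divr_gt0// mulr_gt0.
move=> x y n m.
have [q0 [q0x q0p]] := glue (shift n%:Z x) p.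
have [q1 [q1p q1y]] := glue p y.
pose q := shift (- n%:Z) q0.
pose L (l' : nat) := shift (n + t + l' * n0)%N%:Z q.
pose Rt (l' : nat) := shift (- (l' * n0)%N%:Z) q1.
have Lp l' (i : int) : - (l' * n0)%N%:Z <= i -> coord (L l') i = coord p i.
  move=> hi; rewrite !coord_shift -(p_perM l').
  rewrite -(q0p (i + (l' * n0)%N%:Z)); last by lia.
  by congr (coord q0 _); lia.
have Rp l' (i : int) : i < (l' * n0)%N%:Z -> coord (Rt l') i = coord p i.
  by move=> hi; rewrite !coord_shift q1p ?p_perN//; lia.
(* [G] and [G'] include exactly [l] turns around [p]. The turns [i] and [j] depend on [G] and [G'],
   so they are added afterwards and belong to the bracket. *)
pose G := cocycle A (n + t + l * n0)%N%:Z q.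
pose G' := cocycle A (l * n0 + t + m)%N%:Z (Rt l).
have [i [j hij]] := hc1 G' G.
have ln l' : (0 < l')%N -> (0 < l' * n0)%N by move=> ?; rewrite muln_gt0 n0_gt0 andbT.
have l_le : (l <= l * n0)%N by rewrite leq_pmulr.
pose li := (l + i)%N; pose lj := (l + j)%N.
have li_gt0 : (0 < li * n0)%N by apply: ln; rewrite addn_gt0 l_gt0.
have lj_gt0 : (0 < lj * n0)%N by apply: ln; rewrite addn_gt0 l_gt0.
have lli : (l <= li * n0)%N by apply: leq_trans l_le _; rewrite leq_mul2r leq_addr orbT.
have llj : (l <= lj * n0)%N by apply: leq_trans l_le _; rewrite leq_mul2r leq_addr orbT.
have [u1 [u1L u1z]] : exists u, (forall i : int, i <= -1 -> coord u i = coord (L lj) i) /\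
    (forall i : int, -1 <= i -> coord u i = coord z i).
  by apply: splice; rewrite z_past// Lp//; lia.
have [u [u_le u_ge]] : exists u, (forall i : int, i <= r0%:Z -> coord u i = coord u1 i) /\
    (forall i : int, r0%:Z <= i -> coord u i = coord (shift (- r0%:Z) (Rt li)) i).
  apply: splice; rewrite u1z// coord_shift subrr Rp; last by lia.
  by rewrite -(z_future (lexx _)) add0r.
have uL (a : int) : a < 0 -> coord u a = coord (L lj) a.
  by move=> a0; rewrite u_le; [rewrite u1L//|]; clear -a0; lia.
have uz (a : int) : -1 <= a -> a <= r0%:Z -> coord u a = coord z a.
  by move=> a0 ar; rewrite u_le// u1z.
have uR (a : int) : 0 <= a -> coord (shift r0%:Z u) a = coord (Rt li) a.
  by move=> a0; rewrite coord_shift u_ge ?coord_shift ?addrK//; clear -a0; lia.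
pose n' := (n + t + lj * n0)%N; pose m' := (li * n0 + t + m)%N.
pose w := shift (- n'%:Z) u; pose d := (t + lj * n0 + r0 + li * n0 + t)%N.
have nd : (n + d + m = n' + r0 + m')%N by rewrite /d /n' /m'; clear; lia.
have wq : shift (- n'%:Z) (L lj) = q.
  by rewrite shift_shift addNr shift0.
exists w, d; split.
- rewrite /d !leq_add// leq_mul2r leq_add2l ltnW ?orbT//.
- move=> a an; rewrite coord_shift uL; last by rewrite /n'; clear -an; lia.
  rewrite !coord_shift q0x; last by rewrite /n'; clear -an; lia.
  by rewrite coord_shift; congr (coord x _); rewrite /n'; clear; lia.
- move=> a a0; rewrite -q1y//.
  have -> : coord w (a + (n + d)%N%:Z) = coord (shift r0%:Z u) (a + (li * n0 + t)%N%:Z).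
    by rewrite !coord_shift; congr (coord u _); rewrite /d /n'; clear; lia.
  rewrite uR; last by clear -a0; lia.
  by rewrite coord_shift; congr (coord q1 _); clear; lia.
(* Before the excursion the orbit of [w] is compared with that of [q] by an unstable holonomy, after
   it with that of [Rt li] by a stable one; in between it follows [z]. *)
have E : cocycle A (n + d + m)%N%:Z w =
   G' *m (cocycle A (i * n0)%N%:Z (Rt li) *m sdiff A m' (Rt li) (shift r0%:Z u) *m
     cocycle A r0%:Z u *m udiff A n' u (L lj) *m cocycle A (j * n0)%N%:Z (L l)) *m G.
  rewrite nd (cocycleD A (n' + r0) m') (cocycleD A n' r0).
  have -> : shift (n' + r0)%N%:Z w = shift r0%:Z u by rewrite shift_shift; congr (shift _ u); clear; lia.
  have -> : shift n'%:Z w = u by rewrite shift_shift addrN shift0.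
  have -> : cocycle A n' w = udiff A n' u (L lj) *m cocycle A n'%:Z q.
    by rewrite (udiffE bA) wq mulmxKV// cocycle_unit.
  have -> : cocycle A n'%:Z q = cocycle A (j * n0)%N%:Z (L l) *m G.
    rewrite /n' /lj mulnDl addnA cocycleD //.
  have -> : cocycle A m'%:Z (shift r0%:Z u) = cocycle A m'%:Z (Rt li) *m sdiff A m' (Rt li) (shift r0%:Z u).
    by rewrite /sdiff mulmxA mulmxV ?mul1mx// cocycle_unit.
  have -> : cocycle A m'%:Z (Rt li) = G' *m cocycle A (i * n0)%N%:Z (Rt li).
    have -> : m' = (i * n0 + (l * n0 + t + m))%N by rewrite /m' /li mulnDl; clear; lia.
    rewrite cocycleD; congr (cocycle A _ _ *m _).
    by rewrite shift_shift; congr (shift _ q1); rewrite /li mulnDl; clear; lia.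
  by rewrite !mulmxA.
rewrite E.
set br := _ *m cocycle A (j * n0)%N%:Z (L l).
have br_close : op_norm (br - mprod (fun=> P) i *m M *m mprod (fun=> P) j) < c1 / 2.
  apply: hl => //; clear hc1 hij hK E nd B0 K0 K1 B1_gt0 c1_gt0 e0.
  - by rewrite /n'; lia.
  - by rewrite /m'; lia.
  - by move=> a al; rewrite Rp//; lia.
  - move=> a al; have [a0|a0] := lerP 0 a.
      by rewrite uR// Rp; [rewrite coord_shift z_future|lia].
    rewrite !coord_shift; have [ar|ar] := lerP 0 (a + r0%:Z).
      by rewrite uz//; lia.
    rewrite uL// Lp; last by lia.
    by rewrite z_past.
  - move=> a al; have [a0|a0] := lerP 0 a; last first.
      by rewrite uL// Lp; [rewrite z_past|lia].
    have [ar|ar] := lerP a r0%:Z; first by rewrite uz//; lia.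
    have -> : a = (a - r0%:Z) + r0%:Z by rewrite subrK.
    by rewrite -(coord_shift r0%:Z u) uR ?Rp ?z_future//; lia.
  - by move=> a al; rewrite Lp//; lia.
  - by move=> a al; rewrite Lp//; lia.
  - by move=> a a0; rewrite uL.
have main : c1 / 2 * (op_norm G' * op_norm G) <= op_norm (G' *m br *m G).
  rewrite -(subrK (mprod (fun=> P) i *m M *m mprod (fun=> P) j) br) addrC mulmxDr mulmxDl.
  set T1 := G' *m (mprod (fun=> P) i *m M *m mprod (fun=> P) j) *m G in hij *.
  set T2 := G' *m _ *m G.
  have T2_le : op_norm T2 <= c1 / 2 * (op_norm G' * op_norm G).
    apply: le_trans (op_normM _ _) _; rewrite mulrA ler_wpM2r ?op_norm_ge0//.
    apply: le_trans (op_normM _ _) _; rewrite mulrC ler_wpM2r ?op_norm_ge0//.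
    exact: ltW.
  have : op_norm T1 <= op_norm (T1 + T2) + op_norm T2.
    by rewrite -{1}(addrK T2 T1) -(op_normN T2); exact: op_normD.
  rewrite -lerBlDr; apply: le_trans; rewrite lerBrDr; apply: le_trans hij.
  by rewrite {2}[c1]splitr mulrDl lerD2l.
apply: le_trans main; rewrite -mulrA ler_wpM2l//; first by rewrite divr_ge0 ?ltW.
have G_ge : op_norm (cocycle A n%:Z x) <= B1 * op_norm G.
  apply: (@le_trans _ _ (K * op_norm (cocycle A n%:Z q))).
    apply: hK; apply/eq_wordP => a an; rewrite coord_shift q0x; last by clear -an; lia.
    by rewrite coord_shift subrK.
  have : op_norm (cocycle A n%:Z q) <= B ^+ s * op_norm G.
    rewrite /G -addnA -/s cocycleD.
    by apply: op_norm_unit_mull; [exact: cocycle_unit|exact: (inv_cocycle_le bA)].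
  move=> /(ler_wpM2l K0) h; apply: le_trans h _.
  by rewrite mulrA ler_wpM2r ?op_norm_ge0// lerDl.
have G'_ge : op_norm (cocycle A m%:Z y) <= B1 * op_norm G'.
  apply: (@le_trans _ _ (K * op_norm (cocycle A m%:Z (shift (l * n0 + t)%N%:Z (Rt l))))).
    apply: hK; apply/eq_wordP => a an; rewrite !coord_shift -q1y//.
    by congr (coord q1 _); clear; lia.
  have : op_norm (cocycle A m%:Z (shift (l * n0 + t)%N%:Z (Rt l))) <= B ^+ s * op_norm G'.
    rewrite /G' cocycleD (addnC _ t) -/s.
    by apply: op_norm_unit_mulr; [exact: cocycle_unit|exact: (inv_cocycle_le bA)].
  move=> /(ler_wpM2l K0) h; apply: le_trans h _.
  by rewrite mulrA ler_wpM2r ?op_norm_ge0// lerDl.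
rewrite mulrC ler_pdivrMr ?mulr_gt0//.
have -> : op_norm G' * op_norm G * (B1 * B1) = (B1 * op_norm G) * (B1 * op_norm G') by ring.
by apply: ler_pM => //; exact: op_norm_ge0.
Qed.

End homoclinic_connection.

Section limit_holonomy.
Context {R : realType} {X : sft R} {k : nat}.
Local Notation Sigma := (shift_space X).
Variables (S : nat -> Sigma -> Sigma) (c : nat -> Sigma -> 'M[R]_k).
Variables (E : Sigma -> Sigma -> Prop) (B K theta : R).
Hypothesis S_add : forall m n x, S n (S m x) = S (m + n)%N x.
Hypothesis cD : forall m n x, c (m + n)%N x = c n (S m x) *m c m x.
Hypothesis c_unit : forall n x, c n x \in unitmx.
Hypothesis c_le : forall n x, op_norm (c n x) <= B ^+ n.
Hypothesis c_inv_le : forall n x, op_norm (invmx (c n x)) <= B ^+ n.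
Hypothesis E_S : forall x y n, E x y -> E (S n x) (S n y).
Hypothesis B_ge0 : 0 <= B.
Hypothesis K_ge0 : 0 <= K.
Hypothesis theta_ge0 : 0 <= theta.
Hypothesis theta_lt1 : theta < 1.
Let d n y x := invmx (c n y) *m c n x.
Hypothesis d_cauchy : forall x y m n, E x y -> (m <= n)%N ->
  op_norm (d n y x - d m y x) <= K * theta ^+ m.
Let L y x := lim ((fun n => d n y x) @ \oo).

Let d_add m n y x : d (m + n)%N y x = invmx (c m y) *m d n (S m y) (S m x) *m c m x.
Proof. by rewrite /d !cD invmxM// !mulmxA. Qed.

Lemma limit_holonomy_shift m x y : E x y ->
  L y x = invmx (c m y) *m L (S m y) (S m x) *m c m x.
Proof.
move=> xy; apply/eqP; rewrite -subr_eq0; apply/eqP.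
set D := _ - _; suff D0 : op_norm D <= 0.
  apply/matrixP => i j; rewrite [RHS]mxE; apply/eqP; rewrite -normr_le0.
  exact: le_trans (le_op_norm_entry _ _ _) D0.
apply/ler_addgt0Pr => e e0; rewrite add0r.
have lim1 n := geometric_cauchy_lim K_ge0 theta_ge0 theta_lt1
  (fun m n => @d_cauchy x y m n xy) n.
have lim2 n := geometric_cauchy_lim K_ge0 theta_ge0 theta_lt1
  (fun i j => @d_cauchy (S m x) (S m y) i j (E_S m xy)) n.
pose C := K * (1 + B ^+ m * B ^+ m).
have C0 : 0 <= C by rewrite mulr_ge0// addr_ge0// mulr_ge0 ?exprn_ge0.
have [N hN] : exists N, C * theta ^+ N < e.
  have : (fun m => C * theta ^+ m) @ \oo --> (0 : R).
    by rewrite -(mulr0 C); apply: cvgMr; apply: cvg_expr; rewrite ger0_norm.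
  move=> /cvgrPdist_lt /(_ _ e0) [N _ hN]; exists N.
  by apply: le_lt_trans (hN N (leqnn N)); rewrite sub0r normrN ler_norm.
apply: le_trans (ltW hN).
have -> : D = (L y x - d (m + N)%N y x) +
    invmx (c m y) *m (d N (S m y) (S m x) - L (S m y) (S m x)) *m c m x.
  by rewrite mulmxBr mulmxBl -d_add addrA subrK.
apply: le_trans (op_normD _ _) _.
rewrite /C mulrDr mulr1 mulrDl; apply: lerD.
  apply: le_trans (lim1 (m + N)%N) _; rewrite ler_wpM2l// exprD ler_piMl ?exprn_ge0//.
  by rewrite exprn_ile1// ltW.
apply: le_trans (op_normM _ _) _.
have -> : K * (B ^+ m * B ^+ m) * theta ^+ N = B ^+ m * (K * theta ^+ N) * B ^+ m by ring.
apply: ler_pM; rewrite ?op_norm_ge0//; apply: le_trans (op_normM _ _) _.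
by apply: ler_pM; rewrite ?op_norm_ge0// op_norm_distC; exact: lim2.
Qed.

(** Both sides equal the expression at time [m + n]. This lets [Hs] and [Hu], defined through an
    arbitrary exponent, be computed with a convenient one; the action [S] is abstract in order to
    cover both directions of time. *)
Lemma limit_holonomy_indep m n x y : E (S m x) (S m y) -> E (S n x) (S n y) ->
  invmx (c m y) *m L (S m y) (S m x) *m c m x =
  invmx (c n y) *m L (S n y) (S n x) *m c n x.
Proof.
move=> hm hn; rewrite (limit_holonomy_shift n hm) (limit_holonomy_shift m hn).
rewrite !S_add (addnC n m) !mulmxA -!(mulmxA _ (c _ (S _ _))) -!cD.
by rewrite -!invmxM// -!cD (addnC n m).
Qed.

End limit_holonomy.

Section typical_quasi_multiplicativity.
Context {R : realType} {X : sft R} {k : nat}.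
Local Notation Sigma := (shift_space X).
Implicit Types (x y z p q w : Sigma).

Lemma HsE (A : Sigma -> 'M[R]_k) C B rho theta y x n : bunched A C B rho theta ->
  Ws_loc (shift n%:Z x) (shift n%:Z y) ->
  Hs A y x = invmx (cocycle A n%:Z y) *m Hs_loc A (shift n%:Z y) (shift n%:Z x) *m
    cocycle A n%:Z x.
Proof.
move=> bA xyn; rewrite /Hs; set m := xget _ _.
have xym : Ws_loc (shift m%:Z x) (shift m%:Z y).
  exact: (@xgetPex _ 0%N [set n : nat | Ws_loc (shift n x) (shift n y)] (ex_intro _ n xyn)).
have [K K0 hK] := sdiff_cauchy bA.
have uA := bun_unit bA; have B0 := bun_B_ge0 bA.
apply: (@limit_holonomy_indep _ X k (fun n => shift n%:Z) (fun n => cocycle A n%:Z)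
  (fun x y => Ws_loc x y) B K theta) => //.
- by move=> i j u; rewrite shift_shift addnC.
- by move=> i j u; rewrite cocycleD.
- by move=> i u; exact: cocycle_unit.
- by move=> i u; apply: op_norm_cocycle_le => //; exact: (bun_le bA).
- by move=> i u; exact: (inv_cocycle_le bA).
- by move=> u v i uv j j0; rewrite !coord_shift uv//; lia.
- exact: bun_theta_ge0 bA.
- exact: bun_theta_lt1 bA.
- by move=> u v i j uv ij; apply: hK => // l l0; rewrite uv.
Qed.

Lemma HuE (A : Sigma -> 'M[R]_k) C B rho theta y x (n : nat) : bunched A C B rho theta ->
  Wu_loc (shift (- n%:Z) x) (shift (- n%:Z) y) ->
  Hu A y x = invmx (cocycle A (- n%:Z) y) *m
    Hu_loc A (shift (- n%:Z) y) (shift (- n%:Z) x) *m cocycle A (- n%:Z) x.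
Proof.
move=> bA xyn; rewrite /Hu; set m := xget _ _.
have xym : Wu_loc (shift (- m%:Z) x) (shift (- m%:Z) y).
  exact: (@xgetPex _ 0%N [set n : nat | Wu_loc (shift (- n%:Z) x) (shift (- n%:Z) y)]
    (ex_intro _ n xyn)).
have [K K0 hK] := udiff_cauchy bA.
have uA := bun_unit bA; have B0 := bun_B_ge0 bA.
apply: (@limit_holonomy_indep _ X k (fun n => shift (- n%:Z)) (fun n => cocycle A (- n%:Z))
  (fun x y => Wu_loc x y) B K theta) => //.
- by move=> i j u; rewrite shift_shift; congr (shift _ u); lia.
- move=> i j u; rewrite !cocycleN//.
  have -> : shift (- j%:Z) (shift (- i%:Z) u) = shift (- (i + j)%N%:Z) u.
    by rewrite shift_shift; congr (shift _ u); lia.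
  have -> : shift (- i%:Z) u = shift j%:Z (shift (- (i + j)%N%:Z) u).
    by rewrite shift_shift; congr (shift _ u); lia.
  by rewrite (addnC i j) cocycleD invmxM ?cocycle_unit.
- by move=> i u; rewrite cocycleN// unitmx_inv cocycle_unit.
- by move=> i u; rewrite cocycleN//; exact: (inv_cocycle_le bA).
- move=> i u; rewrite cocycleN// invmxK; apply: op_norm_cocycle_le => //.
  exact: (bun_le bA).
- by move=> u v i uv j j0; rewrite !coord_shift uv//; lia.
- exact: bun_theta_ge0 bA.
- exact: bun_theta_lt1 bA.
- by move=> u v i j uv ij; apply: hK => // l l0; rewrite uv.
Qed.

(** Powers of [P] only rescale the eigenvectors. This transfers twisting from [z] to the translate
    of [z] used by [connection]. *)
Lemma twisting_conj (P M : 'M[R]_k) (lam : 'I_k -> R) (v : 'I_k -> 'cV[R]_k) n :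
  P \in unitmx -> (forall i, v i != 0 /\ P *m v i = lam i *: v i) ->
  twisting M v -> twisting (mprod (fun=> P) n *m M *m mprod (fun=> P) n) v.
Proof.
move=> uP vP tM i j; set Q := mprod _ n; apply/negP => h; case/negP: (tM i j).
have lam0 l : lam l != 0.
  have [vl0 Pvl] := vP l; apply: contraNneq vl0 => ll.
  by rewrite -(mulKmx uP (v l)) Pvl ll scale0r mulmx0.
have uQ : Q \in unitmx by exact: mprod_unit.
have Qv l : Q *m v l = lam l ^+ n *: v l.
  rewrite /Q; elim: (n) => [|m IH] /=; first by rewrite mul1mx scale1r.
  by rewrite -mulmxA IH -scalemxAr (vP l).2 scalerA exprSr.
have Qiv l : invmx Q *m v l = (lam l ^+ n)^-1 *: v l.
  apply: (can_inj (mulKmx uQ)); rewrite mulKVmx// -scalemxAr Qv scalerA.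
  by rewrite mulVf ?scale1r// expf_neq0.
have -> : M *m v i = (lam i ^+ n)^-1 *: (invmx Q *m (Q *m M *m Q *m v i)).
  rewrite -(mulmxA _ Q (v i)) Qv -!scalemxAr scalerA mulVf ?expf_neq0// scale1r.
  by rewrite -!mulmxA mulKmx.
apply: memvZ; pose f := linfun (mulmx (invmx Q) : 'cV[R]_k -> 'cV[R]_k).
have -> : invmx Q *m (Q *m M *m Q *m v i) = f (Q *m M *m Q *m v i) by rewrite lfunE.
have : f (Q *m M *m Q *m v i) \in (f @: <<[seq v l | l <- enum 'I_k & l != j]>>)%VS.
  exact: memv_img.
rewrite limg_span; apply/subvP; apply/span_subvP => _ /mapP[_ /mapP[l lj ->] ->].
rewrite lfunE /= Qiv; apply: memvZ; apply: memv_span.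
by apply/mapP; exists l.
Qed.

Lemma typical_connection (A : Sigma -> 'M[R]_k) r C B rho theta :
  (0 < k)%N -> topologically_mixing X -> typical r A -> bunched A C B rho theta ->
  exists D (c : R), 0 < c /\ forall x y n m, exists w d,
  [/\ (d <= D)%N, forall i : int, i < n%:Z -> coord w i = coord x i,
    forall i : int, 0 <= i -> coord w (i + (n + d)%N%:Z) = coord y i &
    c * (op_norm (cocycle A n%:Z x) * op_norm (cocycle A m%:Z y)) <=
    op_norm (cocycle A (n + d + m)%N%:Z w)].
Proof.
move=> k0 mix [_ [p [z [lam [v [[[n0 [n0_gt0 pper _] [_ lam_inj vP]] hom tw] _]]]]]] bA.
have {}lam_inj : injective lam by move=> i j ij; apply: lam_inj; rewrite ij.
have uA := bun_unit bA.
have [t glue] := mixing_glue mix.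
case: hom => [[a za] [b zb] _].
have {}za (i : int) : a%:Z <= i -> coord z i = coord p i.
  move=> ai; have := za (i - a%:Z); rewrite !coord_shift subrK; apply; lia.
have {}zb (i : int) : i < - b%:Z -> coord z i = coord p i.
  move=> ai; have := zb (i + b%:Z); rewrite !coord_shift addrK; apply; lia.
(* A multiple of the period that is at least [a] and [b]. After translation by [-N] the excursion
   takes place between the times 0 and [2 * N], and the point agrees with [p] in phase on both
   sides. *)
pose N := ((a + b) * n0)%N.
have Na : (a <= N)%N by rewrite /N -[leqLHS]muln1 leq_mul// leq_addr.
have Nb : (b <= N)%N by rewrite /N -[leqLHS]muln1 leq_mul// leq_addl.
have pN j : shift (j * n0)%N%:Z p = p.
  elim: j => [|j IH]; first by rewrite mul0n shift0.
  by rewrite mulSn PoszD -shift_shift IH.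
have pNN : shift (- N%:Z) p = p.
  by rewrite -{1}(pN (a + b)%N) shift_shift addNr shift0.
pose z' := shift (- N%:Z) z.
have z'_past (i : int) : i < 0 -> coord z' i = coord p i.
  move=> i0; rewrite coord_shift zb; last by lia.
  by rewrite -{2}pNN coord_shift.
have z'_future (i : int) : 0 <= i -> coord z' (i + ((a + b).*2 * n0)%N%:Z) = coord p i.
  move=> i0; rewrite -[in RHS](pN (a + b)%N) !coord_shift za; last by lia.
  by congr (coord p _); rewrite -muln2; lia.
have N2 : ((a + b).*2 * n0 = N + N)%N by rewrite /N -addnn mulnDl.
apply: (@connection _ _ _ _ _ _ _ _ bA k0 t glue p z' n0 (a + b).*2 n0_gt0 pper z'_past
  z'_future lam v lam_inj vP).
set P := cocycle A n0 p in vP *.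
have cocycle_p j : cocycle A (j * n0)%N%:Z p = mprod (fun=> P) j.
  by elim: j => // j IH; rewrite mulSn addnC cocycleD pN IH.
have -> : Hs_loc A p (shift ((a + b).*2 * n0)%N z') *m cocycle A ((a + b).*2 * n0)%N z' *m
    Hu_loc A z' p = mprod (fun=> P) (a + b)%N *m (Hs A p z *m Hu A z p) *m mprod (fun=> P) (a + b)%N.
  rewrite (@HsE _ _ _ _ _ _ _ N bA); last first.
    by move=> i i0; rewrite pN -z'_future// !coord_shift; congr (coord z _); lia.
  rewrite (@HuE _ _ _ _ _ _ _ N bA); last first.
    by move=> i i0; rewrite pNN -/z' z'_past.
  rewrite !cocycleN// pNN pN -/z' invmxK cocycle_p -/N.
  rewrite [in X in X = _]N2 cocycleD.
  have -> : shift (N + N)%N z' = shift N z.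
    by rewrite shift_shift; congr (shift _ z); lia.
  have -> : shift N z' = z by rewrite shift_shift addrN shift0.
  have uQ : mprod (fun=> P) (a + b)%N \in unitmx.
    by apply: mprod_unit => i; exact: cocycle_unit.
  by rewrite !mulmxA mulmxV// mul1mx -!mulmxA mulVmx// mulmx1.
by apply: twisting_conj => //; exact: cocycle_unit.
Qed.

End typical_quasi_multiplicativity.

(** * Pressure of almost additive potentials *)

Section potentials.
Context {R : realType} {X : sft R}.
Local Notation Sigma := (shift_space X).
Implicit Types (x y z w : Sigma).

(* What the thermodynamic argument uses of [fun n x => ln (op_norm (cocycle A n x))]. *)
Record potential (phi : nat -> Sigma -> R) (C0 C1 c : R) (D : nat) : Prop := Potential {
  pot_C0_ge0 : 0 <= C0;
  pot_C1_ge0 : 0 <= C1;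
  pot_c_ge0 : 0 <= c;
  pot_subadd : forall m n x, phi (m + n)%N x <= phi m x + phi n (shift m%:Z x);
  pot_dist : forall n x y, word n x = word n y -> `|phi n x - phi n y| <= C0;
  pot_le : forall n x, `|phi n x| <= C1 * n%:R;
  pot_extend : forall m n x, phi m x - C1 * n%:R <= phi (m + n)%N x;
  pot_connect : forall x y n m, exists w d,
    [/\ (d <= D)%N, forall i : int, i < n%:Z -> coord w i = coord x i,
      forall i : int, 0 <= i -> coord w (i + (n + d)%N%:Z) = coord y i &
      phi n x + phi m y - c <= phi (n + d + m)%N w];
  pot_measurable : forall n, measurable_fun setT (phi n : borel_space X -> R) }.

Lemma open_borel (U : set Sigma) : open U -> measurable (U : set (borel_space X)).
Proof. by move=> oU; apply: sub_sigma_algebra. Qed.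

Lemma measurable_agree (f : Sigma -> R) :
  (forall x (e : R), 0 < e -> exists m, forall y, agree x y m -> `|f x - f y| < e) ->
  measurable_fun setT (f : borel_space X -> R).
Proof.
move=> hf; apply: (measurability _ (measurable_realfun.RGenOInfty.measurableE R)).
move=> _ [_ [a ->] <-]; rewrite setTI; apply: open_borel.
apply/open_agreeP => x /=; rewrite in_itv/= andbT => ax.
have [m hm] := hf x (f x - a) (etrans (subr_gt0 _ _) ax).
exists m => y /hm; rewrite /= in_itv /= andbT ltr_norml => /andP[_].
by rewrite ltrBlDr; clear; lra.
Qed.

End potentials.

Section lyapunov_potential.
Context {R : realType} {X : sft R} {k : nat}.
Local Notation Sigma := (shift_space X).
Implicit Types (x y z w : Sigma).

Lemma op_norm1 : (0 < k)%N -> op_norm (1%:M : 'M[R]_k) = 1.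
Proof.
move=> k0; apply/eqP; rewrite eq_le op_norm1_le/=.
have := le_op_norm_entry (1%:M : 'M[R]_k) (Ordinal k0) (Ordinal k0).
by rewrite mxE eqxx normr1.
Qed.

Definition log_norm (A : Sigma -> 'M[R]_k) (n : nat) x : R := ln (op_norm (cocycle A n x)).

(** Distortion comes from the holonomies, extension from the bound on inverse matrices, and
    connection from the homoclinic orbit. *)
Lemma log_norm_potential (A : Sigma -> 'M[R]_k) r :
  (0 < k)%N -> (0 < r) -> topologically_mixing X -> typical r A ->
  exists C0 C1 c D, potential (log_norm A) C0 C1 c D.
Proof.
move=> k0 r0 mix tA; have [hA _] := tA.
have [C [B [rho [theta bA]]]] := Hrb_bunched k0 r0 hA.
have uA := bun_unit bA; have B0 := bun_B_ge0 bA.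
have pos n x : 0 < op_norm (cocycle A n%:Z x).
  by apply: op_norm_unit_gt0 => //; exact: cocycle_unit.
have posE n x : op_norm (cocycle A n%:Z x) \is Num.pos by rewrite posrE.
have [K K1 hK] := bounded_distortion bA; have K0 : 0 < K by exact: lt_le_trans K1.
have [D [c [c_gt0 hc]]] := typical_connection k0 mix tA bA.
have B1 : 1 <= B.
  rewrite -(@expr_ge1 _ 2)// -(op_norm1 k0) -(mulmxV (uA point)).
  apply: le_trans (op_normM _ _) _; rewrite expr2.
  by apply: ler_pM; rewrite ?op_norm_ge0 ?(bun_le bA) ?(bun_inv_le bA).
have B_gt0 : 0 < B by exact: lt_le_trans B1.
have lnB n : ln (B ^+ n) = ln B * n%:R by rewrite lnXn// mulr_natr.
have Bn0 n : 0 < B ^+ n by exact: exprn_gt0.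
have ext m n x : log_norm A m x - ln B * n%:R <= log_norm A (m + n) x.
  rewrite lerBlDr -lnB -lnM ?posrE// ler_ln ?posrE ?mulr_gt0//.
  rewrite cocycleD mulrC; apply: op_norm_unit_mull; first exact: cocycle_unit.
  exact: (inv_cocycle_le bA).
exists (ln K), (ln B), `|ln c|, D; split.
- exact: ln_ge0.
- exact: ln_ge0.
- exact: normr_ge0.
- move=> m n x; rewrite /log_norm -lnM// ler_ln// ?posrE ?mulr_gt0//.
  by rewrite cocycleD mulrC op_normM.
- have h n x y : word n x = word n y -> log_norm A n x <= ln K + log_norm A n y.
    by move=> xy; rewrite /log_norm -lnM ?posrE// ler_ln ?posrE ?mulr_gt0//; exact: hK.
  move=> n x y xy; have := h n x y xy; have := h n y x (esym xy).
  move: (ln K) (log_norm A n x) (log_norm A n y) => u1 u2 u3; clear => h1 h2.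
  by rewrite ler_norml; apply/andP; split; lra.
- move=> n x; rewrite ler_norml; apply/andP; split.
    have := ext 0%N n x; rewrite add0n /log_norm cocycle0 op_norm1// ln1; lra.
  rewrite -lnB /log_norm ler_ln ?posrE//; apply: op_norm_cocycle_le => //.
  exact: (bun_le bA).
- exact: ext.
- move=> x y n m; have [w [d [dD wx wy hw]]] := hc x y n m.
  exists w, d; split => //.
  have : ln c + (log_norm A n x + log_norm A m y) <= log_norm A (n + d + m) w.
    by rewrite /log_norm -lnM// -lnM ?posrE ?mulr_gt0// ler_ln ?posrE ?mulr_gt0.
  by have := lerNnormlW (lexx `|ln c|); lra.
- move=> n; apply: measurable_agree => x e e0.
  have lnc : {for op_norm (cocycle A n x), continuous (@ln R)} := continuous_ln (pos n x).
  have /cvgrPdist_lt /(_ e e0) := lnc; move=> /nbhs_ballP[d /= d0 hd].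
  have [m0 hm] := cocycle_continuous bA 0 n x d0.
  exists m0 => y xy; apply: hd; rewrite -ball_normE /=.
  apply: le_lt_trans (op_norm_dist _ _) _.
  by have := hm m0 y (leqnn _) xy; rewrite !shift0 op_norm_distC.
Qed.

End lyapunov_potential.

Section finite_sums.
Context {R : realType}.

Lemma exists_nat_ge (x : R) : exists N, forall n, (N <= n)%N -> x <= n%:R.
Proof.
exists (Num.bound `|x|) => n hn; apply: le_trans (ler_norm x) _.
by apply: le_trans (ltW (archi_boundP (normr_ge0 x))) _; rewrite ler_nat.
Qed.

Lemma esum_le_seq (T : choiceType) (E : set T) (f : T -> R) (B : R) :
  (forall s : seq T, uniq s -> (forall x, x \in s -> E x) -> \sum_(x <- s) f x <= B) ->
  (\esum_(x in E) (f x)%:E <= B%:E)%E.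
Proof.
move=> h; apply: ge_ereal_sup => _ [F [finF FE] <-].
rewrite fsbig_finite// sumEFin lee_fin; apply: h => [|x].
  exact: finmap.fset_uniq.
by rewrite in_fset_set// inE; exact: FE.
Qed.

Lemma esum_ge_seq (T : choiceType) (E : set T) (f : T -> R) (s : seq T) :
  uniq s -> (forall x, x \in s -> E x) ->
  ((\sum_(x <- s) f x)%:E <= \esum_(x in E) (f x)%:E)%E.
Proof.
move=> us sE; apply: esum_ge; exists [set` s]; first by split.
by rewrite -sumEFin (fsbig_seq _ _ us).
Qed.

Lemma sum_uniq_le (T : finType) (f : T -> R) (s : seq T) (P : pred T) :
  uniq s -> (forall x, 0 <= f x) -> (forall x, x \in s -> P x) ->
  \sum_(x <- s) f x <= \sum_(x | P x) f x.
Proof.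
move=> us f0 sP; rewrite big_uniq//= [leRHS](bigID (mem s))/=.
rewrite -[leLHS]addr0; apply: lerD; last exact: sumr_ge0.
by rewrite [leRHS](eq_bigl (mem s))// => x /=; case: (boolP (x \in s)) => [/sP->|]; rewrite ?andbF.
Qed.

Lemma limn_esup_le (u : nat -> \bar R) (x : \bar R) N :
  (forall n, (N <= n)%N -> (u n <= x)%E) -> (limn_esup u <= x)%E.
Proof.
move=> h; rewrite /limn_esup limf_esupE.
apply: (@le_trans _ _ (ereal_sup [set u n | n in [set n | (N <= n)%N]])).
  by apply: ereal_inf_lbound; exists [set n | (N <= n)%N] => //; exists N.
by apply: ge_ereal_sup => _ [n /= Nn <-]; exact: h.
Qed.

Lemma limn_esup_lt (u : nat -> \bar R) (x : \bar R) :
  (limn_esup u < x)%E -> exists N, forall n, (N <= n)%N -> (u n < x)%E.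
Proof.
rewrite /limn_esup limf_esupE => /ereal_inf_lt[_ [V [N _ NV] <-] Vx].
exists N => n Nn; apply: le_lt_trans Vx; apply: ereal_sup_ubound.
by exists n => //; exact: NV.
Qed.

End finite_sums.

Section words.
Context {R : realType} {X : sft R}.
Local Notation Sigma := (shift_space X).
Implicit Types (x y z : Sigma).

Definition lang n : {set n.-tuple 'I_(sft_card X)} :=
  [set w | `[< exists x, word n x = w >]].

Definition rep n (w : n.-tuple 'I_(sft_card X)) : Sigma :=
  xget point [set x | word n x = w].

Lemma word_lang n x : word n x \in lang n.
Proof. by rewrite inE; apply/asboolP; exists x. Qed.

Lemma word_rep n w : w \in lang n -> word n (rep w) = w.
Proof.
by rewrite inE => /asboolP h; exact: (@xgetPex _ point [set x | word n x = w] h).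
Qed.

Lemma bowen_dist_ge n x y j : (j < n)%N -> mdist (shift j%:Z x) (shift j%:Z y) <= bowen_dist n x y.
Proof. by move=> jn; rewrite /bowen_dist (bigD1 (Ordinal jn))//= le_max lexx. Qed.

Lemma bowen_dist_lt n x y (e : R) : 0 < e ->
  (forall j, (j < n)%N -> mdist (shift j%:Z x) (shift j%:Z y) < e) -> bowen_dist n x y < e.
Proof.
move=> e0 h; rewrite /bowen_dist; elim/big_ind: _ => // [u v ue ve|i _].
  by rewrite gt_max ue ve.
exact: h.
Qed.

Lemma bowen_dist_neq_word n x y : word n x <> word n y -> 1 <= bowen_dist n x y.
Proof.
move=> xy; have [j jn xyj] : exists2 j, (j < n)%N & coord x j%:Z <> coord y j%:Z.
  apply: contrapT => h; apply: xy; apply/eq_wordP => i ni; apply: contrapT => xyi.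
  by apply: h; exists i.
apply: le_trans (bowen_dist_ge x y jn); rewrite leNgt; apply/negP => h.
by apply: xyj; have := @agree_mdist_lt _ _ _ _ 0%N h 0; rewrite !coord_shift !add0r; exact.
Qed.

Lemma bowen_dist_small (e : R) : 0 < e -> exists M, forall n x y,
  word (n + M + M)%N (shift (- M%:Z) x) = word (n + M + M)%N (shift (- M%:Z) y) ->
  bowen_dist n x y < e.
Proof.
move=> e0; have [M hM] := @exists_omega_exp_lt _ X e e0; exists M => n x y /eq_wordP h.
apply: bowen_dist_lt => // j jn; apply: le_lt_trans hM; apply: mdist_le_agree => i iM.
have := h (absz (i + j%:Z + M%:Z)%R); rewrite !coord_shift.
have -> : (absz (i + j%:Z + M%:Z)%R)%:Z - M%:Z = i + j%:Z by lia.
by apply; lia.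
Qed.

Lemma card_gt0 : (0 < sft_card X)%N.
Proof. by have := ltn_ord (coord (point : Sigma) 0); apply: leq_ltn_trans. Qed.

End words.

Section pressure.
Context {R : realType} {X : sft R}.
Local Notation Sigma := (shift_space X).
Implicit Types (x y z : Sigma).
Variables (phi : nat -> Sigma -> R) (C0 C1 c : R) (D : nat).
Hypothesis pot : potential phi C0 C1 c D.

Definition partition_sum q n : R := \sum_(w in lang n) expR (q * phi n (rep w)).
Local Notation Z := partition_sum.

(** The upper exponential growth rate of the partition sums, as the infimum of their eventual linear
    bounds; in this form it is real-valued. *)
Definition topological_pressure q : R :=
  inf [set P | exists N, forall n, (N <= n)%N -> ln (Z q n) <= P * n%:R].

Let weight_le q n x : `|q * phi n x| <= `|q| * C1 * n%:R.
Proof. by rewrite normrM -mulrA ler_wpM2l// (pot_le pot). Qed.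

Let s := sft_card X.
Let s_gt0 : 0 < s%:R :> R. Proof. by rewrite ltr0n card_gt0. Qed.

Lemma card_lang n : #|@lang R X n|%:R <= s%:R ^+ n :> R.
Proof.
rewrite -natrX ler_nat; apply: leq_trans (max_card _) _.
by rewrite card_tuple card_ord.
Qed.

Let partition_sum_ge q n : expR (- (`|q| * C1 * n%:R)) <= Z q n.
Proof.
rewrite /Z (bigD1 (word n point)) ?word_lang//= -[leLHS]addr0.
apply: lerD; last by apply: sumr_ge0 => w _; exact: expR_ge0.
by rewrite ler_expR; have := weight_le q n (rep (word n point)); rewrite ler_norml => /andP[].
Qed.

Lemma partition_sum_gt0 q n : 0 < Z q n.
Proof. exact: lt_le_trans (expR_gt0 _) (partition_sum_ge q n). Qed.

Let partition_sum_le q n : Z q n <= expR ((ln s%:R + `|q| * C1) * n%:R).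
Proof.
apply: (@le_trans _ _ (\sum_(w in lang n) expR (`|q| * C1 * n%:R))).
  apply: ler_sum => w _; rewrite ler_expR.
  by have := weight_le q n (rep w); rewrite ler_norml => /andP[].
rewrite sumr_const -[X in X <= _]mulr_natl mulrDl expRD.
apply: ler_wpM2r; first exact: expR_ge0.
apply: le_trans (card_lang n) _.
by rewrite mulr_natr -lnXn// lnK// posrE exprn_gt0.
Qed.

Let pressure_set q := [set P | exists N, forall n, (N <= n)%N -> ln (Z q n) <= P * n%:R].

Let pressure_set_nonempty q : pressure_set q (ln s%:R + `|q| * C1).
Proof.
exists 0%N => n _; rewrite -[leRHS]expRK ler_ln ?posrE ?expR_gt0 ?partition_sum_gt0//.
Qed.

Let pressure_set_lb q : lbound (pressure_set q) (- (`|q| * C1)).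
Proof.
move=> P [N hN]; have h := hN (maxn N 1) (leq_maxl _ _).
have n0 : 0 < (maxn N 1)%:R :> R by rewrite ltr0n leq_max orbT.
rewrite -(ler_pM2r n0) mulNr; apply: le_trans h; rewrite -[leLHS]expRK.
by rewrite ler_ln ?posrE ?expR_gt0 ?partition_sum_gt0.
Qed.

Let has_inf_pressure q : has_inf (pressure_set q).
Proof.
split; first by exists (ln s%:R + `|q| * C1); exact: pressure_set_nonempty.
by exists (- (`|q| * C1)); exact: pressure_set_lb.
Qed.

Lemma pressure_lt q P : topological_pressure q < P ->
  exists N, forall n, (N <= n)%N -> ln (Z q n) <= P * n%:R.
Proof.
move=> /(inf_lt (proj1 (has_inf_pressure q))) [P' [N hN] P'P]; exists N => n /hN h.
by apply: le_trans h _; rewrite ler_wpM2r// ltW.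
Qed.

Lemma pressure_gt q P : P < topological_pressure q ->
  forall N, exists2 n, (N <= n)%N & P * n%:R < ln (Z q n).
Proof.
move=> Pq N; apply: contrapT => h; move: Pq; apply/negP; rewrite -leNgt.
apply: (inf_lbound (proj2 (has_inf_pressure q))).
by exists N => n Nn; rewrite leNgt; apply/negP => Pn; apply: h; exists n.
Qed.

Lemma separated_reps (e : R) n : e < 1 -> separated n e (@rep _ X n @` [set` lang n]).
Proof.
move=> e1 _ _ [u ul <-] [v vl <-] uv; apply: lt_le_trans e1 _.
apply: bowen_dist_neq_word; rewrite !word_rep// => uv'.
by apply: uv; rewrite uv'.
Qed.

(** A point seen at precision [M] during time [n] is given by its word of length [n] and [2 * M]
    further symbols. So boundedly many points share a word, and distortion allows replacing them by
    its representative. *)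
Lemma word_sum_le q M : exists2 K, 0 < K & forall n (l : seq Sigma), uniq l ->
  {in l &, injective (fun x => word (n + M + M)%N (shift (- M%:Z) x))} ->
  \sum_(x <- l) expR (q * phi n x) <= K * Z q n.
Proof.
exists (s%:R ^+ M * s%:R ^+ M * expR (`|q| * C0)).
  by rewrite !mulr_gt0 ?exprn_gt0 ?expR_gt0.
move=> n l ul inj_l.
pose key x := (word M (shift (- M%:Z) x), word n x, word M (shift n%:Z x)).
have key_inj : {in l &, injective key}.
  move=> x y xl yl kxy; have /eq_wordP h1 := congr1 (fun u => u.1.1) kxy.
  have /eq_wordP h2 := congr1 (fun u => u.1.2) kxy.
  have /eq_wordP h3 := congr1 (fun u => u.2) kxy; apply: inj_l => //=.
  apply/eq_wordP => i iM; rewrite !coord_shift.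
  have [iM1|iM1] := ltnP i M; first exact: h1.
  have [iM2|iM2] := ltnP (i - M) n.
    by have := h2 (i - M)%N iM2; rewrite (_ : (i - M)%N%:Z = i%:Z - M%:Z)//; lia.
  have := h3 (i - M - n)%N; rewrite !coord_shift.
  have -> : (i - M - n)%N%:Z + n%:Z = i%:Z - M%:Z by lia.
  by apply; lia.
pose f (u : M.-tuple 'I_s * n.-tuple 'I_s * M.-tuple 'I_s) :=
  expR (`|q| * C0) * expR (q * phi n (rep u.1.2)).
apply: (@le_trans _ _ (\sum_(x <- l) f (key x))).
  apply: ler_sum => x _; rewrite /f /= -expRD ler_expR.
  have : `|q * (phi n x - phi n (rep (word n x)))| <= `|q| * C0.
    by rewrite normrM ler_wpM2l// (pot_dist pot)// word_rep ?word_lang.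
  by move=> /ler_normlW; rewrite mulrBr lerBlDr.
rewrite -(big_map key xpredT f).
apply: (@le_trans _ _ (\sum_(u : M.-tuple 'I_s * n.-tuple 'I_s * M.-tuple 'I_s | u.1.2 \in lang n) f u)).
  apply: sum_uniq_le; first by rewrite map_inj_in_uniq.
    by move=> u; rewrite mulr_ge0 ?expR_ge0.
  by move=> _ /mapP[x _ ->]; exact: word_lang.
have -> : \sum_(u | u.1.2 \in lang n) f u =
    \sum_(a : M.-tuple 'I_s) \sum_(b | b \in lang n) \sum_(j : M.-tuple 'I_s) f (a, b, j).
  rewrite pair_big_dep pair_big_dep /=.
  by apply: eq_big => [[[a b] j]|[[a b] j] _] //=; rewrite andbT.
rewrite /f /=; under eq_bigr do under eq_bigr do rewrite sumr_const.
rewrite sumr_const !card_tuple !card_ord -sumrMnl /=.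
under eq_bigr do rewrite -mulrnA.
rewrite sumrMnl -mulr_sumr -/(Z q n) -!natrX -natrM -mulrA.
by rewrite [leRHS]mulr_natl.
Qed.

Lemma separated_esum_le q (e : R) : 0 < e -> exists2 K, 0 < K & forall n E, separated n e E ->
  (\esum_(x in E) (expR (q * phi n x))%:E <= (K * Z q n)%:E)%E.
Proof.
move=> e0; have [M hM] := @bowen_dist_small _ X e e0.
have [K K0 hK] := word_sum_le q M; exists K => // n E sepE.
apply: esum_le_seq => l ul lE; apply: hK => // x y xl yl xy; apply: contrapT => xy'.
have := sepE x y (lE x xl) (lE y yl) xy'; apply/negP; rewrite -leNgt.
exact/ltW/hM.
Qed.

(** Every scale below 1 gives the same value: separated sets are controlled by words through
    [separated_esum_le], and points with distinct words are at Bowen distance at least 1. *)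
Lemma pressure_epsE q (e : R) : 0 < e -> e < 1 ->
  limn_esup (fun n : nat => (n%:R^-1)%:E *
    lne (ereal_sup [set (\esum_(x in E) (expR (q * phi n x))%:E)%E | E in separated n e]))%E
  = (topological_pressure q)%:E.
Proof.
move=> e0 e1; have [K K0 hK] := separated_esum_le q e0.
set u := fun n : nat => _.
have sup_le n : (ereal_sup [set (\esum_(x in E) (expR (q * phi n x))%:E)%E |
    E in separated n e] <= (K * Z q n)%:E)%E.
  by apply: ge_ereal_sup => _ [E sE <-]; exact: hK.
have sup_ge n : ((Z q n)%:E <= ereal_sup [set (\esum_(x in E) (expR (q * phi n x))%:E)%E |
    E in separated n e])%E.
  apply: le_trans (ereal_sup_ubound _); last first.
    by exists (@rep _ X n @` [set` lang n]) => //; exact: separated_reps.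
  have -> : Z q n = \sum_(x <- [seq rep w | w <- enum (lang n)]) expR (q * phi n x).
    by rewrite big_map big_enum.
  apply: esum_ge_seq.
    rewrite map_inj_in_uniq ?enum_uniq// => v w; rewrite !mem_enum => vl wl vw.
    by rewrite -(word_rep vl) vw word_rep.
  by move=> x /mapP[w]; rewrite mem_enum => wl ->; exists w.
have ln_le n : (lne (ereal_sup [set (\esum_(x in E) (expR (q * phi n x))%:E)%E |
    E in separated n e]) <= (ln K + ln (Z q n))%:E)%E.
  rewrite -lnM ?posrE ?partition_sum_gt0// -lne_EFin ?mulr_gt0 ?partition_sum_gt0//.
  rewrite lee_lne//.
    by rewrite in_itv /= leey andbT (le_trans _ (sup_ge n))// lee_fin ltW ?partition_sum_gt0.
  by rewrite in_itv /= leey andbT lee_fin ltW ?mulr_gt0 ?partition_sum_gt0.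
have ln_ge n : ((ln (Z q n))%:E <= lne (ereal_sup [set (\esum_(x in E) (expR (q * phi n x))%:E)%E |
    E in separated n e]))%E.
  rewrite -lne_EFin ?partition_sum_gt0// lee_lne//.
    by rewrite in_itv /= leey andbT lee_fin ltW ?partition_sum_gt0.
  by rewrite in_itv /= leey andbT (le_trans _ (sup_ge n))// lee_fin ltW ?partition_sum_gt0.
apply/eqP; rewrite eq_le; apply/andP; split.
- apply/lee_addgt0Pr => d d0.
  have d2 : 0 < d / 2 by rewrite divr_gt0.
  have [N hN] : exists N, forall n, (N <= n)%N ->
      ln (Z q n) <= (topological_pressure q + d / 2) * n%:R.
    by apply: pressure_lt; rewrite ltrDl.
  have [N' hN'] : exists N', forall n, (N' <= n)%N -> ln K <= d / 2 * n%:R.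
    have [N' hN'] := exists_nat_ge (ln K / (d / 2)); exists N' => n /hN'.
    by rewrite ler_pdivrMr// mulrC.
  apply: (@limn_esup_le _ _ _ (maxn 1 (maxn N N'))) => n.
  rewrite !geq_max => /and3P[n1 /hN h /hN' h'].
  have n0 : 0 < n%:R :> R by rewrite ltr0n.
  rewrite /u; apply: (@le_trans _ _ ((n%:R^-1)%:E * (ln K + ln (Z q n))%:E)%E).
    by rewrite lee_wpmul2l ?lee_fin ?invr_ge0.
  rewrite -EFinM -EFinD lee_fin mulrC ler_pdivrMr//.
  by apply: le_trans (lerD h' h) _; rewrite -mulrDl addrCA -splitr.
- rewrite leNgt; apply/negP => lt; have [y hy1 hy2] : exists2 y : R,
      (limn_esup u < y%:E)%E & y < topological_pressure q.
    move: lt; case: (limn_esup u) => [l| |] //.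
      by rewrite lte_fin => lq; exists ((l + topological_pressure q) / 2); rewrite ?lte_fin midf_lt.
    by exists (topological_pressure q - 1); rewrite ?ltNyr// ltrBlDr ltrDl.
  have [N hN] := limn_esup_lt hy1.
  have [n Nn] := pressure_gt hy2 (maxn N 1).
  apply/negP; rewrite -leNgt.
  have n0 : 0 < n%:R :> R by rewrite ltr0n (leq_trans _ Nn)// leq_max orbT.
  have := hN n (leq_trans (leq_maxl _ _) Nn); rewrite /u => /ltW h.
  rewrite -ler_pdivrMr// mulrC -lee_fin EFinM; apply: le_trans h.
  by rewrite lee_wpmul2l ?lee_fin ?invr_ge0.
Qed.

End pressure.

Section pressure_cocycle.
Context {R : realType} {X : sft R} {k : nat}.
Local Notation Sigma := (shift_space X).

Lemma pressureE (A : Sigma -> 'M[R]_k) C0 C1 c D q : (0 < k)%N ->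
  (forall x, A x \in unitmx) -> potential (log_norm A) C0 C1 c D ->
  pressure A q = (topological_pressure (log_norm A) q)%:E.
Proof.
move=> k0 uA pot; rewrite /pressure; apply: lim_near_cst; first exact: ereal_hausdorff.
near=> e; rewrite -(pressure_epsE pot q (e := e)); last 2 first.
- by near: e; exact: nbhs_right_gt.
- by near: e; exact: nbhs_right_lt.
rewrite /pressure_eps; congr limn_esup; apply/funext => n; congr (_ * lne (ereal_sup _))%E.
apply: eq_imagel => E _; apply: eq_esum => x _; rewrite /powR gt_eqF//.
by apply: op_norm_unit_gt0 => //; exact: cocycle_unit.
Unshelve. all: by end_near. Qed.

End pressure_cocycle.

(** * Upper bound for the entropy of the level sets *)

Section entropy_upper_bound.
Context {R : realType} {X : sft R}.
Local Notation Sigma := (shift_space X).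
Implicit Types (x y z : Sigma).
Variables (phi : nat -> Sigma -> R) (C0 C1 c : R) (D : nat).
Hypothesis pot : potential phi C0 C1 c D.

Definition phi_level (alpha : R) : set Sigma :=
  [set x | (fun n : nat => n%:R^-1 * phi n x) @ \oo --> alpha].

Lemma geo_sum_le (p : R) N m : 0 <= p -> p < 1 ->
  \sum_(n < m | (N <= n)%N) p ^+ n <= p ^+ N / (1 - p).
Proof.
move=> p0 p1; have q0 : 0 < 1 - p by rewrite subr_gt0.
suff h : \sum_(n < m | (N <= n)%N) p ^+ n <= (p ^+ N - p ^+ (maxn N m)) / (1 - p).
  by apply: le_trans h _; rewrite ler_pM2r ?invr_gt0// lerBlDr lerDl exprn_ge0.
elim: m => [|m IH]; first by rewrite big_ord0 maxn0 subrr mul0r.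
rewrite big_mkcond big_ord_recr -big_mkcond /=; case: (leqP N m) => Nm.
  apply: le_trans (lerD IH (lexx _)) _; rewrite (maxn_idPr Nm) (maxn_idPr (leqW Nm)).
  rewrite le_eqVlt; apply/orP; left; apply/eqP; rewrite exprS.
  by field; rewrite gt_eqF.
by move: IH; rewrite addr0 (maxn_idPl (ltnW Nm)) (maxn_idPl Nm).
Qed.

Lemma htop_eps_le (alpha q e : R) : 0 < e ->
  (htop_eps (phi_level alpha) e <= (topological_pressure phi q - alpha * q)%:E)%E.
Proof.
move=> e0; set P := topological_pressure phi q.
apply/lee_addgt0Pr => d d0; rewrite -EFinD.
apply: ereal_inf_lbound; exists (P - alpha * q + d) => //=.
set s := P - alpha * q + d.
(* One third of [d] for the excess over the pressure, one for the deviation of [phi n x] from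
   [n * alpha], and one for the geometric decay [rho ^+ n]. *)
pose eta := d / 3; have eta0 : 0 < eta by rewrite divr_gt0.
pose de := eta / (`|q| + 1).
have q1 : 0 < `|q| + 1 by rewrite ltr_wpDl.
have de0 : 0 < de by rewrite divr_gt0.
have qde : `|q| * de <= eta.
  by rewrite /de mulrCA ler_piMr ?(ltW eta0)// ler_pdivrMr// mul1r lerDl.
have [N0 hN0] : exists N0, forall n, (N0 <= n)%N -> ln (partition_sum phi q n) <= (P + eta) * n%:R.
  by apply: (pressure_lt pot); rewrite ltrDl.
have [M hM] := @bowen_dist_small _ X e e0.
have [K K0 hK] := word_sum_le pot q M.
pose good n x := `|phi n x - n%:R * alpha| <= de * n%:R.
pose wd n x := word (n + M + M)%N (shift (- M%:Z) x).
pose center (u : {n : nat & (n + M + M)%N.-tuple 'I_(sft_card X)}) : Sigma :=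
  xget point [set x | wd (tag u) x = tagged u /\ good (tag u) x].
(* The time after which a point of the level set is good depends on the point, so the cover uses
   words of all levels [n >= N]. The decay in [n] keeps the sum over levels small. *)
pose C N : set (nat * Sigma) := [set (tag u, center u) | u in
  [set u | (N <= tag u)%N /\ exists x, wd (tag u) x = tagged u /\ good (tag u) x]].
have centerP u : (exists x, wd (tag u) x = tagged u /\ good (tag u) x) ->
    wd (tag u) (center u) = tagged u /\ good (tag u) (center u).
  by move=> h; exact: (@xgetPex _ point [set x | wd (tag u) x = tagged u /\ good (tag u) x] h).
have C_cover N : (0 < N)%N -> bowen_cover (phi_level alpha) N e (C N).
  move=> N_gt0; split.
    by apply: (sub_countable (card_image_le _ _)); exact: countableP.
    by move=> _ [u [Nu _] <-].
  move=> x /cvgrPdist_lt /(_ _ de0) [n1 _ hn1].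
  pose n := maxn N n1; have n_gt0 : 0 < n%:R :> R by rewrite ltr0n leq_max N_gt0.
  have gx : good n x.
    have := ltW (hn1 n (leq_maxr _ _)); rewrite -(ler_pM2r n_gt0); apply: le_trans.
    rewrite -[X in _ <= _ * X](gtr0_norm n_gt0) -normrM mulrBl mulrAC mulVf ?mul1r ?gt_eqF//.
    by rewrite distrC mulrC.
  pose u : {n : nat & (n + M + M)%N.-tuple 'I_(sft_card X)} := Tagged (fun n => (n + M + M)%N.-tuple _) (wd n x).
  have ux : exists x, wd (tag u) x = tagged u /\ good (tag u) x by exists x.
  exists (n, center u); first by exists u => //; split => //=; exact: leq_maxl.
  by apply: hM; have [] := centerP u ux.
pose rho := expR (- eta); have rho0 : 0 < rho by exact: expR_gt0.
have rho1 : rho < 1 by rewrite -expR0 ltr_expR oppr_lt0.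
have S_le N : (maxn 1 N0 <= N)%N -> (bowen_S (phi_level alpha) s N e <= (K * (rho ^+ N / (1 - rho)))%:E)%E.
  rewrite geq_max => /andP[N1 N0N].
  apply: le_trans (ereal_inf_lbound _) _; first by exists (C N) => //; exact: C_cover.
  apply: esum_le_seq => l ul lC.
  pose nm := (\max_(x <- l) x.1).+1.
  have l_lt (x : nat * Sigma) : x \in l -> (x.1 < nm)%N.
    by move=> xl; rewrite ltnS; rewrite (big_rem x xl) leq_maxl.
  have -> : \sum_(x <- l) expR (- s * x.1%:R) =
      \sum_(n < nm) \sum_(x <- l | x.1 == n) expR (- s * n%:R).
    under [RHS]eq_bigr do rewrite big_mkcond.
    rewrite exchange_big /=; rewrite [LHS]big_seq [RHS]big_seq; apply: eq_bigr => x xl.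
    rewrite (bigD1 (Ordinal (l_lt x xl)))//= eqxx big1 ?addr0// => i ix.
    by case: eqP => // xi; case/eqP: ix; apply: val_inj.
  apply: (@le_trans _ _ (\sum_(n < nm | (N <= n)%N) K * rho ^+ n)); last first.
    by rewrite -mulr_sumr ler_wpM2l ?(ltW K0)// geo_sum_le// ltW.
  rewrite [leRHS]big_mkcond; apply: ler_sum => n _.
  case: leqP => [Nn|nN]; last first.
    rewrite big_seq_cond big1// => x /andP[/lC[u [Nu _] <-] /=] /eqP un.
    by move: nN; rewrite -un ltnNge Nu.
  pose l' : seq Sigma := map snd (seq.filter (fun p : nat * Sigma => p.1 == n :> nat) l).
  have l'P y : y \in l' -> exists u, [/\ tag u = n :> nat, y = center u & exists x, wd (tag u) x = tagged u /\ good (tag u) x].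
    move=> /mapP[x]; rewrite mem_filter => /andP[/eqP xn /lC[u [Nu uC] ux]] ->.
    by exists u; split => //; rewrite -ux in xn *.
  apply: (@le_trans _ _ (\sum_(y <- l') rho ^+ n * expR (- (P + eta) * n%:R) * expR (q * phi n y))).
    rewrite big_map big_filter big_seq_cond [leRHS]big_seq_cond.
    apply: ler_sum => x /andP[xl /eqP xn].
    have xl' : x.2 \in l' by apply: map_f; rewrite mem_filter xn eqxx.
    have [u [un xu ux]] := l'P _ xl'.
    have {ux}[_] := centerP u ux; rewrite -xu un /good => gx.
    rewrite -expRM_natr -!expRD ler_expR.
    have : `|q * (phi n x.2 - n%:R * alpha)| <= eta * n%:R.
      rewrite normrM; apply: le_trans (ler_wpM2l (normr_ge0 _) gx) _.
      by rewrite mulrA ler_wpM2r.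
    rewrite ler_norml mulrBr => /andP[hq _].
    have -> : - s * n%:R = - eta * n%:R + - (P + eta) * n%:R + (q * (n%:R * alpha) - eta * n%:R).
      by rewrite /s /eta; field.
    by move: hq; rewrite lerBrDl lerD2l.
  rewrite -mulr_sumr mulrAC.
  have Zle : expR (- (P + eta) * n%:R) * partition_sum phi q n <= 1.
    rewrite mulNr expRN mulrC ler_pdivrMr ?expR_gt0// mul1r.
    rewrite -[leLHS](@lnK R) ?posrE ?(partition_sum_gt0 pot)// ler_expR.
    by apply: hN0; exact: leq_trans Nn.
  apply: (@le_trans _ _ (rho ^+ n * (expR (- (P + eta) * n%:R) * (K * partition_sum phi q n)))).
    rewrite mulrAC -mulrA ler_wpM2l ?exprn_ge0 ?(ltW rho0)// ler_wpM2l ?expR_ge0//.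
    apply: hK.
      rewrite map_inj_in_uniq ?filter_uniq// => -[a1 a2] [b1 b2].
      by rewrite !mem_filter /= => /andP[/eqP -> _] /andP[/eqP -> _] ->.
    move=> y y' /l'P[[m v] [/= mn -> uC]] /l'P[[m' v'] [/= m'n -> uC']] /= yy'.
    subst m m'; pose tg w := existT (fun n : nat => (n + M + M)%N.-tuple 'I_(sft_card X)) n w.
    have [/= h1 _] := centerP (tg v) uC; have [/= h2 _] := centerP (tg v') uC'.
    by congr (center (tg _)); rewrite -h1 -h2; exact: yy'.
  rewrite [leRHS]mulrC; apply: ler_wpM2l; first by rewrite exprn_ge0 ?(ltW rho0).
  by rewrite mulrCA -[leRHS]mulr1; apply: ler_wpM2l; first exact: ltW.
rewrite /bowen_S_lim; apply/cvg_lim; first exact: ereal_hausdorff.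
apply: (@squeeze_cvge _ _ _ _ (fun=> 0%E) _ (fun N => (K * (rho ^+ N / (1 - rho)))%:E)).
- exists (maxn 1 N0) => // N /= hN; rewrite S_le// andbT.
  by apply: le_ereal_inf_tmp => _ [E _ <-]; apply: esum_ge0 => x _; rewrite lee_fin expR_ge0.
- exact: cvg_cst.
- apply: cvg_EFin; first exact: nearW.
  rewrite [X in _ --> X](_ : _ = K * (0 / (1 - rho))); last by rewrite mul0r mulr0.
  apply: cvgMr; apply: cvgMl; apply: cvg_expr; rewrite gtr0_norm//.
Qed.

End entropy_upper_bound.

(** * Invariant means and the variational inequality *)

Section fekete.
Context {R : realType}.

Lemma fekete (u : nat -> R) (b : R) :
  (forall m n, u (m + n)%N <= u m + u n) -> (forall n, - b * n%:R <= u n) ->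
  cvg ((fun n : nat => n%:R^-1 * u n) @ \oo).
Proof.
move=> sub lb; pose S := [set n%:R^-1 * u n | n in [set n : nat | (0 < n)%N]].
have lbS : lbound S (- b).
  move=> _ [n /= n0 <-]; have n0' : 0 < n%:R :> R by rewrite ltr0n.
  by rewrite mulrC ler_pdivlMr.
have hS : has_inf S.
  by split; [exists (1%:R^-1 * u 1%N); exists 1%N|exists (- b)].
apply/cvg_ex; exists (inf S); apply/cvgrPdist_le => e e0.
have e2 : 0 < e / 2 by rewrite divr_gt0.
have [_ [k /= k0 <-] hk] := inf_adherent e2 hS.
have k0' : 0 < k%:R :> R by rewrite ltr0n.
have mulu r q : u (q * k + r)%N <= q%:R * u k + u r.
  elim: q => [|q IH]; first by rewrite mul0n add0n mul0r add0r.
  rewrite mulSn -addnA; apply: le_trans (sub _ _) _.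
  by rewrite -natr1 mulrDl mul1r; move: IH; clear; lra.
pose M := \sum_(r < k) `|u r|.
have hM r : (r < k)%N -> u r <= M.
  move=> rk; rewrite /M (bigD1 (Ordinal rk))//= (le_trans (ler_norm _))// lerDl.
  exact: sumr_ge0.
have M0 : 0 <= M by exact: sumr_ge0.
have uk_le : `|u k| <= k%:R * (`|u k| / k%:R) by rewrite mulrCA mulfV ?mulr1// gt_eqF.
have [N hN] := exists_nat_ge ((M + `|u k|) / (e / 2)).
exists (maxn 1 N) => // n /=; rewrite geq_max => /andP[n0 /hN nN].
have n0' : 0 < n%:R :> R by rewrite ltr0n.
rewrite ler_distl; apply/andP; split; last first.
  have : inf S <= n%:R^-1 * u n by apply: (inf_lbound (proj2 hS)); exists n.
  by move/le_trans; apply; rewrite lerDl ltW.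
rewrite lerBlDr mulrC ler_pdivrMr//; have k0'' : k%:R != 0 :> R by rewrite gt_eqF.
have := mulu (n %% k)%N (n %/ k)%N; rewrite -divn_eq.
have := hM (n %% k)%N (ltn_pmod _ k0).
have nE : n%:R = (n %/ k)%:R * k%:R + (n %% k)%:R :> R by rewrite -natrM -natrD -divn_eq.
have rk : (n %% k)%:R <= k%:R :> R by rewrite ler_nat ltnW// ltn_pmod.
have r0 : 0 <= (n %% k)%:R :> R by [].
set v := k%:R^-1 * u k in hk; have uE : u k = k%:R * v by rewrite mulVKf.
have vk : - `|u k| <= (n %% k)%:R * v.
  have : `|(n %% k)%:R * v| <= `|u k| by rewrite uE !normrM [`|_%:R|]ger0_norm// [`|k%:R|]ger0_norm ?ler0n// ler_wpM2r.
  by rewrite ler_norml => /andP[].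
have : v * n%:R <= (inf S + e / 2) * n%:R by rewrite ler_wpM2r// ltW.
move: nN vk; rewrite ler_pdivrMr// uE nE.
move: `|k%:R * v| => M1; move: (u (n %% k)%N) (u n) => ur un; clear -e2; clearbody M v.
move: (inf S) (n %/ k)%:R (n %% k)%:R k%:R => a Q r' k'.
by clear S => *; lra.
Qed.

End fekete.

Lemma cvg_invn {R : realType} : (fun n : nat => n%:R^-1 : R) @ \oo --> 0.
Proof.
rewrite -(@cvg_shiftn 1); under eq_fun do rewrite addn1.
exact: cvg_harmonic.
Qed.

Section invariant_means.
Context {R : realType} {X : sft R}.
Local Notation Sigma := (shift_space X).
Implicit Types (x y z : Sigma).

Lemma shift_invariant_int (M : set (set Sigma)) (T : Type) (m : set Sigma -> T) :
  (forall (j : int) A, M A -> M (shift j @^-1` A)) ->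
  (forall A, M A -> m (shift 1 @^-1` A) = m A) ->
  forall (j : int) A, M A -> m (shift j @^-1` A) = m A.
Proof.
move=> hM h; have hn (n : nat) A : M A -> m (shift n%:Z @^-1` A) = m A.
  move=> MA; elim: n => [|n IH]; first by congr m; apply/seteqP; split => x /=; rewrite shift0.
  rewrite -IH -[RHS]h; last exact: hM.
  by congr m; apply/seteqP; split => x /=; rewrite shift_shift -PoszD addn1.
move=> [n|n] A MA; first exact: hn.
rewrite NegzE -(hn n.+1); last exact: hM.
by congr m; apply/seteqP; split => x /=; rewrite shift_shift addNr shift0.
Qed.

(* Covers both invariant measures, with [M] the measurable sets, and weak limits
   of empirical averages, which are defined and finitely additive on all sets. *)
Record invariant_mean (M : set (set Sigma)) (m : set Sigma -> R) : Prop := InvariantMean {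
  im_U : forall A B, M A -> M B -> M (A `|` B);
  im_I : forall A B, M A -> M B -> M (A `&` B);
  im_ge0 : forall A, 0 <= m A;
  im_1 : m setT = 1;
  im_add : forall A B, M A -> M B -> A `&` B = set0 -> m (A `|` B) = m A + m B;
  im_shiftM : forall (j : int) A, M A -> M (shift j @^-1` A);
  im_shift : forall (j : int) A, M A -> m (shift j @^-1` A) = m A;
  im_agree : forall k (A : set Sigma), (forall x y, agree x y k -> A x -> A y) -> M A }.

Variables (M : set (set Sigma)) (m : set Sigma -> R).
Hypothesis im : invariant_mean M m.

Definition label (I : finType) (c : Sigma -> I) := forall i, M (c @^-1` [set i]).

Definition pr (I : finType) (c : Sigma -> I) i : R := m (c @^-1` [set i]).

Definition expect (I : finType) (c : Sigma -> I) (g : I -> R) : R := \sum_i g i * pr c i.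

Definition label_entropy (I : finType) (c : Sigma -> I) : R := - \sum_i pr c i * ln (pr c i).

Lemma im_M0 : M set0.
Proof. by apply: (im_agree im (k := 0%N)). Qed.

Lemma im_0 : m set0 = 0.
Proof.
have := im_add im im_M0 im_M0 (setI0 _); rewrite setU0 => h.
by apply: (addrI (m set0)); rewrite addr0.
Qed.

Lemma label_seq (I : finType) (c : Sigma -> I) (s : seq I) : label c -> uniq s ->
  M [set x | c x \in s] /\ m [set x | c x \in s] = \sum_(i <- s) pr c i.
Proof.
move=> lc; elim: s => [_|i s IH /= /andP[is_ us]].
  rewrite big_nil (_ : [set x | c x \in [::]] = set0) ?im_0; first by split => //; exact: im_M0.
  by apply/seteqP; split.
have [IM Im] := IH us.
have E : [set x | c x \in i :: s] = (c @^-1` [set i]) `|` [set x | c x \in s].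
  apply/seteqP; split => x /=; rewrite inE; last by case=> ->; rewrite ?eqxx ?orbT.
  by case/orP => [/eqP|]; [left|right].
rewrite E; split; first exact: (im_U im).
rewrite (im_add im) ?big_cons ?Im//.
by apply/seteqP; split => x //= [->]; rewrite (negPf is_).
Qed.

Lemma label_pred (I : finType) (c : Sigma -> I) (P : pred I) : label c ->
  M [set x | P (c x)] /\ m [set x | P (c x)] = \sum_(i | P i) pr c i.
Proof.
move=> lc; have := @label_seq I c (enum P) lc (enum_uniq P).
rewrite big_enum /= => -[h1 h2].
have -> : [set x | P (c x)] = [set x | c x \in enum P].
  by apply/seteqP; split => x /=; rewrite mem_enum.
by split.
Qed.

Lemma pr_ge0 (I : finType) (c : Sigma -> I) i : 0 <= pr c i.
Proof. exact: (im_ge0 im). Qed.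

Lemma pr_sum (I : finType) (c : Sigma -> I) : label c -> \sum_i pr c i = 1.
Proof.
move=> lc; have [_ <-] := @label_pred I c xpredT lc.
by rewrite -(im_1 im); congr m; apply/seteqP; split.
Qed.

Lemma pr_inhabited (I : finType) (c : Sigma -> I) i : 0 < pr c i -> exists x, c x = i.
Proof.
move=> p0; apply: contrapT => /forallNP h; move: p0; rewrite /pr.
rewrite (_ : _ @^-1` _ = set0) ?im_0 ?ltxx//.
by apply/seteqP; split => x //= /h.
Qed.

Lemma label_comp (I J : finType) (c : Sigma -> I) (h : I -> J) : label c -> label (h \o c).
Proof.
move=> lc j; have [+ _] := @label_pred I c (fun i => h i == j) lc.
by congr M; apply/seteqP; split => x /= /eqP.
Qed.

Lemma pr_comp (I J : finType) (c : Sigma -> I) (h : I -> J) j : label c ->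
  pr (h \o c) j = \sum_(i | h i == j) pr c i.
Proof.
move=> lc; have [_ <-] := @label_pred I c (fun i => h i == j) lc.
by congr m; apply/seteqP; split => x /= /eqP.
Qed.

Lemma expect_comp (I J : finType) (c : Sigma -> I) (h : I -> J) (g : J -> R) : label c ->
  expect (h \o c) g = expect c (g \o h).
Proof.
move=> lc; rewrite /expect [RHS](partition_big h xpredT)//=; apply: eq_bigr => j _.
by rewrite pr_comp// mulr_sumr; apply: eq_bigr => i /eqP <-.
Qed.

Lemma expect_le (I : finType) (c : Sigma -> I) (g g' : I -> R) :
  (forall x, g (c x) <= g' (c x)) -> expect c g <= expect c g'.
Proof.
move=> gg; apply: ler_sum => i _.
have := pr_ge0 c i; rewrite le_eqVlt => /predU1P[<-|p0]; first by rewrite !mulr0.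
by have [x <-] := pr_inhabited p0; rewrite ler_wpM2r ?pr_ge0.
Qed.

Lemma expect_cst (I : finType) (c : Sigma -> I) a : label c -> expect c (fun=> a) = a.
Proof. by move=> lc; rewrite /expect -mulr_sumr pr_sum// mulr1. Qed.

Lemma expectD (I : finType) (c : Sigma -> I) (g g' : I -> R) :
  expect c (fun i => g i + g' i) = expect c g + expect c g'.
Proof. by rewrite /expect -big_split; apply: eq_bigr => i _; rewrite mulrDl. Qed.

Lemma expectZ (I : finType) (c : Sigma -> I) a (g : I -> R) :
  expect c (fun i => a * g i) = a * expect c g.
Proof. by rewrite /expect mulr_sumr; apply: eq_bigr => i _; rewrite mulrA. Qed.

Lemma expect_sum (I : finType) (c : Sigma -> I) (J : Type) (s : seq J) (g : J -> I -> R) :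
  expect c (fun i => \sum_(j <- s) g j i) = \sum_(j <- s) expect c (g j).
Proof. by rewrite /expect exchange_big; apply: eq_bigr => i _; rewrite mulr_suml. Qed.

Lemma label_shift (I : finType) (c : Sigma -> I) (j : int) : label c -> label (c \o shift j).
Proof. by move=> lc i; exact: (im_shiftM im j (lc i)). Qed.

Lemma expect_shift (I : finType) (c : Sigma -> I) (j : int) g : label c ->
  expect (c \o shift j) g = expect c g.
Proof.
by move=> lc; apply: eq_bigr => i _; congr (_ * _); exact: (im_shift im j (lc i)).
Qed.

Lemma label_pair (I J : finType) (c : Sigma -> I) (d : Sigma -> J) :
  label c -> label d -> label (fun x => (c x, d x)).
Proof.
move=> lc ld [i j]; rewrite (_ : _ @^-1` _ = c @^-1` [set i] `&` d @^-1` [set j]).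
  exact: (im_I im).
by apply/seteqP; split => x /= [-> ->].
Qed.

Lemma label_agree (I : finType) (c : Sigma -> I) k :
  (forall x y, agree x y k -> c x = c y) -> label c.
Proof. by move=> h i; apply: (im_agree im (k := k)) => x y /h /= ->. Qed.

Lemma label_word n : label (word n).
Proof.
apply: (@label_agree _ _ n) => x y xy; apply/eq_wordP => i ni; apply: xy; lia.
Qed.

Definition itinerary (I : finType) (c : Sigma -> I) n x : n.-tuple I :=
  [tuple c (shift i%:Z x) | i < n].

Lemma label_itinerary (I : finType) (c : Sigma -> I) n : label c -> label (itinerary c n).
Proof.
move=> lc w; pose F k := [set x | forall j : 'I_n, (j < k)%N -> c (shift j%:Z x) = tnth w j].
have FM k : M (F k).
  elim: k => [|k IH]; first by apply: (im_agree im (k := 0%N)) => x y _ _ j.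
  have [kn|kn] := ltnP k n; last first.
    rewrite (_ : F k.+1 = F k)//; apply/seteqP; split => x h j jk; apply: h.
      exact: leq_trans jk _.
    by apply: leq_trans kn; exact: ltn_ord.
  rewrite (_ : F k.+1 = F k `&` (shift k%:Z @^-1` (c @^-1` [set tnth w (Ordinal kn)]))).
    by apply: (im_I im) => //; exact: (im_shiftM im).
  apply/seteqP; split => x /=.
    by move=> h; split; [move=> j jk; apply: h; exact: leqW|apply: (h (Ordinal kn)) => /=].
  move=> [h1 h2] j; rewrite ltnS leq_eqVlt => /orP[/eqP jk|]; last exact: h1.
  by rewrite (_ : j = Ordinal kn)//; apply: val_inj.
rewrite (_ : _ @^-1` _ = F n)//; apply/seteqP; split => x /=.
  by move=> xw j _; have := congr1 (fun t => tnth t j) xw; rewrite tnth_mktuple.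
by move=> h; apply: eq_from_tnth => j; rewrite tnth_mktuple h.
Qed.

Lemma ln_le_sub1 (t : R) : 0 < t -> ln t <= t - 1.
Proof. by move=> t0; have := @le_ln1Dx R (t - 1); rewrite subrKC; apply; lra. Qed.

(** Bounding the entropy of a coarser label [h \o c] by a weight on a finer one lets auxiliary
    information enter [nu] without conditional entropies. It works because the probability of [i] is
    at most that of [h i], so that [ln t <= t - 1] sums to a nonpositive total. *)
Lemma gibbs (I J : finType) (c : Sigma -> I) (h : I -> J) (nu : I -> R) : label c ->
  (forall i, 0 <= nu i) -> (forall i, 0 < pr c i -> 0 < nu i) -> \sum_i nu i <= 1 ->
  label_entropy (h \o c) <= - expect c (fun i => ln (nu i)).
Proof.
move=> lc nu0 nup nu1; rewrite /label_entropy lerN2.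
have -> : \sum_j pr (h \o c) j * ln (pr (h \o c) j) = expect (h \o c) (fun j => ln (pr (h \o c) j)).
  by apply: eq_bigr => j _; rewrite mulrC.
rewrite expect_comp// -subr_le0 /expect -sumrB.
apply: (@le_trans _ _ (\sum_i (nu i - pr c i))); last by rewrite sumrB pr_sum// subr_le0.
apply: ler_sum => i _; rewrite -mulrBl /=.
have := pr_ge0 c i; rewrite le_eqVlt => /predU1P[<-|p0]; first by rewrite mulr0 subr0.
have ni := nup i p0.
have pq : pr c i <= pr (h \o c) (h i).
  by rewrite pr_comp// (bigD1 i)//= lerDl sumr_ge0// => *; exact: pr_ge0.
have q0 := lt_le_trans p0 pq; set q := pr (h \o c) (h i) in pq q0 *.
rewrite -ln_div ?posrE//; apply: (@le_trans _ _ ((nu i / q - 1) * pr c i)).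
  by rewrite ler_wpM2r ?pr_ge0// ln_le_sub1// divr_gt0.
rewrite mulrBl mul1r lerD2r -mulrA ler_piMr//.
by rewrite mulrC ler_pdivrMr// mul1r.
Qed.

(** Gibbs' inequality against the product of the two marginals. *)
Lemma label_entropy_pair (I J K : finType) (c : Sigma -> I) (d : Sigma -> J)
    (h : I * J -> K) : label c -> label d ->
  label_entropy (fun x => h (c x, d x)) <= label_entropy c + label_entropy d.
Proof.
move=> lc ld; have lcd := label_pair lc ld; set cd := fun x => (c x, d x) in lcd.
have pc p : pr cd p <= pr c p.1.
  rewrite -[c]/(fst \o cd) (pr_comp fst)// (bigD1 p)//= lerDl sumr_ge0// => *; exact: pr_ge0.
have pd p : pr cd p <= pr d p.2.
  rewrite -[d]/(snd \o cd) (pr_comp snd)// (bigD1 p)//= lerDl sumr_ge0// => *; exact: pr_ge0.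
apply: (@le_trans _ _ (- expect cd (fun p => ln (pr c p.1 * pr d p.2)))).
  apply: (@gibbs _ _ cd h (fun p : I * J => pr c p.1 * pr d p.2)) => // [p|p p0|].
  - by rewrite mulr_ge0 ?pr_ge0.
  - by rewrite mulr_gt0// (lt_le_trans p0).
  - rewrite -(pair_bigA _ (fun i j => pr c i * pr d j))/=.
    under eq_bigr do rewrite -mulr_sumr pr_sum// mulr1.
    by rewrite pr_sum.
rewrite /label_entropy -opprD lerN2 le_eqVlt; apply/orP; left; apply/eqP.
have -> : \sum_i pr c i * ln (pr c i) = expect (fst \o cd) (fun i => ln (pr c i)).
  by apply: eq_bigr => i _; rewrite mulrC.
have -> : \sum_i pr d i * ln (pr d i) = expect (snd \o cd) (fun i => ln (pr d i)).
  by apply: eq_bigr => i _; rewrite mulrC.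
rewrite !expect_comp// -expectD; apply: eq_bigr => p _ /=.
have := pr_ge0 cd p; rewrite le_eqVlt => /predU1P[<-|p0]; first by rewrite !mulr0.
by rewrite lnM// posrE (lt_le_trans p0).
Qed.

Lemma label_entropy_shift (I : finType) (c : Sigma -> I) (j : int) : label c ->
  label_entropy (c \o shift j) = label_entropy c.
Proof.
by move=> lc; congr (- _); apply: eq_bigr => i _; rewrite /pr comp_preimage !(im_shift im j (lc i)).
Qed.

Lemma itinerary_entropyD (I : finType) (c : Sigma -> I) n1 n2 : label c ->
  label_entropy (itinerary c (n1 + n2)%N) <=
  label_entropy (itinerary c n1) + label_entropy (itinerary c n2).
Proof.
move=> lc; have l1 := @label_itinerary _ _ n1 lc; have l2 := @label_itinerary _ _ n2 lc.
rewrite -[X in _ <= _ + X](label_entropy_shift n1%:Z)//.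
have -> : itinerary c (n1 + n2)%N = (fun x => (fun p : n1.-tuple I * n2.-tuple I =>
    [tuple of p.1 ++ p.2]) (itinerary c n1 x, (itinerary c n2 \o shift n1%:Z) x)).
  apply/funext => x; apply: eq_from_tnth => i; rewrite tnth_mktuple.
  case: (split_ordP i) => j ->.
    by rewrite tnth_lshift tnth_mktuple.
  by rewrite tnth_rshift tnth_mktuple /= shift_shift addrC -PoszD.
by apply: (@label_entropy_pair _ _ _ _ _ (fun p : n1.-tuple I * n2.-tuple I =>
    [tuple of p.1 ++ p.2])) => //; exact: label_shift.
Qed.

Lemma label_entropy_ge0 (I : finType) (c : Sigma -> I) : label c -> 0 <= label_entropy c.
Proof.
move=> lc; rewrite oppr_ge0 sumr_le0// => i _; rewrite mulr_ge0_le0 ?pr_ge0// ln_le0//.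
by rewrite -(pr_sum lc) (bigD1 i)//= lerDl sumr_ge0// => *; exact: pr_ge0.
Qed.

Lemma itinerary_entropy_cvg (I : finType) (c : Sigma -> I) : label c ->
  cvg ((fun n : nat => n%:R^-1 * label_entropy (itinerary c n)) @ \oo).
Proof.
move=> lc; apply: (fekete (b := 0)) => [n1 n2|n]; first exact: itinerary_entropyD.
by rewrite oppr0 mul0r label_entropy_ge0//; exact: label_itinerary.
Qed.

Section potential_means.
Variables (phi : nat -> Sigma -> R) (C0 C1 c : R) (D : nat).
Hypothesis pot : potential phi C0 C1 c D.

(** A substitute for the integral of [phi n], with an error at most [C0]. It is a finite sum, so it
    makes sense for finitely additive means. *)
Definition mean_phi n := expect (word n) (fun w => phi n (rep w)).

Lemma mean_phi_near (I : finType) (d : Sigma -> I) (g : I -> R) n (B : R) : label d ->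
  (forall x, `|g (d x) - phi n x| <= B) -> `|expect d g - mean_phi n| <= B + C0.
Proof.
move=> ld gB; pose wd x := (d x, word n x).
have lwd : label wd by apply: label_pair => //; exact: label_word.
rewrite -[d]/(fst \o wd) /mean_phi -[word n]/(snd \o wd) !expect_comp//.
have near x : `|(g \o fst) (wd x) - ((fun w => phi n (rep w)) \o snd) (wd x)| <= B + C0.
  rewrite /= -(subrKA (phi n x)); apply: le_trans (ler_normD _ _) _.
  by apply: lerD; rewrite ?gB// (pot_dist pot)// word_rep ?word_lang.
have := @expect_le _ wd (g \o fst) (fun p => (B + C0) + ((fun w => phi n (rep w)) \o snd) p).
have := @expect_le _ wd ((fun w => phi n (rep w)) \o snd) (fun p => (B + C0) + (g \o fst) p).
rewrite !(expectD _ (fun=> B + C0)) !expect_cst// => h1 h2.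
have h3 := h1; have h4 := h2.
rewrite ler_distl lerBlDl h3 => [|x]; last first.
  by have := near x; rewrite ler_distl lerBlDl => /andP[].
rewrite andTb addrC h4// => x.
by rewrite [leRHS]addrC; have := near x; rewrite ler_distl => /andP[].
Qed.

Lemma mean_phi_subadd n1 n2 : mean_phi (n1 + n2) <= mean_phi n1 + mean_phi n2 + 3 * C0.
Proof.
pose wd x := (word n1 x, word n2 (shift n1%:Z x)).
have l1 : label (word n1) := @label_word n1.
have l2 : label (word n2 \o shift n1%:Z) by apply: label_shift; exact: label_word.
have lwd : label (fun x => (wd x, word (n1 + n2)%N x)).
  by apply: label_pair; [exact: label_pair|exact: label_word].
set wd' := (fun x => _) in lwd.
have -> : mean_phi (n1 + n2) = expect (snd \o wd') (fun w => phi (n1 + n2) (rep w)) by [].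
have -> : mean_phi n1 = expect (fst \o fst \o wd') (fun w => phi n1 (rep w)) by [].
have -> : mean_phi n2 = expect (snd \o fst \o wd') (fun w => phi n2 (rep w)).
  by rewrite /mean_phi -(expect_shift n1%:Z)//; exact: label_word.
rewrite !expect_comp// -expectD -(expect_cst (3 * C0) lwd) -expectD.
apply: expect_le => x /=.
have h n y : `|phi n (rep (word n y)) - phi n y| <= C0.
  by rewrite (pot_dist pot)// word_rep ?word_lang.
have := h (n1 + n2)%N x; have := h n1 x; have := h n2 (shift n1%:Z x).
have := pot_subadd pot n1 n2 x; rewrite !ler_norml.
by clear => h1 /andP[? ?] /andP[? ?] /andP[? ?]; lra.
Qed.

Lemma mean_phi_cvg : cvg ((fun n : nat => n%:R^-1 * mean_phi n) @ \oo).
Proof.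
have C00 := pot_C0_ge0 pot.
(* Adding [3 * C0] turns subadditivity up to a constant into subadditivity. *)
have h : cvg ((fun n : nat => n%:R^-1 * (mean_phi n + 3 * C0)) @ \oo).
  apply: (fekete (b := C1)) => [n1 n2|n].
    have := mean_phi_subadd n1 n2; lra.
  rewrite -[leLHS]addr0; apply: lerD; last by rewrite mulr_ge0.
  rewrite -(expect_cst (- C1 * n%:R) (@label_word n)); apply: expect_le => x.
  by have := pot_le pot n (rep (word n x)); rewrite ler_norml mulNr => /andP[].
have -> : (fun n : nat => n%:R^-1 * mean_phi n) =
    (fun n : nat => n%:R^-1 * (mean_phi n + 3 * C0) - n%:R^-1 * (3 * C0)).
  by apply/funext => n; rewrite mulrDr addrK.
apply: is_cvgB => //; apply: is_cvgMl; apply/cvg_ex; exists 0; exact: cvg_invn.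
Qed.

End potential_means.

End invariant_means.

(** * Entropy of an arbitrary partition against the pressure *)

Section entropy_pressure.
Context {R : realType} {X : sft R}.
Local Notation Sigma := (shift_space X).
Implicit Types (x y z : Sigma).

Lemma sum_tuple_prod (I : finType) n (F : 'I_n -> I -> R) :
  \sum_(t : n.-tuple I) \prod_(j < n) F j (tnth t j) = \prod_(j < n) \sum_i F j i.
Proof.
rewrite bigA_distr_bigA (reindex (@tuple_of_finfun I n))/=; last first.
  by exists (@finfun_of_tuple I n) => t _; [exact: tuple_of_finfunK|exact: finfun_of_tupleK].
by apply: eq_bigr => f _; apply: eq_bigr => j _; rewrite tnth_mktuple.
Qed.

Lemma ln_prod (I : Type) (s : seq I) (F : I -> R) : (forall i, 0 < F i) ->
  ln (\prod_(i <- s) F i) = \sum_(i <- s) ln (F i).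
Proof.
move=> F0; elim: s => [|i s IH]; first by rewrite !big_nil ln1.
by rewrite !big_cons lnM ?posrE ?prodr_gt0// IH.
Qed.

Variables (M : set (set Sigma)) (m : set Sigma -> R).
Hypothesis im : invariant_mean M m.
Variables (phi : nat -> Sigma -> R) (C0 C1 c0 : R) (D : nat).
Hypothesis pot : potential phi C0 C1 c0 D.

Lemma expect_le2 (I J : finType) (c : Sigma -> I) (d : Sigma -> J) (g : I -> R) (g' : J -> R) :
  label M c -> label M d -> (forall x, g (c x) <= g' (d x)) -> expect m c g <= expect m d g'.
Proof.
move=> lc ld h; have lcd := label_pair im lc ld; set cd := fun x => _ in lcd.
rewrite -[c]/(fst \o cd) -[d]/(snd \o cd) !(expect_comp im)//.
exact: (expect_le im).
Qed.

Section kernel.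
Variables (I : finType) (c c' : Sigma -> I) (k : nat) (de : R).
Hypothesis lc : label M c.
Hypothesis c'k : forall x y, agree x y k -> c' x = c' y.
Hypotheses (de0 : 0 < de) (de1 : de < 1).

(** A noisy channel from the values of [c'] to those of [c]. All its entries are positive, so the
    cost of a disagreement stays finite. *)
Let kappa (a b : I) : R := if a == b then 1 - de else de / #|I|%:R.

Let I0 : 0 < #|I|%:R :> R.
Proof. by rewrite ltr0n; apply/card_gt0P; exists (c point). Qed.

Let kappa_gt0 a b : 0 < kappa a b.
Proof. by rewrite /kappa; case: ifP; rewrite ?subr_gt0// divr_gt0. Qed.

Let kappa_sum b : \sum_a kappa a b <= 1.
Proof.
apply: (@le_trans _ _ (\sum_a ((if a == b then 1 - de else 0) + de / #|I|%:R))).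
  apply: ler_sum => a _; rewrite /kappa; case: ifP => _; last by rewrite add0r.
  by rewrite lerDl ltW// divr_gt0.
rewrite big_split /= -big_mkcond big_pred1_eq.
have -> : \sum_(a : I) de / #|I|%:R = de by rewrite sumr_const -[LHS]mulr_natr mulfVK ?gt_eqF.
by rewrite subrK.
Qed.

(** Gibbs' inequality for the following weight: a word is drawn with weight [expR (q * phi n)], it
    determines the itinerary of [c'], and each symbol of it passes through the channel [kappa]. A
    faithful symbol costs [- ln (1 - de)] and a disagreement at most [ln (#|I|%:R / de)] more,
    whatever the length [n]. *)
Lemma itinerary_entropy_le q : exists K, forall n,
  label_entropy m (itinerary c n) + q * mean_phi m phi n <=
  ln (partition_sum phi q n) + K +
  n%:R * (- ln (1 - de) + ln (#|I|%:R / de) * m [set x | c x != c' x]).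
Proof.
have [K K0 hK] := word_sum_le pot q k.
exists (ln K + `|q| * (C0 + C0)) => n.
pose N := (n + k + k)%N; pose W := N.-tuple 'I_(sft_card X).
pose wd x : W := word N (shift (- k%:Z) x).
pose base (v : W) := shift k%:Z (rep v).
have wd_base v : v \in lang N -> wd (base v) = v.
  by move=> vl; rewrite /wd /base shift_shift addNr shift0 word_rep.
pose Zk := \sum_(v in @lang R X N) expR (q * phi n (base v)).
have Zk_le : Zk <= K * partition_sum phi q n.
  have -> : Zk = \sum_(x <- [seq base v | v <- enum (@lang R X N)]) expR (q * phi n x).
    by rewrite big_map big_enum.
  apply: hK.
    rewrite map_inj_in_uniq ?enum_uniq// => v w; rewrite !mem_enum => vl wl vw.
    by rewrite -(wd_base v vl) vw wd_base.
  move=> x y /mapP[v + ->] /mapP[w + ->]; rewrite !mem_enum => vl wl.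
  by rewrite -/(wd _) -/(wd _) !wd_base// => ->.
have Zk0 : 0 < Zk.
  rewrite /Zk (bigD1 (word N point)) ?word_lang//=.
  by apply: ltr_wpDr; [apply: sumr_ge0 => *; exact: expR_ge0|exact: expR_gt0].
have wd_lang x : wd x \in lang N by exact: word_lang.
have wd_agree x (i : int) : - k%:Z <= i < n%:Z + k%:Z -> coord (base (wd x)) i = coord x i.
  move=> /andP[i1 i2]; have /eq_wordP := word_rep (wd_lang x).
  move=> /(_ (absz (i + k%:Z)%R)); rewrite !coord_shift.
  have -> : (absz (i + k%:Z)%R)%:Z - k%:Z = i by lia.
  have -> : (absz (i + k%:Z)%R)%:Z = i + k%:Z by lia.
  by apply; lia.
have lwd : label M wd.
  exact: (label_shift im (- k%:Z) (@label_word _ _ _ _ im N)).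
have lit : label M (itinerary c n) by exact: (label_itinerary im).
have lcd := label_pair im lit lwd; set cd := fun x => (itinerary c n x, wd x) in lcd.
have c'_base x (j : 'I_n) : c' (shift j%:Z (base (wd x))) = c' (shift j%:Z x).
  apply: c'k => i ik; rewrite !coord_shift; apply: wd_agree.
  by have := ltn_ord j; lia.
pose nu (p : n.-tuple I * W) := if p.2 \in lang N then
  expR (q * phi n (base p.2)) / Zk * \prod_(j < n) kappa (tnth p.1 j) (c' (shift j%:Z (base p.2)))
  else 0.
have nup p : p.2 \in lang N -> 0 < nu p.
  move=> pl; rewrite /nu pl mulr_gt0 ?divr_gt0 ?expR_gt0//.
  by apply: prodr_gt0 => j _; exact: kappa_gt0.
have nu0 p : 0 <= nu p.
  by case: (boolP (p.2 \in lang N)) => [/nup/ltW//|pl]; rewrite /nu (negPf pl).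
have nu1 : \sum_p nu p <= 1.
  rewrite -(pair_bigA _ (fun w v => nu (w, v)))/= exchange_big /=.
  rewrite (bigID (mem (@lang R X N)))/= [X in _ + X]big1 ?addr0; last first.
    by move=> v vl; rewrite big1// => w _; rewrite /nu (negPf vl).
  apply: (@le_trans _ _ (\sum_(v in @lang R X N) expR (q * phi n (base v)) / Zk)); last first.
    by rewrite -mulr_suml -/Zk mulfV// gt_eqF.
  apply: ler_sum => v vl; rewrite /nu /= vl.
  rewrite -mulr_sumr (sum_tuple_prod (fun j a => kappa a (c' (shift j%:Z (base v))))) ler_piMr ?divr_ge0 ?expR_ge0 ?(ltW Zk0)//.
  by apply: Num.Theory.prodr_ile1 => j _; rewrite kappa_sum andbT sumr_ge0// => a _; exact/ltW/kappa_gt0.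
have := @gibbs R X M m im _ _ cd fst nu lcd nu0 _ nu1.
rewrite [_ \o _](_ : _ = itinerary c n)//.
have -> : - expect m cd (fun p => ln (nu p)) = expect m cd (fun p => - ln (nu p)).
  by rewrite /expect -sumrN; apply: eq_bigr => p _; rewrite mulNr.
move=> H; have {}H : label_entropy m (itinerary c n) <= expect m cd (fun p => - ln (nu p)).
  by apply: H => p p0; have [x <-] := pr_inhabited im p0; apply: nup; exact: wd_lang.
pose L (a b : I) := - ln (kappa a b).
have {}H : label_entropy m (itinerary c n) <= expect m cd (fun p => (ln Zk - q * phi n (base p.2)) +
    \sum_(j < n) L (tnth p.1 j) (c' (shift j%:Z (base p.2)))).
  apply: le_trans H _; apply: (expect_le im) => x; rewrite /nu wd_lang.
  have pr0 : 0 < \prod_(j < n) kappa (tnth (cd x).1 j) (c' (shift j%:Z (base (cd x).2))).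
    by apply: prodr_gt0 => j _; exact: kappa_gt0.
  rewrite lnM ?posrE ?divr_gt0 ?expR_gt0// ln_div ?posrE ?expR_gt0// expRK.
  rewrite opprD opprB; apply: lerD => //.
  by rewrite /L sumrN lerN2 ln_prod.
rewrite expectD expect_sum in H.
have lL : 0 <= - ln (1 - de) by rewrite oppr_ge0 ln_le0// gerBl ltW.
have lI : 0 <= ln (#|I|%:R / de).
  apply: ln_ge0; rewrite ler_pdivlMr// mul1r (le_trans (ltW de1))//.
  by rewrite ler1n -(ltr0n R).
have lc' : label M c' by exact: (label_agree im c'k).
have lneq : label M (fun x => c x != c' x).
  by apply: (@label_comp _ _ _ _ im _ _ (fun x => (c x, c' x)) (fun p => p.1 != p.2)); exact: (label_pair im).
have hL (j : 'I_n) : expect m cd (fun p => L (tnth p.1 j) (c' (shift j%:Z (base p.2)))) <=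
    - ln (1 - de) + ln (#|I|%:R / de) * m [set x | c x != c' x].
  apply: (@le_trans _ _ (expect m ((fun x => c x != c' x) \o shift j%:Z)
    (fun b => - ln (1 - de) + ln (#|I|%:R / de) * b%:R))).
    apply: expect_le2 => //; first exact: (label_shift im).
    move=> x /=; rewrite tnth_mktuple c'_base /L /kappa; case: eqP => _ /=.
      by rewrite mulr0 addr0.
    by rewrite mulr1 -lnV ?posrE ?divr_gt0// invf_div lerDr.
  rewrite (expect_shift im)// expectD (expect_cst im)// lerD2l expectZ ler_wpM2l//.
  rewrite /expect big_bool /= mul1r mul0r addr0 /pr.
  by rewrite le_eqVlt; apply/orP; left; apply/eqP; congr m; apply/seteqP; split.
have hS : \sum_(j < n) expect m cd (fun p => L (tnth p.1 j) (c' (shift j%:Z (base p.2)))) <=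
    n%:R * (- ln (1 - de) + ln (#|I|%:R / de) * m [set x | c x != c' x]).
  rewrite mulr_natl -[X in _ *+ X](card_ord n) -sumr_const.
  by apply: ler_sum => j _; exact: hL.
have hg : `|expect m wd (fun v => phi n (base v)) - mean_phi m phi n| <= C0 + C0.
  apply: (mean_phi_near im pot lwd) => x; apply: (pot_dist pot).
  by apply/eq_wordP => i ni; apply: wd_agree; move: ni; clear; lia.
have hq : expect m cd (fun p => ln Zk - q * phi n (base p.2)) <=
    ln (partition_sum phi q n) + (ln K + `|q| * (C0 + C0)) - q * mean_phi m phi n.
  have -> : expect m cd (fun p => ln Zk - q * phi n (base p.2)) =
      ln Zk - q * expect m wd (fun v => phi n (base v)).
    rewrite expectD (expect_cst im)//; congr (_ + _); rewrite -mulNr -expectZ.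
    rewrite -[wd]/(snd \o cd) (expect_comp im)//; apply: eq_bigr => p _ /=.
    by rewrite [- q * _]mulNr.
  have : ln Zk <= ln K + ln (partition_sum phi q n).
    have Zn0 : 0 < partition_sum phi q n := partition_sum_gt0 pot q n.
    by rewrite -lnM ?posrE// ler_ln ?posrE//; exact: mulr_gt0.
  have : `|q * (expect m wd (fun v => phi n (base v)) - mean_phi m phi n)| <= `|q| * (C0 + C0).
    by rewrite normrM ler_wpM2l.
  by rewrite ler_norml mulrBr => /andP[+ _]; lra.
by move: H hS hq; lra.
Qed.

End kernel.
End entropy_pressure.

Section invariant_measures.
Context {R : realType} {X : sft R}.
Local Notation Sigma := (shift_space X).
Implicit Types (x y z : Sigma).

Lemma agree_borel k (A : set Sigma) : (forall x y, agree x y k -> A x -> A y) ->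
  measurable (A : set (borel_space X)).
Proof.
by move=> h; apply: open_borel; apply/open_agreeP => x Ax; exists k => y /h; exact.
Qed.

Lemma shift_borel (j : int) (A : set Sigma) : measurable (A : set (borel_space X)) ->
  measurable (shift j @^-1` A : set (borel_space X)).
Proof.
move=> mA; rewrite -[_ @^-1` _]setTI.
have mf : measurable_fun setT (shift j : borel_space X -> borel_space X).
  apply: (@measurability _ _ (borel_space X) (borel_space X) setT (shift j) (@open Sigma) erefl) => _ [B oB <-].
  rewrite setTI.
  apply: open_borel; apply/open_agreeP => x /= Bx.
  move: oB => /open_agreeP /(_ _ Bx)[k hk]; exists (k + `|j|)%N => y xy.
  by apply: hk; exact: agree_shift.
exact: mf.
Qed.

Variable mu : probability (borel_space X) R.

Definition measure_mean (A : set Sigma) : R := fine (mu A).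

Lemma measure_meanE (A : set Sigma) : measurable (A : set (borel_space X)) ->
  (measure_mean A)%:E = mu A.
Proof. by move=> mA; rewrite fineK// fin_num_measure. Qed.

Lemma measure_invariant_mean : invariant_measure mu ->
  invariant_mean (fun A : set Sigma => measurable (A : set (borel_space X))) measure_mean.
Proof.
move=> inv.
split.
- by move=> A B; exact: measurableU.
- by move=> A B; exact: measurableI.
- by move=> A; exact: fine_ge0.
- by rewrite /measure_mean probability_setT.
- move=> A B mA mB AB; apply: EFin_inj.
  rewrite EFinD !measure_meanE//; last exact: measurableU.
  by rewrite measureU.
- by move=> j A; exact: shift_borel.
- move=> j A; apply: shift_invariant_int => [i B|B mB]; first exact: shift_borel.
  by rewrite /measure_mean inv.
- by move=> k A; exact: agree_borel.
Qed.

Lemma mean_phi_integral (phi : nat -> Sigma -> R) C0 C1 c D n : potential phi C0 C1 c D ->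
  invariant_measure mu ->
  `|\int[mu]_x phi n x - mean_phi measure_mean phi n| <= C0.
Proof.
move=> pot inv; have im := measure_invariant_mean inv.
pose g (w : n.-tuple 'I_(sft_card X)) := phi n (rep w).
have bint (f : Sigma -> R) B : measurable_fun setT (f : borel_space X -> R) ->
    (forall x, `|f x| <= B) -> mu.-integrable setT (EFin \o f).
  move=> mf fB; apply: measurable_bounded_integrable => //.
    by rewrite -ge0_fin_numE// fin_num_measure.
  by exists B; split; rewrite ?num_real// => b Bb x _; exact: le_trans (fB x) (ltW Bb).
have near x : `|phi n x - g (word n x)| <= C0.
  by rewrite (pot_dist pot)// word_rep ?word_lang.
have mg : measurable_fun setT ((g \o word n) : borel_space X -> R).
  apply: measurable_agree => x e e0; exists n => y xy /=.
  suff -> : word n x = word n y by rewrite subrr normr0.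
  by apply/eq_wordP => i ni; apply: xy; lia.
have bg x : `|(g \o word n) x| <= C1 * n%:R by exact: (pot_le pot).
have ig := bint _ _ mg bg.
have iphi := bint _ _ (pot_measurable pot n) (pot_le pot n).
have mw w : measurable (word n @^-1` [set w] : set (borel_space X)).
  exact: (@label_word _ _ _ _ im n w).
have -> : mean_phi measure_mean phi n = \int[mu]_x (g \o word n) x.
  apply: EFin_inj; rewrite /Rintegral fineK; last exact: integrable_fin_num ig.
  have -> : (fun x : borel_space X => ((g \o word n) x)%:E) =
      (fun x => \sum_w (g w * \1_(word n @^-1` [set w]) x)%:E)%E.
    apply/funext => x; rewrite sumEFin (bigD1 (word n x))//= indicE mem_set// mulr1.
    rewrite big1 ?addr0// => w wx; rewrite indicE memNset ?mulr0//= => xw.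
    by rewrite xw eqxx in wx.
  rewrite integral_sum//; last first.
    move=> w; apply: (bint (fun x => g w * \1_(word n @^-1` [set w]) x) `|g w|).
      by apply: measurable_realfun.measurable_funM => //; exact: measurable_indic.
    by move=> x; rewrite normrM indicE ler_piMr//; case: (_ \in _); rewrite ?normr1 ?normr0.
  rewrite -sumEFin; apply: eq_bigr => w _; rewrite EFinM measure_meanE//.
  under eq_integral do rewrite EFinM.
  rewrite integralZl//; last exact: integrable_indic.
  by rewrite integral_indic// setIT.
have mu1 : fine (mu [set: borel_space X]) = 1 by rewrite [mu _](@probability_setT _ _ _ mu).
rewrite -RintegralB// ler_norml; apply/andP; split.
- rewrite -[leLHS]mulr1 -mu1 -Rintegral_cst//.
  apply: le_Rintegral => //.
  + by apply: (bint _ `|- C0|) => // x.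
  + rewrite [EFin \o _](_ : _ = (EFin \o phi n) \- (EFin \o (g \o word n)))%E//.
    exact: integrableB.
  by move=> x _; have := near x; rewrite ler_norml => /andP[].
- rewrite -[leRHS]mulr1 -mu1 -Rintegral_cst//.
  apply: le_Rintegral => //.
  + rewrite [EFin \o _](_ : _ = (EFin \o phi n) \- (EFin \o (g \o word n)))%E//.
    exact: integrableB.
  + by apply: (bint _ `|C0|) => // x.
  by move=> x _; have := near x; rewrite ler_norml => /andP[].
Qed.

(** The approximable sets form a sigma-algebra containing the open sets. A countable union is first
    truncated, by continuity from above, and then its finitely many members are approximated. *)
Lemma borel_agree_approx (A : set Sigma) (e : R) : measurable (A : set (borel_space X)) -> 0 < e ->
  exists k (B : set Sigma), (forall x y, agree x y k -> B x -> B y) /\ (mu (A `+` B) < e%:E)%E.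
Proof.
move=> mA; move: e; pose good (A : set Sigma) := measurable (A : set (borel_space X)) /\
  forall e : R, 0 < e -> exists k (B : set Sigma),
    (forall x y, agree x y k -> B x -> B y) /\ (mu (A `+` B) < e%:E)%E.
suff [] : good A by [].
have agreeC k (B : set Sigma) : (forall x y, agree x y k -> B x -> B y) ->
    forall x y, agree x y k -> (~` B) x -> (~` B) y.
  by move=> h x y; rewrite agree_sym => xy Bx /(h _ _ xy).
have mY (A1 A2 : set Sigma) : measurable (A1 : set (borel_space X)) ->
    measurable (A2 : set (borel_space X)) -> measurable (A1 `+` A2 : set (borel_space X)).
  by move=> m1 m2; apply: measurableU; exact: measurableD.
have union (F : (set Sigma)^nat) : (forall n, good (F n)) -> good (\bigcup_n F n).
  move=> gF; have mF n : measurable (F n : set (borel_space X)) by have [] := gF n.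
  have mU : measurable (\bigcup_n F n : set (borel_space X)) by exact: bigcup_measurable.
  split => // e e0; have e2 : 0 < e / 2 by rewrite divr_gt0.
  pose U N := \big[setU/set0]_(i < N) F i.
  have mUN N : measurable (U N : set (borel_space X)) by exact: bigsetU_measurable.
  pose T N := (\bigcup_n F n) `\` U N.
  have mT N : measurable (T N : set (borel_space X)) by exact: measurableD.
  have T0 : \bigcap_N T N = set0.
    apply/seteqP; split => // x Tx; have [n _ Fx] := (Tx 0%N I).1.
    apply: (Tx n.+1 I).2; rewrite /U -bigcup_mkord; exists n => //=.
  have [N hN] : exists N, (mu (T N) < (e / 2)%:E)%E.
    have cT : mu \o T @ \oo --> mu (\bigcap_N T N).
      apply: nonincreasing_cvg_mu => //.
      - by rewrite -ge0_fin_numE// fin_num_measure.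
      - by rewrite T0.
      - move=> a b ab; apply/subsetPset; apply: setDS.
        by rewrite /U -!bigcup_mkord; apply: bigcup_sub => i ia; apply: bigcup_sup => /=; exact: leq_trans ab.
    rewrite T0 measure0 in cT; have /fine_cvgP[_ /cvgrPdist_lt /(_ _ e2)] := cT.
    move=> [N _ /(_ N (leqnn _))] /=; rewrite sub0r normrN => h; exists N.
    rewrite -[mu _]fineK ?fin_num_measure// lte_fin; exact: le_lt_trans (ler_norm _) h.
  have N1 : 0 < e / 2 / N.+1%:R by rewrite divr_gt0.
  have ch n : exists kB : nat * set Sigma, (forall x y, agree x y kB.1 -> kB.2 x -> kB.2 y) /\
      (mu (F n `+` kB.2) < (e / 2 / N.+1%:R)%:E)%E.
    by have [_ /(_ _ N1)[k [B hB]]] := gF n; exists (k, B).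
  pose kB n := sval (cid (ch n)); have hkB n := svalP (cid (ch n)).
  pose k := \max_(i < N) (kB i).1; pose B := \bigcup_(i in `I_N) (kB i).2.
  exists k, B; split.
    move=> x y xy [i iN Bx]; exists i => //; have [h _] := hkB i; apply: h Bx.
    by apply: agreeW xy; rewrite /k (bigD1 (Ordinal iN))//= leq_maxl.
  have mB i : measurable ((kB i).2 : set (borel_space X)).
    by have [h _] := hkB i; exact: agree_borel h.
  pose V := \big[setU/set0]_(i < N) (F i `+` (kB i).2).
  have mV : measurable (V : set (borel_space X)).
    by apply: bigsetU_measurable => i _; exact: mY.
  have UE : U N = \bigcup_(i in `I_N) F i by rewrite bigcup_mkord.
  have VE : V = \bigcup_(i in `I_N) (F i `+` (kB i).2) by rewrite bigcup_mkord.
  have sub : (\bigcup_n F n) `+` B `<=` T N `|` V.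
    move=> x [[[n _ Fx] nB]|[[i iN Bx] nF]].
      have [UNx|nUN] := pselect (U N x); last by left; split => //; exists n.
      right; move: UNx; rewrite UE VE => -[i iN Fix]; exists i => //; left.
      by split => // Bx; apply: nB; exists i.
    by right; rewrite VE; exists i => //; right; split => // Fx; apply: nF; exists i.
  apply: (@le_lt_trans _ _ (mu (T N `|` V))).
    apply: le_measure => //; rewrite inE; first by apply: mY => //; exact: bigcup_measurable.
    exact: measurableU.
  apply: (@le_lt_trans _ _ (mu (T N) + mu V)%E); first exact: measureU2.
  have -> : e%:E = ((e / 2)%:E + (e / 2)%:E)%E by rewrite -EFinD -splitr.
  apply: lte_leD => //; first by rewrite fin_num_measure.
  apply: le_trans (@Boole_inequality _ _ _ mu (fun i => F i `+` (kB i).2) N _) _; first by move=> i _; exact: mY.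
  apply: (@le_trans _ _ (\sum_(i < N) (e / 2 / N.+1%:R)%:E)%E).
    by apply: lee_sum => i _; apply: ltW; have [_] := hkB i.
  rewrite sumEFin lee_fin sumr_const card_ord -[leLHS]mulr_natr.
  apply: (@le_trans _ _ (e / 2 / N.+1%:R * N.+1%:R)); last by rewrite mulfVK.
  by rewrite ler_wpM2l ?(ltW N1)// ler_nat.
apply: (smallest_sub (X := good) _ _ mA).
  split => //; last first.
    move=> A1 [m1 h1]; split; first by rewrite setTD; exact: measurableC.
    move=> e /h1[k [B [hB AB]]]; exists k, (~` B); split; first exact: agreeC.
    rewrite (_ : _ `+` _ = A1 `+` B)//; apply/seteqP; split => x /=;
      by have [a|a] := pselect (A1 x); have [b|b] := pselect (B x); tauto.
  split => // e e0; exists 0%N, set0; split => //.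
  by rewrite setYK measure0 lte_fin.
move=> U oU; have mU := open_borel oU.
pose V k : set Sigma := [set x | forall y, agree x y k -> U y].
have VU k : V k `<=` U by move=> x; apply.
have gV k : good (V k).
  have aV : forall x y, agree x y k -> V k x -> V k y.
    by move=> x y xy Vx z yz; apply: Vx; exact: agree_trans yz.
  split; first exact: agree_borel aV.
  by move=> e e0; exists k, (V k); rewrite setYK measure0 lte_fin.
rewrite (_ : U = \bigcup_k V k); first exact: union.
apply/seteqP; split => x; last by move=> [k _ /VU].
by move: oU => /open_agreeP/[apply] -[k hk]; exists k.
Qed.

Lemma partition_agree_approx (I : finType) (c : Sigma -> I) (e : R) : 0 < e ->
  (forall i, measurable (c @^-1` [set i] : set (borel_space X))) ->
  exists k (c' : Sigma -> I), (forall x y, agree x y k -> c' x = c' y) /\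
    measure_mean [set x | c x != c' x] <= e.
Proof.
move=> e0 mc; have I0 : 0 < #|I|%:R :> R by rewrite ltr0n; apply/card_gt0P; exists (c point).
have e1 : 0 < e / #|I|%:R by rewrite divr_gt0.
have ch i : exists kB : nat * set Sigma, (forall x y, agree x y kB.1 -> kB.2 x -> kB.2 y) /\
    (mu (c @^-1` [set i] `+` kB.2) < (e / #|I|%:R)%:E)%E.
  by have [k [B hB]] := borel_agree_approx (mc i) e1; exists (k, B).
pose kB i := sval (cid (ch i)); have hkB i := svalP (cid (ch i)).
pose k := \max_i (kB i).1.
(* The approximating sets may overlap or leave gaps, but the label so chosen differs from [c x] only
   if [x] lies in one of the symmetric differences. *)
pose c' x := if [pick i | `[< (kB i).2 x >]] is Some i then i else c point.
have Bk i x y : agree x y k -> (kB i).2 x -> (kB i).2 y.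
  by move=> xy; have [h _] := hkB i; apply: h; apply: agreeW xy; rewrite /k (bigD1 i)//= leq_maxl.
have c'k x y : agree x y k -> c' x = c' y.
  move=> xy; rewrite /c' (@eq_pick _ _ (fun i => `[< (kB i).2 y >]))// => i.
  apply/asboolP/asboolP; first exact: Bk.
  by apply: Bk; rewrite agree_sym.
exists k, c'; split => //.
have mB i : measurable ((kB i).2 : set (borel_space X)).
  by have [h _] := hkB i; exact: agree_borel h.
have mY i : measurable (c @^-1` [set i] `+` (kB i).2 : set (borel_space X)).
  by apply: measurableU; exact: measurableD.
have mc' i : measurable (c' @^-1` [set i] : set (borel_space X)).
  by apply: (@agree_borel k) => x y /c'k /= ->.
pose S := \big[setU/set0]_(i <- enum I) (c @^-1` [set i] `+` (kB i).2).
have mu_S : (mu S <= \sum_(i <- enum I) (e / #|I|%:R)%:E)%E.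
  rewrite /S; elim: (enum I) => [|i s IH]; first by rewrite !big_nil measure0.
  rewrite !big_cons; apply: le_trans (measureU2 _ _ _) _ => //.
    by apply: bigsetU_measurable => j _; exact: mY.
  by apply: leeD => //; apply: ltW; have [_] := hkB i.
have mneq : measurable ([set x | c x != c' x] : set (borel_space X)).
  rewrite (_ : [set x | _] = \big[setU/set0]_(i <- enum I) (c @^-1` [set i] `\` c' @^-1` [set i])).
    by apply: bigsetU_measurable => i _; exact: measurableD.
  rewrite -bigcup_seq; apply/seteqP; split => x /=.
    by move=> cx; exists (c x); [rewrite /= mem_enum|split => // c'x; rewrite c'x eqxx in cx].
  by move=> [i _ [<- h]]; apply/eqP => h'; apply: h; rewrite /= -h'.
rewrite -lee_fin measure_meanE//; apply: (@le_trans _ _ (mu S)).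
  apply: le_measure; rewrite ?inE//; first by apply: bigsetU_measurable => i _; exact: mY.
  rewrite /S -bigcup_seq => x /= cx; apply: contrapT => nY.
  have nYi i : ~ (c @^-1` [set i] `+` (kB i).2) x.
    by move=> Yx; apply: nY; exists i; rewrite //= mem_enum.
  move/eqP: cx; apply; rewrite /c'; case: pickP => [i /asboolP Bx|h].
    by apply: contrapT => cx; apply: (nYi i); right.
  apply: contrapT => _; apply: (nYi (c x)); left; split => // Bx.
  by have := h (c x); rewrite asboolT.
apply: le_trans mu_S _; rewrite sumEFin lee_fin big_enum sumr_const.
by rewrite -[leLHS]mulr_natr mulfVK// gt_eqF.
Qed.

Variables (phi : nat -> Sigma -> R) (C0 C1 c0 : R) (D : nat).
Hypothesis pot : potential phi C0 C1 c0 D.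
Hypothesis inv : invariant_measure mu.

Lemma partition_entropyE m (c : Sigma -> 'I_m) n :
  partition_entropy mu c n = label_entropy measure_mean (itinerary c n).
Proof.
rewrite /partition_entropy /label_entropy; congr (- _); apply: eq_bigr => w _.
rewrite /pr /measure_mean (_ : word_atom c w = itinerary c n @^-1` [set w])//.
apply/seteqP; split => x /=.
  by move=> h; apply: eq_from_tnth => j; rewrite tnth_mktuple h.
by move=> <- j; rewrite tnth_mktuple.
Qed.

Definition phi_mean : R := lim ((fun n : nat => n%:R^-1 * mean_phi measure_mean phi n) @ \oo).

Lemma phi_mean_cvg : (fun n : nat => n%:R^-1 * mean_phi measure_mean phi n) @ \oo --> phi_mean.
Proof. exact: (mean_phi_cvg (measure_invariant_mean inv) pot). Qed.

Lemma phi_meanE : lim ((fun n : nat => n%:R^-1 * \int[mu]_x phi n x) @ \oo) = phi_mean.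
Proof.
apply/cvg_lim => //.
rewrite (_ : (fun n : nat => _) = (fun n : nat => n%:R^-1 * mean_phi measure_mean phi n +
  n%:R^-1 * (\int[mu]_x phi n x - mean_phi measure_mean phi n))); last first.
  by apply/funext => n; rewrite -mulrDr subrKC.
rewrite -[X in _ --> X]addr0; apply: cvgD; first exact: phi_mean_cvg.
apply: (@squeeze_cvgr _ _ _ _ (fun n : nat => - (n%:R^-1 * C0)) (fun n : nat => n%:R^-1 * C0)).
- apply: nearW => n; have := mean_phi_integral n pot inv; rewrite ler_norml => /andP[h1 h2].
  by rewrite -mulrN !ler_wpM2l ?invr_ge0.
- by rewrite -[X in _ --> X](oppr0) -[X in - X](mul0r C0); apply: cvgN; apply: cvgMl; exact: cvg_invn.
- by rewrite -[X in _ --> X](mul0r C0); apply: cvgMl; exact: cvg_invn.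
Qed.

Theorem variational_le q :
  (measure_entropy mu + (q * phi_mean)%:E <= (topological_pressure phi q)%:E)%E.
Proof.
rewrite -leeBrDr//; apply: ge_ereal_sup => _ [m [c [mc ->]]].
rewrite leeBrDr// -EFinD lee_fin.
have im := measure_invariant_mean inv.
set h := lim _; have hE : (fun n : nat => n%:R^-1 * partition_entropy mu c n) @ \oo --> h.
  have := @itinerary_entropy_cvg _ _ _ _ im _ c mc.
  by rewrite /h; under [in X in X -> _]eq_fun do rewrite -partition_entropyE.
(* A quarter of [e] each for the excess over the pressure, the constant [K], the faithful symbols of
   the channel and the disagreements. The choice of [de] makes [- ln (1 - de)] equal to [e4]. *)
apply/ler_addgt0Pr => e e0; pose e4 := e / 4; have e40 : 0 < e4 by rewrite divr_gt0.
pose de := 1 - expR (- e4).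
have de0 : 0 < de by rewrite subr_gt0 -expR0 ltr_expR oppr_lt0.
have de1 : de < 1 by rewrite ltrBlDr ltrDl expR_gt0.
have lnde : - ln (1 - de) = e4 by rewrite /de subKr expRK opprK.
have m0 : (0 < m)%N by exact: leq_ltn_trans (leq0n _) (ltn_ord (c point)).
pose L := ln (#|'I_m|%:R / de).
pose eta := e4 / (`|L| + 1); have L1 : 0 < `|L| + 1 by rewrite ltr_wpDl.
have eta0 : 0 < eta by rewrite divr_gt0.
have [k [c' [c'k cc']]] := partition_agree_approx eta0 mc.
have [K hK] := @itinerary_entropy_le R X _ _ im phi _ _ _ _ pot _ c c' k de mc c'k de0 de1 q.
have Leta : L * measure_mean [set x | c x != c' x] <= e4.
  have m00 : 0 <= measure_mean [set x | c x != c' x] by exact: (im_ge0 im).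
  apply: (@le_trans _ _ (`|L| * eta)).
    by apply: le_trans (ler_wpM2r m00 (ler_norm L)) _; exact: ler_wpM2l.
  by rewrite /eta mulrCA ler_piMr ?(ltW e40)// ler_pdivrMr// mul1r lerDl.
have [N1 hN1] : exists N, forall n, (N <= n)%N ->
    ln (partition_sum phi q n) <= (topological_pressure phi q + e4) * n%:R.
  by apply: (pressure_lt pot); rewrite ltrDl.
have [N2 hN2] := exists_nat_ge (K / e4).
have cv : (fun n : nat => n%:R^-1 * partition_entropy mu c n +
    q * (n%:R^-1 * mean_phi measure_mean phi n)) @ \oo --> h + q * phi_mean.
  by apply: cvgD => //; apply: cvgMr; exact: phi_mean_cvg.
rewrite -(cvg_lim _ cv)//; apply: limr_le; first by apply/cvg_ex; eexists; exact: cv.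
exists (maxn 1 (maxn N1 N2)) => // n /=; rewrite !geq_max => /and3P[n1 /hN1 h1 /hN2 h2].
have n0 : 0 < n%:R :> R by rewrite ltr0n.
move: h2; rewrite ler_pdivrMr// => h2.
rewrite /= mulrCA -mulrDr mulrC ler_pdivrMr// partition_entropyE.
apply: le_trans (hK n) _; rewrite lnde -/L.
have : n%:R * (e4 + L * measure_mean [set x | c x != c' x]) <= n%:R * (e4 + e4).
  by rewrite ler_wpM2l// lerD2l.
by rewrite /e4 in h1 h2 *; lra.
Qed.

End invariant_measures.

Lemma uniq_map_flatten (T : eqType) (U1 U2 : eqType) (w1 : T -> U1) (w2 : T -> U2)
    (f : T -> seq T) (s : seq T) :
  (forall y y', w2 y = w2 y' -> w1 y = w1 y') -> (forall z y, z \in s -> y \in f z -> w1 y = w1 z) ->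
  (forall z, z \in s -> uniq (map w2 (f z))) -> uniq (map w1 s) ->
  uniq (map w2 (flatten (map f s))).
Proof.
move=> w21; elim: s => //= z s IH fw fu /andP[zs us].
rewrite map_cat cat_uniq fu ?mem_head// IH//; last 2 first.
- by move=> z' y z's; apply: fw; rewrite inE z's orbT.
- by move=> z' z's; apply: fu; rewrite inE z's orbT.
rewrite andbT /=; apply/hasPn => v /mapP[y /flattenP[_ /mapP[z' z's ->] yz'] ->].
apply/negP => /mapP[y' y'z /w21 yy']; case/negP: zs; apply/mapP; exists z' => //.
by rewrite -(fw z y') ?mem_head// -yy' (fw z' y)// inE z's orbT.
Qed.

Lemma uniq_map_coarse (T U1 U2 : eqType) (w1 : T -> U1) (w2 : T -> U2) (s : seq T) :
  {in s &, forall y y', w2 y = w2 y' -> w1 y = w1 y'} -> uniq (map w1 s) -> uniq (map w2 s).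
Proof.
elim: s => //= z s IH w21 /andP[zs us]; rewrite IH ?andbT//; last first.
  by move=> y y' ys y's; apply: w21; rewrite inE ?ys ?y's orbT.
apply: contra zs => /mapP[y ys zy]; apply/mapP; exists y => //.
by apply: w21; rewrite ?mem_head// inE ys orbT.
Qed.

Lemma sum_count_ord (T : Type) (F : seq T) (dd : T -> nat) D : (forall y, (dd y <= D)%N) ->
  (\sum_(i < D.+1) count (fun y => dd y == i) F)%N = size F.
Proof.
move=> ddD; elim: F => [|y F IH] /=; first by rewrite big1.
rewrite big_split /= IH (bigD1 (Ordinal (ddD y : (dd y < D.+1)%N)))//= eqxx big1// => i.
by case: (dd y =P i :> nat) => // di ni; case/eqP: ni; apply: val_inj.
Qed.

(** * Free concatenation of orbit segments *)

Section stages.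
Context {R : realType} {X : sft R}.
Local Notation Sigma := (shift_space X).
Implicit Types (x y z : Sigma).
Variables (phi : nat -> Sigma -> R) (C0 C1 c0 : R) (D : nat).
Hypothesis pot : potential phi C0 C1 c0 D.

(* Any orbit segment of length [L] can be continued for a time [n] in [M] distinct ways,
   each of which adds [a] to the potential, up to [e]. *)
Definition stage (a e : R) (n M : nat) := forall u (L : nat), exists ch : seq Sigma,
  [/\ size ch = M, uniq (map (word (L + n)) ch) & forall z, z \in ch ->
    [/\ forall i : int, i < L%:Z -> coord z i = coord u i,
        `|phi (L + n)%N z - phi L u - a| <= e &
        forall x, word n x = word n (shift L%:Z z) -> phi n x <= a + e]].

Lemma stage_le a a' e e' n M M' : `|a - a'| <= e' - e -> (M' <= M)%N ->
  stage a e n M -> stage a' e' n M'.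
Proof.
rewrite ler_norml => /andP[ae1 ae2] MM h u L; have [ch [sch uch hch]] := h u L.
exists (take M' ch); split.
- by rewrite size_takel// sch.
- by rewrite map_take take_uniq.
move=> z /mem_take /hch[h1 h2 h3]; split => //.
  by move: h2; rewrite !ler_norml => /andP[h2 h2']; apply/andP; split; lra.
by move=> x /h3 h4; lra.
Qed.

(** No new loss arises at the junction: a stage can be attached to any past, and its connection is
    already part of its length and of its error. *)
Lemma stage_cat a1 a2 e1 e2 n1 n2 M1 M2 : stage a1 e1 n1 M1 -> stage a2 e2 n2 M2 ->
  stage (a1 + a2) (e1 + e2) (n1 + n2) (M1 * M2).
Proof.
move=> s1 s2 u L; have [ch1 [sch1 uch1 hch1]] := s1 u L.
pose f z := sval (cid (s2 z (L + n1)%N)); have hf z := svalP (cid (s2 z (L + n1)%N)).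
exists (flatten (map f ch1)); split.
- rewrite size_flatten /shape -map_comp -sch1.
  elim: (ch1) => //= z s IH; rewrite IH mulSn.
  by have [+ _ _] := hf z; rewrite -/(f z) => ->.
- apply: (@uniq_map_flatten _ _ _ (word (L + n1))) => //.
  + by move=> y y'; apply: eq_word_le; rewrite addnA leq_addr.
  + move=> z y _ yz; have [_ _ /(_ y yz)[h _ _]] := hf z.
    by apply/eq_wordP => i iL; apply: h.
  + by move=> z _; have [_ + _] := hf z; rewrite addnA.
move=> y /flattenP[_ /mapP[z zch ->] yz].
have [h1 h2 h3] := hch1 z zch; have [_ _ /(_ y yz)[h1' h2' h3']] := hf z.
split.
- by move=> i iL; rewrite h1' ?h1//; lia.
- move: h2 h2'; rewrite addnA !ler_norml => /andP[h2 h4] /andP[h2' h4'].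
  by apply/andP; split; lra.
move=> x /eq_wordP xy; apply: le_trans (pot_subadd pot n1 n2 x) _.
have : phi n1 x <= a1 + e1.
  apply: h3; apply/eq_wordP => i ni; rewrite xy ?coord_shift ?h1'//; last by lia.
  by move: ni; clear; lia.
have : phi n2 (shift n1%:Z x) <= a2 + e2.
  apply: h3'; apply/eq_wordP => i ni; rewrite coord_shift -PoszD xy; last by lia.
  by rewrite !coord_shift; congr (coord y _); lia.
lra.
Qed.

Lemma stage0 : stage 0 0 0 1.
Proof.
move=> u L; exists [:: u]; split => // z; rewrite inE => /eqP ->; split => //.
  by rewrite addn0 subrr subr0 normr0.
by move=> x _; rewrite addr0; have := pot_le pot 0 x; rewrite mulr0 normr_le0 => /eqP ->.
Qed.

Lemma stage_iter a e n M m : stage a e n M ->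
  stage (m%:R * a) (m%:R * e) (m * n) (M ^ m).
Proof.
move=> s; elim: m => [|m IH]; first by rewrite !mul0r; exact: stage0.
by rewrite -natr1 !mulrDl !mul1r mulSnr expnSr; exact: stage_cat.
Qed.

(** For a given past, each member is attached through a gap of length at most [D]. By the pigeonhole
    principle some gap length [d], which may depend on the past, serves at least one member in
    [D.+1]; a tail of length [D - d] then gives all continuations the length [N + D]. *)
Lemma stage_of_family N (F : seq Sigma) a e : F != [::] -> uniq (map (word N) F) ->
  (forall y, y \in F -> `|phi N y - a| <= e) ->
  stage a (e + (2 * C0 + C1 * D%:R + c0)) (N + D) (((size F).-1 %/ D.+1).+1).
Proof.
move=> F0 uF hF u L.
have ch y : exists wd : Sigma * nat, [/\ (wd.2 <= D)%N,
    forall i : int, i < L%:Z -> coord wd.1 i = coord u i,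
    forall i : int, 0 <= i -> coord wd.1 (i + (L + wd.2)%N%:Z) = coord y i &
    phi L u + phi N y - c0 <= phi (L + wd.2 + N)%N wd.1].
  by have [w [d [h1 h2 h3 h4]]] := pot_connect pot u y L N; exists (w, d).
pose wd y := sval (cid (ch y)); have hwd y := svalP (cid (ch y)).
have dD y : ((wd y).2 <= D)%N by have [] := hwd y.
(* The size of [F] divided by [D.+1], rounded up. *)
set M := (_ %/ _).+1.
have [d hd] : exists d, (M <= count (fun y => (wd y).2 == d) F)%N.
  apply: contrapT => h.
  have : (\sum_(i < D.+1) count (fun y => (wd y).2 == i) F <= \sum_(i < D.+1) (M.-1))%N.
    apply: leq_sum => i _; rewrite leqNgt; apply/negP => hi; apply: h; exists (i : nat).
    by rewrite -[M]prednK.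
  rewrite (sum_count_ord F dD) sum_nat_const card_ord /M /= mulnC.
  have := leq_trunc_div (size F).-1 D.+1; have : (0 < size F)%N by case: (F) F0.
  by clear; lia.
pose G := take M [seq y <- F | (wd y).2 == d].
have GF y : y \in G -> y \in F /\ (wd y).2 = d.
  by move=> /mem_take; rewrite mem_filter => /andP[/eqP].
have uG : uniq (map (word N) G).
  rewrite /G map_take take_uniq//; apply: subseq_uniq uF.
  by apply: map_subseq; exact: filter_subseq.
exists [seq (wd y).1 | y <- G]; split.
- by rewrite size_map size_takel// size_filter.
- rewrite -map_comp; apply: uniq_map_coarse uG => y y' yG y'G /= /eq_wordP yy'.
  have [Fy dy] := GF y yG; have [Fy' dy'] := GF y' y'G.
  apply/eq_wordP => i ni; have [_ _ <- // _] := hwd y; have [_ _ <- // _] := hwd y'.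
  rewrite -/(wd y) -/(wd y') dy dy' -PoszD; apply: yy'.
  by have := dD y; rewrite dy; move: ni; clear; lia.
move=> _ /mapP[y yG ->]; have [Fy dy] := GF y yG.
have [h1 h2 h3 h4] := hwd y; rewrite -/(wd y) dy in h1 h2 h3 h4.
have := hF y Fy; rewrite !ler_norml => /andP[e1 e2].
have C00 := pot_C0_ge0 pot; have C10 := pot_C1_ge0 pot; have c00 := pot_c_ge0 pot.
have Dd : (D - d)%:R <= D%:R :> R by rewrite ler_nat leq_subr.
have CDd : C1 * (D - d)%:R <= C1 * D%:R by rewrite ler_wpM2l.
have blk x : word (N + D) x = word (N + D) (shift L%:Z (wd y).1) ->
    phi (N + D)%N x <= phi N y + C0 + C1 * D%:R.
  move=> /eq_wordP xw; have -> : (N + D = d + (N + (D - d)))%N by move: h1; clear; lia.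
  apply: le_trans (pot_subadd pot _ _ _) _.
  have := pot_subadd pot N (D - d) (shift d%:Z x).
  have := pot_le pot d x; have := pot_le pot (D - d) (shift N%:Z (shift d%:Z x)).
  have : `|phi N (shift d%:Z x) - phi N y| <= C0.
    apply: (pot_dist pot); apply/eq_wordP => i ni; rewrite coord_shift -PoszD xw; last by move: h1 ni; clear; lia.
    by rewrite -(h3 i)// coord_shift; congr (coord _ _); clear; lia.
  have -> : C1 * D%:R = C1 * d%:R + C1 * (D - d)%:R by rewrite -mulrDr -natrD subnKC.
  by rewrite !ler_norml => /andP[_ ?] /andP[_ ?] /andP[_ ?]; lra.
split => //; last by move=> x /blk; lra.
apply/andP; split.
  have := pot_extend pot (L + d + N) (D - d) (wd y).1.
  have -> : (L + d + N + (D - d) = L + (N + D))%N by move: h1; clear; lia.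
  by lra.
have := pot_subadd pot L (N + D) (wd y).1; have := blk _ erefl.
have : `|phi L (wd y).1 - phi L u| <= C0.
  by apply: (pot_dist pot); apply/eq_wordP => i iL; exact: h2.
by rewrite ler_norml => /andP[_ ?]; lra.
Qed.

End stages.

(* The supremum of the slopes of the chords from [(alpha, s)] to the points on its left is the
   slope of a line separating [(alpha, s)] from the convex set [G]. *)
Lemma convex_separation (R : realType) (G : R -> R -> Prop) (P : R -> R) (alpha s b1 b2 : R) :
  (forall b t t', t' <= t -> G b t -> G b t') ->
  (forall b b' t t' th, 0 <= th <= 1 -> G b t -> G b' t' ->
    G (th * b + (1 - th) * b') (th * t + (1 - th) * t')) ->
  b1 < alpha -> G b1 0 -> alpha < b2 -> G b2 0 ->
  (forall q, exists b, G b (P q - q * b)) -> (forall q, s < P q - alpha * q) -> G alpha s.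
Proof.
move=> Gdown Gconv b1a G1 ab2 G2 GP sP; apply: contrapT => nG.
have Glt t : G alpha t -> t < s by move=> Gt; rewrite ltNge; apply/negP => /Gdown /(_ Gt).
have slope b t b' t' : b < alpha -> G b t -> alpha < b' -> G b' t' ->
    (t - s) / (alpha - b) <= (s - t') / (b' - alpha).
  move=> ba Gb ab Gb'; have h1 : 0 < alpha - b by rewrite subr_gt0.
  have h2 : 0 < b' - alpha by rewrite subr_gt0.
  have h3 : 0 < b' - b by lra.
  pose th := (b' - alpha) / (b' - b).
  have th01 : 0 <= th <= 1.
    by rewrite /th divr_ge0 ?(ltW h2) ?(ltW h3)//= ler_pdivrMr// mul1r; lra.
  have th1 : 1 - th = (alpha - b) / (b' - b) by rewrite /th; field; rewrite gt_eqF.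
  have := Gconv _ _ _ _ _ th01 Gb Gb'; rewrite th1 /th.
  have -> : (b' - alpha) / (b' - b) * b + (alpha - b) / (b' - b) * b' = alpha.
    by field; rewrite gt_eqF.
  move/Glt; have -> : (b' - alpha) / (b' - b) * t + (alpha - b) / (b' - b) * t' =
      ((b' - alpha) * t + (alpha - b) * t') / (b' - b) by field; rewrite gt_eqF.
  rewrite ltr_pdivrMr// => h; rewrite ler_pdivrMr// mulrAC ler_pdivlMr//; lra.
pose S := [set (p.2 - s) / (alpha - p.1) | p in [set p : R * R | p.1 < alpha /\ G p.1 p.2]].
have S0 : S !=set0 by exists ((0 - s) / (alpha - b1)); exists (b1, 0).
have Sub b' t' : alpha < b' -> G b' t' -> ubound S ((s - t') / (b' - alpha)).
  by move=> ab Gb' _ [[b t] /= [ba Gb] <-]; exact: slope.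
have hS : has_sup S by split => //; exists ((s - 0) / (b2 - alpha)); exact: Sub.
(* For [q = sup S] the points of [G] satisfy [t + q * b <= s + q * alpha], whereas the point
   supplied for this [q] has [t + q * b = P q], which is larger. *)
have [b Gb] := GP (sup S); have := sP (sup S); set p := P _ => sp.
have [ba|ab|ba] := ltgtP b alpha.
- have : (p - sup S * b - s) / (alpha - b) <= sup S.
    by apply: (sup_ubound (proj2 hS)); exists (b, p - sup S * b).
  by rewrite ler_pdivrMr ?subr_gt0//; lra.
- have : sup S <= (s - (p - sup S * b)) / (b - alpha).
    by apply: (ge_sup S0); exact: Sub.
  by rewrite ler_pdivlMr ?subr_gt0//; lra.
- by rewrite ba -/p in Gb; have := Glt _ Gb; lra.
Qed.

Lemma sum_le_size (R : numDomainType) (T : eqType) (s : seq T) (f : T -> R) (c : R) :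
  {in s, forall x, f x <= c} -> \sum_(x <- s) f x <= (size s)%:R * c.
Proof.
move=> h; rewrite mulr_natl big_seq; apply: le_trans (ler_sum _ h) _.
rewrite -big_seq; elim: s {h} => [|x s IH]; first by rewrite big_nil.
by rewrite big_cons mulrS lerD2l.
Qed.

Lemma slope_transfer (R : realFieldType) (u v N b b' e : R) : - u <= v - b' * N <= u ->
  - (e / 2 * N) <= (b - b') * N <= e / 2 * N -> u <= e / 2 * N -> - (e * N) <= v - b * N <= e * N.
Proof. by move=> /andP[h1 h2] /andP[h3 h4] h5; apply/andP; split; lra. Qed.

(** * The convex set of rich pairs *)

Section rich.
Context {R : realType} {X : sft R}.
Local Notation Sigma := (shift_space X).
Implicit Types (x y z : Sigma).
Variables (phi : nat -> Sigma -> R) (C0 C1 c0 : R) (D : nat).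
Hypothesis pot : potential phi C0 C1 c0 D.

Definition rich (b t : R) := forall e : R, 0 < e -> exists n M,
  [/\ (0 < n)%N, stage phi (b * n%:R) (e * n%:R) n M & expR ((t - e) * n%:R) <= M%:R].

Lemma rich_le b t t' : t' <= t -> rich b t -> rich b t'.
Proof.
move=> tt h e /h[n [M [n0 sM tM]]]; exists n, M; split => //.
by apply: le_trans tM; rewrite ler_expR ler_wpM2r// lerD2r.
Qed.

(** For long segments the losses in [stage_of_family], both in the potential and in the number of
    segments, fall below [e / 2] per unit of time. *)
Lemma rich_of_families b t : (forall e : R, 0 < e -> forall N0, exists N (F : seq Sigma),
    [/\ (N0 <= N)%N, uniq (map (word N) F), forall y, y \in F -> `|phi N y - b * N%:R| <= e * N%:R &
        expR ((t - e) * N%:R) <= (size F)%:R]) -> rich b t.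
Proof.
move=> h e e0; have e2 : 0 < e / 2 by rewrite divr_gt0.
have C00 := pot_C0_ge0 pot; have C10 := pot_C1_ge0 pot; have c00 := pot_c_ge0 pot.
pose c1 := 2 * C0 + C1 * D%:R + c0.
have [N1 hN1] := exists_nat_ge ((c1 + `|b| * D%:R) / (e / 2)).
have [N2 hN2] := exists_nat_ge ((`|t| * D%:R + ln D.+1%:R) / (e / 2)).
have [N [F [+ uF hF sF]]] := h _ e2 (maxn 1 (maxn N1 N2)).
rewrite !geq_max => /and3P[N0 /hN1 h1 /hN2 h2].
rewrite ler_pdivrMr// in h1; rewrite ler_pdivrMr// in h2.
have F0 : F != [::].
  by apply/eqP => FE; have := lt_le_trans (expR_gt0 _) sF; rewrite FE ltxx.
exists (N + D)%N, ((size F).-1 %/ D.+1).+1; split; first by rewrite addn_gt0 N0.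
  apply: stage_le (leqnn _) (stage_of_family pot F0 uF hF).
  rewrite -/c1 !natrD -mulrBr opprD addNKr mulrN normrN normrM [`|D%:R|]ger0_norm//.
  have : 0 <= e * D%:R by rewrite mulr_ge0 ?(ltW e0).
  by lra.
have D0 : 0 < D.+1%:R :> R by [].
rewrite -(ler_pM2r D0) -natrM; apply: (@le_trans _ _ (size F)%:R); last first.
  rewrite ler_nat; have := ltn_ceil (size F).-1 (ltn0Sn D).
  by case: (F) F0.
apply: le_trans sF; rewrite -[X in _ * X <= _](lnK D0) -expRD ler_expR natrD.
have : t * D%:R <= `|t| * D%:R by rewrite ler_wpM2r// ler_norm.
have : 0 <= e * D%:R by rewrite mulr_ge0 ?(ltW e0).
by lra.
Qed.

Lemma rich_convex b b' t t' th : 0 <= th <= 1 -> rich b t -> rich b' t' ->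
  rich (th * b + (1 - th) * b') (th * t + (1 - th) * t').
Proof.
move=> /andP[th0 th1] r1 r2 e e0; have e2 : 0 < e / 2 by rewrite divr_gt0.
have [n1 [M1 [n10 s1 h1]]] := r1 _ e2; have [n2 [M2 [n20 s2 h2]]] := r2 _ e2.
have [k0 hk0] := exists_nat_ge ((`|b - b'| + `|t - t'|) / (e / 2)).
pose k := maxn 1 k0; have /hk0 := leq_maxr 1 k0; rewrite -/k ler_pdivrMr// => hk.
have k_gt0 : (0 < k)%N by rewrite leq_max.
(* Both stages are iterated to the common length [n1 * n2], and [k1] of the [k] blocks are of the
   first kind. Rounding misplaces less than one block, which is negligible for large [k]. *)
pose k1 := Num.truncn (th * k%:R).
have thk : 0 <= th * k%:R by rewrite mulr_ge0.
have /andP[k1l k1u] := truncn_itv thk; rewrite -/k1 in k1l k1u.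
have k1k : (k1 <= k)%N.
  by rewrite -(ler_nat R) (le_trans k1l)// ler_piMl.
pose k2 := (k - k1)%N; have kE : k%:R = k1%:R + k2%:R :> R by rewrite -natrD subnKC.
pose n := (n1 * n2)%N; have n0 : 0 < n%:R :> R by rewrite ltr0n muln_gt0 n10.
exists (k * n)%N, ((M1 ^ n2) ^ k1 * (M2 ^ n1) ^ k2)%N; split.
- by rewrite !muln_gt0 k_gt0 n10.
- have := stage_cat pot (stage_iter pot k1 (stage_iter pot n2 s1))
    (stage_iter pot k2 (stage_iter pot n1 s2)).
  have -> : (k1 * (n2 * n1) + k2 * (n1 * n2) = k * n)%N.
    by rewrite [(n2 * n1)%N]mulnC -mulnDl subnKC.
  apply: stage_le => //.
  have -> : k1%:R * (n2%:R * (b * n1%:R)) + k2%:R * (n1%:R * (b' * n2%:R)) -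
      (th * b + (1 - th) * b') * (k * n)%:R = (k1%:R - th * k%:R) * (b - b') * n%:R.
    by rewrite /n !natrM kE; ring.
  rewrite !normrM [`|n%:R|]gtr0_norm//.
  have : `|k1%:R - th * k%:R| * `|b - b'| <= `|b - b'|.
    by rewrite ler_piMl// ler_norml; apply/andP; split; rewrite -natr1 in k1u; lra.
  have : `|b - b'| <= e / 2 * k%:R by rewrite mulrC; apply: le_trans hk; rewrite lerDl.
  move=> hb hb'; rewrite [leRHS](_ : _ = e / 2 * k%:R * n%:R); last first.
    by rewrite /n !natrM kE; field.
  by rewrite ler_wpM2r ?(ltW n0)// (le_trans hb').
rewrite [in leRHS]natrM !natrX.
have g1 : expR ((t - e / 2) * n%:R) <= M1%:R ^+ n2.
  by rewrite /n natrM mulrA expRM_natr lerXn2r ?nnegrE ?expR_ge0.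
have g2 : expR ((t' - e / 2) * n%:R) <= M2%:R ^+ n1.
  by rewrite /n mulnC natrM mulrA expRM_natr lerXn2r ?nnegrE ?expR_ge0.
apply: (@le_trans _ _ (expR ((t - e / 2) * n%:R) ^+ k1 * expR ((t' - e / 2) * n%:R) ^+ k2)); last first.
  by apply: ler_pM; rewrite ?exprn_ge0 ?expR_ge0//; apply: lerXn2r; rewrite ?nnegrE ?expR_ge0 ?exprn_ge0.
rewrite -!expRM_natr -expRD ler_expR natrM.
have -> : (t - e / 2) * n%:R * k1%:R + (t' - e / 2) * n%:R * k2%:R =
    ((th * t + (1 - th) * t' - e / 2) * k%:R + (k1%:R - th * k%:R) * (t - t')) * n%:R.
  by rewrite kE; ring.
rewrite mulrA ler_wpM2r ?(ltW n0)//.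
have : - `|t - t'| <= (k1%:R - th * k%:R) * (t - t').
  rewrite lerNl -mulNr (le_trans (ler_norm _))// normrM ler_piMl//.
  by rewrite ler_norml; apply/andP; split; rewrite -natr1 in k1u; lra.
have : 0 <= `|b - b'| by [].
by move: hk; lra.
Qed.

(** The averages [b] of the families may vary with [j]. A cluster value exists by compactness of the
    interval, and families whose average is close to it serve for it as well. *)
Lemma rich_cluster (lo hi P q K : R) : (forall j : nat, exists N b (F : seq Sigma),
    [/\ (j <= N)%N, lo <= b <= hi, uniq (map (word N) F),
        forall y, y \in F -> `|phi N y - b * N%:R| <= N%:R / j.+1%:R &
        expR ((P - q * b - K / j.+1%:R) * N%:R) <= (size F)%:R]) ->
  exists2 b, lo <= b <= hi & rich b (P - q * b).
Proof.
move=> h; have ch j : exists Nb : nat * R, exists F : seq Sigma,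
    [/\ (j <= Nb.1)%N, lo <= Nb.2 <= hi, uniq (map (word Nb.1) F),
        forall y, y \in F -> `|phi Nb.1 y - Nb.2 * Nb.1%:R| <= Nb.1%:R / j.+1%:R &
        expR ((P - q * Nb.2 - K / j.+1%:R) * Nb.1%:R) <= (size F)%:R].
  by have [N [b [F hF]]] := h j; exists (N, b), F.
pose Nb j := sval (cid (ch j)); have hNb j := svalP (cid (ch j)).
have [b [bI clb]] : `[lo, hi]%classic `&` cluster ((fun j => (Nb j).2) @ \oo) !=set0.
  apply: (@segment_compact R lo hi _ _); exists 0%N => // j _ /=.
  by have [F [_ + _ _ _]] := hNb j; rewrite in_itv.
exists b; first by move: bI; rewrite /= in_itv.
apply: rich_of_families => e e0 N0; have e2 : 0 < e / 2 by rewrite divr_gt0.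
have q1 : 0 < `|q| + 1 by rewrite ltr_wpDl.
have de0 : 0 < e / 2 / (`|q| + 1) by rewrite divr_gt0.
have [J hJ] := exists_nat_ge ((1 + `|K|) / (e / 2)).
have [_ [[j /= jJ <-] bj]] : [set (Nb j).2 | j in [set j | (maxn N0 J <= j)%N]] `&`
    ball b (e / 2 / (`|q| + 1)) !=set0.
  apply: clb; last exact: nbhsx_ballx.
  by exists (maxn N0 J) => // j /= hj; exists j.
move: jJ; rewrite geq_max => /andP[N0j /hJ Jj].
have [F [jN bjI uF hF sF]] := hNb j; rewrite -/(Nb j) in jN bjI uF hF sF.
have j0 : 0 < j.+1%:R :> R by [].
have jl : 1 + `|K| <= j.+1%:R * (e / 2).
  by rewrite -ler_pdivrMr//; apply: le_trans Jj _; rewrite ler_nat.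
have j1 : j.+1%:R^-1 <= e / 2.
  by rewrite -[leLHS]mul1r ler_pdivrMr// mulrC; apply: le_trans jl; rewrite lerDl.
have jK : K / j.+1%:R <= e / 2.
  rewrite ler_pdivrMr// mulrC; apply: le_trans jl.
  by apply: le_trans (ler_norm K) _; rewrite lerDr.
have bj' : `|b - (Nb j).2| <= e / 2 / (`|q| + 1) by apply: ltW; rewrite -ball_normE in bj.
have bje : `|b - (Nb j).2| <= e / 2.
  by apply: le_trans bj' _; rewrite ler_pdivrMr// ler_peMr ?(ltW e2)// lerDr.
have qbj : `|q * (b - (Nb j).2)| <= e / 2.
  rewrite normrM; apply: le_trans (ler_wpM2l (normr_ge0 q) bj') _.
  by rewrite mulrCA ler_piMr ?(ltW e2)// ler_pdivrMr// mul1r lerDl.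
exists (Nb j).1, F; split => //; first exact: leq_trans jN.
- move=> y /hF hy.
  have : (Nb j).1%:R / j.+1%:R <= e / 2 * (Nb j).1%:R by rewrite mulrC ler_wpM2r.
  have : `|(b - (Nb j).2) * (Nb j).1%:R| <= e / 2 * (Nb j).1%:R.
    by rewrite normrM [`|_%:R|]ger0_norm// ler_wpM2r.
  by move: hy; rewrite !ler_norml; exact: slope_transfer.
- apply: le_trans sF; rewrite ler_expR ler_wpM2r//.
  move: qbj jK; rewrite ler_norml mulrBr => /andP[h1 h2]; move: (K / _) => u uK.
  by move: h1 uK; clear; lra.
Qed.

(** Words of length [n] are sorted by the value of [phi n / n] into bins of width [de]. The number
    of bins does not depend on [n], so one bin carries a fixed proportion of the partition sum. On
    it the weight is nearly constant, so it has about [expR ((P - q * b) * n)] words. *)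
Lemma rich_pressure q : exists b, rich b (topological_pressure phi q - q * b).
Proof.
set P := topological_pressure phi q; have C10 := pot_C1_ge0 pot.
have [b _ hb] : exists2 b, - C1 <= b <= C1 + 1 & rich b (P - q * b); last by exists b.
(* The multiple of [de] lost in the exponent: [|q|] for the width of a bin, 1 for the approximation
   of the pressure and 1 for the number of bins. *)
apply: (@rich_cluster _ _ P q (`|q| + 2)) => j.
pose de : R := j.+1%:R^-1; have de0 : 0 < de by rewrite invr_gt0.
pose B := (Num.truncn (2 * C1 / de)).+1; have B0 : 0 < B%:R :> R by [].
have [N1 hN1] := exists_nat_ge (ln B%:R / de).
have Pde : P - de < P by rewrite ltrBlDr ltrDl.
have [n + hn] := pressure_gt pot Pde (maxn 1 (maxn j N1)).
rewrite !geq_max => /and3P[n0 jn /hN1 nN1].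
have n0' : 0 < n%:R :> R by rewrite ltr0n.
pose v (w : n.-tuple 'I_(sft_card X)) := (phi n (rep w) / n%:R + C1) / de.
have v0 w : 0 <= v w.
  apply: divr_ge0; last exact: ltW.
  rewrite -lerBlDr sub0r ler_pdivlMr// mulNr.
  by have := pot_le pot n (rep w); rewrite ler_norml => /andP[].
have vB w : (Num.truncn (v w) < B)%N.
  rewrite ltnS; apply: le_truncn; rewrite ler_pM2r ?invr_gt0//.
  rewrite mulrDl mul1r lerD2r ler_pdivrMr//.
  by have := pot_le pot n (rep w); rewrite ler_norml => /andP[].
pose bin (i : 'I_B) := [seq rep w | w <- enum (@lang R X n) & Num.truncn (v w) == i].
have [i hi] : exists i : 'I_B, partition_sum phi q n / B%:R <= \sum_(x <- bin i) expR (q * phi n x).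
  apply: contrapT => /forallNP h.
  have : \sum_(i < B) \sum_(x <- bin i) expR (q * phi n x) < \sum_(i < B) partition_sum phi q n / B%:R.
    apply: ltr_sum => [|i _]; first by apply/hasP; exists ord0; rewrite ?mem_index_enum.
    by rewrite ltNge; apply/negP; exact: h.
  rewrite sumr_const card_ord -[ltRHS]mulr_natr mulfVK ?gt_eqF// /partition_sum.
  rewrite [ltRHS](partition_big (fun w => Ordinal (vB w)) xpredT)//=.
  rewrite (eq_bigr (fun i : 'I_B => \sum_(w in lang n | Ordinal (vB w) == i) expR (q * phi n (rep w)))).
    by rewrite ltxx.
  move=> i _; rewrite big_map big_filter big_enum_cond /=; apply: eq_bigl => w.
  by rewrite -(inj_eq val_inj).
have binP y : y \in bin i -> exists2 w, w \in lang n & y = rep w /\ Num.truncn (v w) = i.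
  by move=> /mapP[w]; rewrite mem_filter mem_enum => /andP[/eqP vi wl] ->; exists w.
pose b := - C1 + i%:R * de.
have binb y : y \in bin i -> b * n%:R <= phi n y <= (b + de) * n%:R.
  move=> /binP[w wl [-> vi]]; have := truncn_itv (v0 w); rewrite vi => /andP[h1 h2].
  move: h1; rewrite ler_pdivlMr// -lerBlDr ler_pdivlMr// => h1.
  move: h2; rewrite ltr_pdivrMr// -ltrBrDr ltr_pdivrMr// => h2.
  apply/andP; split; first by move: h1; rewrite /b addrC.
  by apply: ltW; apply: lt_le_trans h2 _; rewrite ler_wpM2r// /b -natr1; lra.
exists n, b, (bin i); split => //.
- rewrite /b lerDl mulr_ge0 ?(ltW de0)//= addrC.
  have : i%:R * de <= 2 * C1.
    have : i%:R <= 2 * C1 / de.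
      have h : 0 <= 2 * C1 / de by rewrite divr_ge0 ?(ltW de0)// mulr_ge0.
      have /andP[+ _] := truncn_itv h; apply: le_trans.
      by rewrite ler_nat -ltnS.
    by rewrite ler_pdivlMr.
  lra.
- rewrite -map_comp map_inj_in_uniq; first by rewrite filter_uniq// enum_uniq.
  move=> w w'.
  rewrite mem_filter mem_enum => /andP[_ wl]; rewrite mem_filter mem_enum => /andP[_ wl'] /=.
  by rewrite !word_rep.
- move=> y /binb/andP[h1 h2]; rewrite -/de ler_norml; apply/andP; split.
    by apply: (@le_trans _ _ 0); rewrite ?subr_ge0// oppr_le0 mulr_ge0// ltW.
  by rewrite lerBlDl -[X in _ + X]mulrC -mulrDl.
have hs : \sum_(x <- bin i) expR (q * phi n x) <= (size (bin i))%:R * expR ((q * b + `|q| * de) * n%:R).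
  apply: sum_le_size => x /binb/andP[h1 h2]; rewrite ler_expR.
  have : `|q * (phi n x - b * n%:R)| <= `|q| * (de * n%:R).
    by rewrite normrM ler_wpM2l// ger0_norm ?subr_ge0// lerBlDl -mulrDl.
  by rewrite ler_norml mulrBr => /andP[_]; lra.
have := le_trans hi hs; rewrite -ler_pdivrMr ?expR_gt0//; apply: le_trans.
rewrite -expRN -[partition_sum _ _ _](lnK) ?posrE ?(partition_sum_gt0 pot)//.
rewrite -[X in _ / X * _](lnK) ?posrE// -expRN -!expRD ler_expR.
move: nN1; rewrite ler_pdivrMr// => nN1; rewrite -/de.
by move: hn nN1; rewrite -/P; lra.
Qed.

(** A single orbit segment is a family of entropy 0. A mean of [phi n] beyond a bound forces some
    segment to reach that bound, on either side. *)
Lemma mean_phi_rich M m (im : @invariant_mean R X M m) (be : R) :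
  (fun n : nat => n%:R^-1 * mean_phi m phi n) @ \oo --> be ->
  (forall lo, lo < be -> exists2 b, lo <= b & rich b 0) /\
  (forall hi, be < hi -> exists2 b, b <= hi & rich b 0).
Proof.
move=> cbe; have single lo hi : (forall j : nat, exists N y, [/\ (0 < N)%N, (j <= N)%N &
    lo * N%:R <= phi N y <= hi * N%:R]) -> exists2 b, lo <= b <= hi & rich b 0.
  move=> h; have [b bI rb] : exists2 b, lo <= b <= hi & rich b (0 - 0 * b).
    apply: (@rich_cluster _ _ 0 0 0) => j; have [N [y [N0 jN /andP[h1 h2]]]] := h j.
    have N0' : 0 < N%:R :> R by rewrite ltr0n.
    exists N, (phi N y / N%:R), [:: y]; split => //.
    - by rewrite ler_pdivlMr// h1 ler_pdivrMr// h2.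
    - by move=> z; rewrite inE => /eqP ->; rewrite mulfVK ?gt_eqF// subrr normr0 divr_ge0.
    - by rewrite !mul0r !subr0 mul0r expR0.
  by exists b => //; rewrite mul0r subr0 in rb.
have C10 := pot_C1_ge0 pot.
have ex n (g : R) : mean_phi m phi n < g * n%:R -> exists y, phi n y <= g * n%:R.
  move=> h; apply: contrapT => /forallNP h'; move: h; apply/negP; rewrite -leNgt.
  rewrite -(expect_cst im (g * n%:R) (@label_word _ _ _ _ im n)); apply: (expect_le im) => x.
  by apply: ltW; rewrite ltNge; apply/negP; exact: h'.
have ex' n (g : R) : g * n%:R < mean_phi m phi n -> exists y, g * n%:R <= phi n y.
  move=> h; apply: contrapT => /forallNP h'; move: h; apply/negP; rewrite -leNgt.
  rewrite -[leRHS](expect_cst im (g * n%:R) (@label_word _ _ _ _ im n)); apply: (expect_le im) => x.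
  by apply: ltW; rewrite ltNge; apply/negP; exact: h'.
split=> g gb.
- have [b /andP[h _] rb] : exists2 b, g <= b <= C1 & rich b 0; last by exists b.
  apply: single => j; have /cvgrPdist_lt /(_ (be - g)) := cbe; rewrite subr_gt0 => /(_ gb)[n1 _ hn].
  pose n := maxn 1 (maxn j n1); have n0 : (0 < n)%N by rewrite leq_max.
  have n0' : 0 < n%:R :> R by rewrite ltr0n.
  have [|y hy] := @ex' n g.
    have := hn n; rewrite /= !leq_max leqnn !orbT => /(_ isT); rewrite ltr_norml => /andP[_ h].
    by rewrite -ltr_pdivlMr// mulrC; move: h; lra.
  exists n, y; split => //; first by rewrite !leq_max leqnn orbT.
  by rewrite hy; have := pot_le pot n y; rewrite ler_norml => /andP[].
- have [b /andP[_ h] rb] : exists2 b, - C1 <= b <= g & rich b 0; last by exists b.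
  apply: single => j; have /cvgrPdist_lt /(_ (g - be)) := cbe; rewrite subr_gt0 => /(_ gb)[n1 _ hn].
  pose n := maxn 1 (maxn j n1); have n0 : (0 < n)%N by rewrite leq_max.
  have n0' : 0 < n%:R :> R by rewrite ltr0n.
  have [|y hy] := @ex n g.
    have := hn n; rewrite /= !leq_max leqnn !orbT => /(_ isT); rewrite ltr_norml => /andP[h _].
    by rewrite -ltr_pdivrMr// mulrC; move: h; lra.
  exists n, y; split => //; first by rewrite !leq_max leqnn orbT.
  by rewrite hy andbT mulNr; have := pot_le pot n y; rewrite ler_norml => /andP[].
Qed.

Lemma rich_interior alpha s b1 b2 : b1 < alpha -> rich b1 0 -> alpha < b2 -> rich b2 0 ->
  (forall q, s < topological_pressure phi q - alpha * q) -> rich alpha s.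
Proof.
move=> h1 r1 h2 r2; apply: (convex_separation (b1 := b1) (b2 := b2)) => //.
- by move=> b t t'; exact: rich_le.
- by move=> b b' t t' th; exact: rich_convex.
- exact: rich_pressure.
Qed.

End rich.

(** * Lower bound for the entropy of the level sets *)

Section moran_numbers.
Context {R : realType}.

Lemma eventually_sum_le (a b : nat -> R) k0 : (forall k, (k0 <= k)%N -> a k <= b k) ->
  exists2 A, 0 <= A & forall i, \sum_(k < i) a k <= \sum_(k < i) b k + A.
Proof.
move=> ab; pose S n := \sum_(k < n) `|a k - b k|.
have SS n : S n.+1 = S n + `|a n - b n| by rewrite /S big_ord_recr.
have Sle n n' : (n <= n')%N -> S n <= S n'.
  move=> nn; rewrite -(subnKC nn); elim: (n' - n)%N => [|k IH]; first by rewrite addn0.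
  by rewrite addnS SS; apply: le_trans IH _; rewrite lerDl.
exists (S k0); first exact: sumr_ge0.
suff h i : \sum_(k < i) a k <= \sum_(k < i) b k + S (minn i k0).
  by move=> i; apply: le_trans (h i) _; rewrite lerD2l Sle// geq_minr.
elim: i => [|i IH]; first by rewrite !big_ord0 add0r; exact: sumr_ge0.
rewrite !big_ord_recr /=; have [ik|ki] := ltnP i k0.
  rewrite (minn_idPl ik) SS; move: IH; rewrite (minn_idPl (ltnW ik)).
  by have := ler_norm (a i - b i); lra.
by rewrite (minn_idPr (leqW ki)); move: IH (ab i ki); rewrite (minn_idPr ki); lra.
Qed.

(** [g i] is the largest [j] with [h j <= i], where [h] grows fast enough that [n (g i)] is
    negligible against [i]. In the tree it decides when a new stage is taken up. *)
Lemma slow_growth (n : nat -> nat) : exists g : nat -> nat, forall J, exists i0, forall i,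
  (i0 <= i)%N -> (J <= g i)%N /\ (J * n (g i) <= i)%N.
Proof.
pose h j := (\sum_(k < j.+1) k.+1 * (n k).+1)%N.
have hj j : (j <= h j)%N.
  rewrite /h big_ord_recr /=; apply: leq_trans (leq_addl _ _).
  by rewrite mulnS; lia.
have hn j : (j.+1 * n j <= h j)%N.
  rewrite /h big_ord_recr /=; apply: leq_trans (leq_addl _ _).
  by rewrite leq_mul.
pose good i g := (h g <= i)%N /\ forall j, (h j <= i)%N -> (j <= g)%N.
have ex i : (h 0 <= i)%N -> exists g, good i g.
  move=> hi; have ex1 : exists j, (h j <= i)%N by exists 0%N.
  have ub j : (h j <= i)%N -> (j <= i)%N by exact: leq_trans.
  by case: (ex_maxnP ex1 ub) => g h1 h2; exists g.
exists (fun i => xget 0%N (good i)).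
move=> J; exists (maxn (h 0) (h J)) => i; rewrite geq_max => /andP[/ex h0 hJ].
have [h1 /(_ _ hJ) Jg] := xgetPex 0%N h0; split => //.
by apply: leq_trans h1; apply: leq_trans (hn _); rewrite leq_mul// leqW.
Qed.

Lemma sum_uniq_indicator (T : eqType) (s : seq T) w (a : R) : uniq s -> 0 <= a ->
  \sum_(y <- s) (if y == w then a else 0) <= a.
Proof.
move=> us a0; rewrite -big_mkcond big_const_seq.
have : (count (fun y => y == w) s <= 1)%N by rewrite (count_uniq_mem w us) leq_b1.
by case: (count _ _) => [|[|]] //= _; rewrite ?addr0.
Qed.

End moran_numbers.

(** * A tree of concatenations and its covers *)

Section moran.
Context {R : realType} {X : sft R}.
Local Notation Sigma := (shift_space X).
Implicit Types (x y z : Sigma).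
Variables (phi : nat -> Sigma -> R) (C0 C1 c0 : R) (D : nat).
Hypothesis pot : potential phi C0 C1 c0 D.

Section limit_point.
Variables (alpha : R) (N : nat -> nat) (ep : nat -> R).
Hypothesis N0 : forall i, (0 < N i)%N.
Let L i := (\sum_(k < i) N k)%N.

Let LS i : L i.+1 = (L i + N i)%N. Proof. by rewrite /L big_ord_recr. Qed.

Lemma level_ge i : (i <= L i)%N.
Proof. by elim: i => // i IH; rewrite LS -addn1 leq_add. Qed.

Lemma level_le i j : (i <= j)%N -> (L i <= L j)%N.
Proof.
by move=> ij; rewrite -(subnKC ij); elim: (j - i)%N => [|k IH]; rewrite ?addn0// addnS LS; apply: leq_trans IH (leq_addr _ _).
Qed.

Hypothesis epN : forall e : R, 0 < e -> exists i0, forall i, (i0 <= i)%N -> ep i <= e.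
Hypothesis N_slow : forall J, exists i0, forall i, (i0 <= i)%N -> (J * N i <= i)%N.

Variable u : nat -> Sigma.
Hypothesis u_agree : forall i (t : int), t < (L i)%:Z -> coord (u i.+1) t = coord (u i) t.
Hypothesis u_phi : forall i,
  `|phi (L i.+1) (u i.+1) - phi (L i) (u i) - alpha * (N i)%:R| <= ep i * (N i)%:R.

(** At the times [L i] the errors [ep k * N k] have a small average. At other times the incomplete
    block has length at most [N i], which is negligible against [i] and hence against [L i]. *)
Lemma moran_limit : exists x, (forall i (t : int), t < (L i)%:Z -> coord x t = coord (u i) t) /\
  phi_level phi alpha x.
Proof.
have uE i j (t : int) : (i <= j)%N -> t < (L i)%:Z -> coord (u j) t = coord (u i) t.
  move=> ij ti; rewrite -(subnKC ij); elim: (j - i)%N => [|k IH]; first by rewrite addn0.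
  rewrite addnS u_agree//; apply: lt_le_trans ti _; rewrite lez_nat.
  by apply: level_le; exact: leq_addr.
have tL (t : int) : t < (L `|t|.+1)%:Z by have := level_ge `|t|.+1; lia.
pose f (t : int) := coord (u `|t|.+1) t.
have fE i (t : int) : t < (L i)%:Z -> f t = coord (u i) t.
  move=> ti; rewrite /f; case: (leqP i `|t|.+1) => h; first exact: uE.
  by rewrite -(uE _ i)// ltnW.
have adm : admissible f.
  move=> t; have h1 := tL t; have h2 := tL (t + 1).
  pose i := maxn `|t|.+1 `|(t + 1)%R|%N.+1.
  rewrite (fE i t); last first.
    by apply: lt_le_trans h1 _; rewrite lez_nat; apply: level_le; exact: leq_maxl.
  rewrite (fE i (t + 1)); last first.
    by apply: lt_le_trans h2 _; rewrite lez_nat; apply: level_le; exact: leq_maxr.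
  exact: (svalP (u i)).
pose x : Sigma := exist _ f adm; exists x.
have xE i (t : int) : t < (L i)%:Z -> coord x t = coord (u i) t by exact: fE.
split => //; have C00 := pot_C0_ge0 pot; have C10 := pot_C1_ge0 pot.
have phiL i : `|phi (L i) x - alpha * (L i)%:R| <= C0 + \sum_(k < i) ep k * (N k)%:R.
  have h1 : `|phi (L i) x - phi (L i) (u i)| <= C0.
    by apply: (pot_dist pot); apply/eq_wordP => t ti; apply: xE; rewrite ltz_nat.
  rewrite -(subrKA (phi (L i) (u i))); apply: le_trans (ler_normD _ _) (lerD h1 _).
  elim: i {h1} => [|i IH].
    have := pot_le pot 0 (u 0%N); rewrite /L !big_ord0 !mulr0 normr_le0 => /eqP ->.
    by rewrite subrr normr0.
  rewrite big_ord_recr /= LS natrD mulrDr.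
  have := u_phi i; rewrite LS; move: IH.
  rewrite !ler_norml => /andP[h1 h2] /andP[h3 h4]; apply/andP; split; lra.
apply/cvgrPdist_le => e e0; have e3 : 0 < e / 3 by rewrite divr_gt0.
have [k0 hk0] := epN e3.
have [A A0 hA] := @eventually_sum_le R (fun k => ep k * (N k)%:R) (fun k => e / 3 * (N k)%:R) k0
  (fun k kk => ler_wpM2r (ler0n _ _) (hk0 k kk)).
have [J hJ] := exists_nat_ge ((C1 + `|alpha|) / (e / 3)); have {}hJ := hJ J (leqnn J).
have [i0 hi0] := N_slow J.
have [n1 hn1] := exists_nat_ge ((C0 + A) / (e / 3)).
exists (maxn 1 (maxn n1 (L i0))) => // n /=; rewrite !geq_max => /and3P[n0 /hn1 nA nL].
have n0' : 0 < n%:R :> R by rewrite ltr0n.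
have [i [iL iL' ii0]] : exists i, [/\ (L i <= n)%N, (n < L i.+1)%N & (i0 <= i)%N].
  have ub i : (L i <= n)%N -> (i <= n)%N by apply: leq_trans; exact: level_ge.
  case: (ex_maxnP (ex_intro _ i0 nL) ub) => i h1 h2; exists i; split => //; last exact: h2.
  by rewrite ltnNge; apply/negP => /h2; rewrite ltnn.
have nE : n%:R = (L i)%:R + (n - L i)%:R :> R by rewrite -natrD subnKC.
have dN : (n - L i)%:R <= (N i)%:R :> R by rewrite ler_nat; rewrite LS in iL'; lia.
have d0 : 0 <= (n - L i)%:R :> R by [].
have := phiL i; have := hA i; rewrite -mulr_sumr -natr_sum -/(L i) => hS hphi.
have h1 := pot_extend pot (L i) (n - L i) x.
have h2 := pot_subadd pot (L i) (n - L i) x.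
have h3 := pot_le pot (n - L i) (shift (L i)%:Z x).
rewrite (subnKC iL) in h1 h2.
have hN : (C1 + `|alpha|) * (n - L i)%:R <= e / 3 * n%:R.
  apply: (@le_trans _ _ ((C1 + `|alpha|) * (N i)%:R)); first by rewrite ler_wpM2l// addr_ge0.
  move: hJ; rewrite ler_pdivrMr// => hJ.
  apply: (@le_trans _ _ (J%:R * (e / 3) * (N i)%:R)); first by rewrite ler_wpM2r.
  rewrite mulrAC [leRHS]mulrC ler_wpM2r ?(ltW e3)// -natrM ler_nat.
  by apply: leq_trans (hi0 i ii0) _; apply: leq_trans (level_ge i) iL.
have ha : `|alpha * (n - L i)%:R| <= `|alpha| * (n - L i)%:R by rewrite normrM (ger0_norm d0).
have hL : e / 3 * (L i)%:R <= e / 3 * n%:R by rewrite ler_wpM2l ?(ltW e3)// ler_nat.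
move: nA; rewrite ler_pdivrMr// => nA.
have key : `|phi n x - alpha * n%:R| <= e * n%:R.
  move: h3 ha hphi; rewrite !ler_norml => /andP[h3 h4] /andP[ha1 ha2] /andP[hp1 hp2].
  have aE : alpha * n%:R = alpha * (L i)%:R + alpha * (n - L i)%:R by rewrite nE mulrDr.
  rewrite aE mulrDl in hN *; move: (alpha * (n - L i)%:R) (alpha * (L i)%:R) ha1 ha2 hp1 hp2.
  move: (C1 * (n - L i)%:R) (`|alpha| * (n - L i)%:R) hN h1 h2 h3 h4.
  move: hL nA hS; move: n%:R (L i)%:R (\sum_(_ < i) _).
  move=> nn LL S hL nA hS c1d ad hN h1 h2 h3 h4 a1 a2 ha1 ha2 hp1 hp2.
  by apply/andP; split; lra.
rewrite -(ler_pM2r n0') -[X in _ * X <= _](gtr0_norm n0') -normrM mulrBl mulrAC mulVf ?gt_eqF// mul1r.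
by rewrite distrC.
Qed.

End limit_point.

Section tree.
Variables (alpha s s' : R) (N M : nat -> nat) (ep : nat -> R).
Hypothesis N0 : forall i, (0 < N i)%N.
Hypothesis stN : forall i, stage phi (alpha * (N i)%:R) (ep i * (N i)%:R) (N i) (M i).
Hypothesis M_ge : forall i, expR ((s - ep i) * (N i)%:R) <= (M i)%:R.
Hypothesis epN : forall e : R, 0 < e -> exists i0, forall i, (i0 <= i)%N -> ep i <= e.
Hypothesis N_slow : forall J, exists i0, forall i, (i0 <= i)%N -> (J * N i <= i)%N.
Hypothesis s's : s' < s.
Let L i := (\sum_(k < i) N k)%N.

Let LS i : L i.+1 = (L i + N i)%N. Proof. by rewrite /L big_ord_recr. Qed.

Let M_gt0 i : 0 < (M i)%:R :> R. Proof. exact: lt_le_trans (expR_gt0 _) (M_ge i). Qed.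

Let ex_level n : exists j, (n <= L j)%N. Proof. by exists n; exact: (@level_ge N N0). Qed.

(* The generation at which the ball [c] is resolved by the tree. *)
Let gen (c : nat * Sigma) := ex_minn (ex_level c.1).

Let weight i (c : nat * Sigma) : R := \prod_(i <= k < (gen c).-1) (M k)%:R^-1.

Let compat i u (c : nat * Sigma) := word (minn c.1 (L i)) u == word (minn c.1 (L i)) c.2.

(* An upper bound for the proportion of the descendants of the node [u], of generation [i],
   that [c] covers. *)
Let cost i u c : R := if compat i u c then weight i c else 0.

(** The weight counts only the blocks that end before [c.1], while [c.1] may extend to the end of
    one more. Half of [s - s'] absorbs the errors [ep]; the other half pays for that block, whose
    length is negligible by [N_slow]. Finitely many exceptions go into [K]. *)
Lemma weight_bound : exists2 K : R, 0 < K & forall c, weight 0 c <= K * expR (- s' * c.1%:R).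
Proof.
have [s'0|s'0] := ltP s' 0.
  exists 1 => // c; rewrite mul1r; apply: (@le_trans _ _ 1).
    apply: Num.Theory.prodr_ile1 => k _; rewrite invr_ge0 ler0n invf_le1//= ler1n -(ltr0n R) //.
  by rewrite -expR0 ler_expR mulNr oppr_ge0 mulr_le0_ge0// ltW.
pose eta := (s - s') / 2; have eta0 : 0 < eta by rewrite divr_gt0// subr_gt0.
have [k0 hk0] := epN eta0.
have [A A0 hA] : exists2 A, 0 <= A & forall i,
    \sum_(k < i) (s' + eta) * (N k)%:R <= \sum_(k < i) (s - ep k) * (N k)%:R + A.
  apply: (@eventually_sum_le R (fun k => (s' + eta) * (N k)%:R) (fun k => (s - ep k) * (N k)%:R) k0).
  move=> k /hk0 kk; rewrite ler_wpM2r//.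
  by move: kk; rewrite /eta; lra.
have [J hJ] := exists_nat_ge (s' / eta); have {}hJ := hJ J (leqnn J).
rewrite ler_pdivrMr// in hJ.
have [i1 hi1] := N_slow J; pose A' := s' * (L i1)%:R.
have A'0 : 0 <= A' by rewrite mulr_ge0.
have sN i : s' * (N i)%:R <= eta * (L i)%:R + A'.
  have [ii1|i1i] := ltnP i i1.
    apply: (@le_trans _ _ A'); last by rewrite lerDr mulr_ge0// ltW.
    rewrite ler_wpM2l// ler_nat; apply: (@leq_trans (L i.+1)); first by rewrite LS leq_addl.
    exact: (@level_le N).
  apply: (@le_trans _ _ (eta * (L i)%:R)); last by rewrite lerDl.
  apply: (@le_trans _ _ (J%:R * eta * (N i)%:R)); first by rewrite ler_wpM2r.
  rewrite mulrAC mulrC ler_wpM2l ?(ltW eta0)// -natrM ler_nat.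
  by apply: leq_trans (hi1 i i1i) _; exact: (@level_ge N N0).
have key i : s' * (L i.+1)%:R <= \sum_(k < i) (s - ep k) * (N k)%:R + (A + A').
  have := hA i; have := sN i; rewrite -mulr_sumr -natr_sum -/(L i) LS natrD; lra.
exists (expR (A + A')); first exact: expR_gt0.
move=> c; have cL : (c.1 <= L (gen c))%N by rewrite /gen; case: ex_minnP.
apply: (@le_trans _ _ (expR (A + A') * expR (- s' * (L (gen c))%:R))); last first.
  by rewrite ler_wpM2l ?expR_ge0// ler_expR !mulNr lerN2 ler_wpM2l// ler_nat.
rewrite -expRD /weight; case: (gen c) => [|i] /=.
  by rewrite big_geq// /L big_ord0 mulr0 addr0 -expR0 ler_expR addr_ge0.
rewrite big_mkord; apply: (@le_trans _ _ (\prod_(k < i) expR (- ((s - ep k) * (N k)%:R)))).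
  by apply: ler_prod => k _; rewrite invr_ge0 ler0n /= expRN lef_pV2 ?posrE ?expR_gt0.
by rewrite -expR_sum ler_expR sumrN; have := key i; lra.
Qed.

Section cover.
Variables (e : R) (C : set (nat * Sigma)).

(** The bound one half is below 1, the cost of a ball at a compatible node where it is resolved.
    Finite lists stand for the sum over [C]. *)
Let cost_le i u := forall l : seq (nat * Sigma), uniq l -> (forall c, c \in l -> C c) ->
  \sum_(c <- l) cost i u c <= 2^-1.

Let weight_ge0 i c : 0 <= weight i c.
Proof. by apply: prodr_ge0 => k _; rewrite invr_ge0. Qed.

Let cost_ge0 i u c : 0 <= cost i u c.
Proof. by rewrite /cost; case: ifP. Qed.

(** While [c] reaches the end of the next block, at most one child is compatible with it, and the
    weight of that child is [M i] times larger. Afterwards all weights are 1, and only compatible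
    nodes have compatible children. *)
Let cost_step i u (ch : seq Sigma) c : size ch = M i -> uniq (map (word (L i.+1)) ch) ->
  (forall z, z \in ch -> forall t : int, t < (L i)%:Z -> coord z t = coord u t) ->
  \sum_(v <- ch) cost i.+1 v c <= (M i)%:R * cost i u c.
Proof.
move=> sch uch hch.
have up v : v \in ch -> compat i.+1 v c -> compat i u c.
  move=> vch /eqP /eq_wordP vc; apply/eqP/eq_wordP => t tL.
  rewrite -vc; last by rewrite LS; lia.
  by rewrite (hch v vch)//; lia.
have [ig|gi] := ltnP i (gen c).-1.
  have cL : (L i.+1 <= c.1)%N.
    apply: ltnW; rewrite ltnNge; apply/negP; move: ig; rewrite /gen.
    by case: ex_minnP => j _ hj ij /hj; lia.
  have wE : (M i)%:R * weight i c = weight i.+1 c.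
    by rewrite /weight [in LHS]big_ltn// mulrA mulfV ?mul1r// gt_eqF.
  have [uc|nuc] := boolP (compat i u c); last first.
    rewrite {2}/cost (negPf nuc) mulr0 big_seq big1// => v vch.
    by rewrite /cost; case: ifP => // /(up v vch) uc; rewrite uc in nuc.
  rewrite {2}/cost uc wE.
  have -> : \sum_(v <- ch) cost i.+1 v c =
      \sum_(w <- map (word (L i.+1)) ch) (if w == word (L i.+1) c.2 then weight i.+1 c else 0).
    by rewrite big_map; apply: eq_bigr => v _; rewrite /cost /compat (minn_idPr cL).
  exact: sum_uniq_indicator.
have w1 k : (i <= k)%N -> weight k c = 1 by move=> ik; rewrite /weight big_geq//; lia.
rewrite -sch; apply: sum_le_size => v vch; rewrite /cost; case: ifP => [/(up v vch) ->|_].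
  by rewrite !w1.
by case: ifP.
Qed.

(** If every child cost more than one half, the finitely many lists showing this could be merged,
    and by [cost_step] the average over the children would make [u] cost more than one half as
    well. *)
Let node_step i u : cost_le i u -> exists v,
  [/\ cost_le i.+1 v, forall t : int, t < (L i)%:Z -> coord v t = coord u t &
      `|phi (L i.+1) v - phi (L i) u - alpha * (N i)%:R| <= ep i * (N i)%:R].
Proof.
move=> cu; have [ch [sch uch hch]] := stN i u (L i); rewrite -LS in uch hch.
have hch1 z : z \in ch -> forall t : int, t < (L i)%:Z -> coord z t = coord u t.
  by move=> /hch[].
suff [v vch cv] : exists2 v, v \in ch & cost_le i.+1 v.
  by exists v; have [h1 h2 _] := hch v vch.
apply: contrapT => h.
have bad v : exists l : seq (nat * Sigma), [/\ uniq l, forall c, c \in l -> C c &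
    v \in ch -> 2^-1 < \sum_(c <- l) cost i.+1 v c].
  have [vch|nvch] := boolP (v \in ch); last by exists [::].
  have : ~ cost_le i.+1 v by move=> cv; apply: h; exists v.
  move=> /existsNP[l /not_implyP[ul /not_implyP[lC /negP]]]; rewrite -ltNge => lv.
  by exists l.
pose bl v := sval (cid (bad v)); have hbl v := svalP (cid (bad v)).
pose l := undup (flatten (map bl ch)).
have lC c : c \in l -> C c.
  rewrite mem_undup => /flattenP[_ /mapP[v _ ->] cv].
  by have [_ + _] := hbl v; apply.
have := cu l (undup_uniq _) lC; rewrite -(ler_pM2l (M_gt0 i)); apply/negP; rewrite -ltNge.
rewrite mulr_sumr; apply: (@lt_le_trans _ _ (\sum_(c <- l) \sum_(v <- ch) cost i.+1 v c)); last first.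
  by apply: ler_sum => c _; apply: cost_step.
rewrite exchange_big /= -sch mulr_natl.
have -> : 2^-1 *+ size ch = \sum_(v <- ch) 2^-1 :> R.
  by rewrite big_const_seq count_predT -Monoid.iteropE /=; elim: (size ch) => //= n IH; rewrite mulrS IH.
rewrite big_seq [ltRHS]big_seq; apply: ltr_sum.
  have : (0 < size ch)%N by rewrite sch -(ltr0n R).
  by case: (ch) => //= v ch' _; rewrite mem_head.
move=> v vch; have [ub _ /(_ vch) lt] := hbl v; apply: lt_le_trans lt _.
rewrite -/(bl v) [leRHS](bigID (mem (bl v)))/= -[leLHS]addr0; apply: lerD; last exact: sumr_ge0.
rewrite -[in leRHS]big_filter [leRHS](perm_big (bl v))// perm_sym.
apply: uniq_perm; [exact: ub|by rewrite filter_uniq// undup_uniq|move=> c].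
rewrite mem_filter mem_undup /=; case: (boolP (c \in bl v)) => //= cb.
by apply/esym/flattenP; exists (bl v) => //; apply/mapP; exists v.
Qed.

(** Follow nodes of cost at most one half down to a limit point. Since [e <= 1], a ball containing
    that point shares its word of length [c.1], so at generation [gen c] it alone would cost 1. *)
Lemma moran_uncovered u0 : e <= 1 -> cost_le 0 u0 ->
  exists2 x, phi_level phi alpha x & ~ (\bigcup_(c in C) bowen_ball c.1 c.2 e) x.
Proof.
move=> e1 c0u.
have step i (v : {v | cost_le i v}) : {v' : {v' | cost_le i.+1 v'} |
    (forall t : int, t < (L i)%:Z -> coord (sval v') t = coord (sval v) t) /\
    `|phi (L i.+1) (sval v') - phi (L i) (sval v) - alpha * (N i)%:R| <= ep i * (N i)%:R}.
  by apply: cid; have [v' [h1 h2 h3]] := node_step (svalP v); exists (exist _ v' h1).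
pose path := fix path i : {v | cost_le i v} :=
  if i is i'.+1 then sval (step i' (path i')) else exist _ u0 c0u.
pose u i := sval (path i).
have [x [xu lx]] : exists x, (forall i (t : int), t < (L i)%:Z -> coord x t = coord (u i) t) /\
    phi_level phi alpha x.
  apply: (@moran_limit alpha N ep N0 epN N_slow u) => i; rewrite -/(L _) -?/(L i.+1).
    by have [h _] := svalP (step i (path i)).
  by have [_ h] := svalP (step i (path i)).
exists x => // -[c Cc cx].
have xc : word c.1 c.2 = word c.1 x.
  apply: contrapT => /bowen_dist_neq_word h; move: cx; rewrite /bowen_ball /=; apply/negP.
  by rewrite -leNgt; exact: le_trans h.
have := svalP (path (gen c)) [:: c]; rewrite -/(u _) big_seq1 => /(_ isT) h.
have : cost (gen c) (u (gen c)) c = 1.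
  rewrite /cost /weight big_geq ?leq_pred//.
  have -> : compat (gen c) (u (gen c)) c.
    have cL : (c.1 <= L (gen c))%N by rewrite /gen; case: ex_minnP.
    rewrite /compat (minn_idPl cL) xc; apply/eqP/eq_wordP => t tc; rewrite (xu (gen c))//.
    by rewrite ltz_nat; exact: leq_trans cL.
  by [].
move=> cE; rewrite cE in h; have : (1 : R) <= 2^-1 by apply: h => c'; rewrite inE => /eqP ->.
lra.
Qed.

Lemma uncovered_sum_ge K : 0 < K -> (forall c, weight 0 c <= K * expR (- s' * c.1%:R)) ->
  e <= 1 -> phi_level phi alpha `<=` \bigcup_(c in C) bowen_ball c.1 c.2 e ->
  ((2^-1 / K)%:E <= \esum_(c in C) (expR (- s' * c.1%:R))%:E)%E.
Proof.
move=> K0 hK e1 cov; rewrite leNgt; apply/negP => lt.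
have [x xl nx] : exists2 x, phi_level phi alpha x & ~ (\bigcup_(c in C) bowen_ball c.1 c.2 e) x.
  apply: (@moran_uncovered point e1) => l ul lC.
  have : \sum_(c <- l) expR (- s' * c.1%:R) <= 2^-1 / K.
    rewrite -lee_fin; apply: le_trans (ltW lt).
    exact: (esum_ge_seq (fun c : nat * Sigma => expR (- s' * c.1%:R))).
  rewrite ler_pdivlMr// mulr_suml; apply: le_trans; apply: ler_sum => c _.
  by rewrite /cost /compat [L 0]big_ord0 minn0 mulrC; case: ifP => // _; rewrite ltW// mulr_gt0 ?expR_gt0.
exact: nx (cov _ xl).
Qed.

End cover.

(** A mass distribution principle without a measure: the uniform mass on the tree enters only
    through the weights of balls. *)
Lemma cover_sum_ge : exists2 K : R, 0 < K & forall e C, e <= 1 ->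
  phi_level phi alpha `<=` \bigcup_(c in C) bowen_ball c.1 c.2 e ->
  (K%:E <= \esum_(c in C) (expR (- s' * c.1%:R))%:E)%E.
Proof.
have [K K0 hK] := weight_bound; exists (2^-1 / K); first by rewrite divr_gt0.
by move=> e C; exact: uncovered_sum_ge.
Qed.

End tree.

Lemma htop_eps_ge (alpha s s' e : R) : rich phi alpha s -> s' < s -> 0 < e <= 1 ->
  (s'%:E <= htop_eps (phi_level phi alpha) e)%E.
Proof.
move=> ra s's e01; apply: le_ereal_inf_tmp => _ [t /= ht <-]; rewrite lee_fin leNgt.
apply/negP => ts'.
have j0 (j : nat) : 0 < j.+1%:R^-1 :> R by rewrite invr_gt0.
have ch j : exists nM : nat * nat, [/\ (0 < nM.1)%N,
    stage phi (alpha * nM.1%:R) (j.+1%:R^-1 * nM.1%:R) nM.1 nM.2 &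
    expR ((s - j.+1%:R^-1) * nM.1%:R) <= nM.2%:R].
  by have [n [M h]] := ra _ (j0 j); exists (n, M).
pose nM j := sval (cid (ch j)); have hnM j := svalP (cid (ch j)).
(* Generation [i] uses stage number [g i], so that its error tends to 0 while its length stays
   negligible against [i]. *)
have [g hg] := slow_growth (fun j => (nM j).1).
pose N i := (nM (g i)).1; pose M i := (nM (g i)).2; pose ep i : R := (g i).+1%:R^-1.
have N0 i : (0 < N i)%N by have [] := hnM (g i).
have stN i : stage phi (alpha * (N i)%:R) (ep i * (N i)%:R) (N i) (M i) by have [] := hnM (g i).
have M_ge i : expR ((s - ep i) * (N i)%:R) <= (M i)%:R by have [] := hnM (g i).
have epN (d : R) : 0 < d -> exists i0, forall i, (i0 <= i)%N -> ep i <= d.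
  move=> d0; have [J hJ] := exists_nat_ge d^-1; have [i0 hi0] := hg J.
  exists i0 => i /hi0[Jg _]; rewrite /ep invf_ple ?posrE//.
  by apply: le_trans (hJ _ Jg) _; rewrite ler_nat.
have N_slow J : exists i0, forall i, (i0 <= i)%N -> (J * N i <= i)%N.
  by have [i0 hi0] := hg J; exists i0 => i /hi0[].
have [K K0 hK] : exists2 K : R, 0 < K & forall n C, bowen_cover (phi_level phi alpha) n e C ->
    (K%:E <= \esum_(c in C) (expR (- t * c.1%:R))%:E)%E.
  have [K K0 hK] := cover_sum_ge N0 stN M_ge epN N_slow s's.
  exists K => // n C [_ _ cov]; case/andP: e01 => _ e1; apply: le_trans (hK e C e1 cov) _.
  apply: le_esum => c _; rewrite lee_fin ler_expR !mulNr lerN2 ler_wpM2r// ltW//.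
have S_ge n : (K%:E <= bowen_S (phi_level phi alpha) t n e)%E.
  by apply: le_ereal_inf_tmp => _ [C hC <-]; exact: hK hC.
have cvS : cvgn (fun n => bowen_S (phi_level phi alpha) t n e).
  apply: ereal_nondecreasing_is_cvgn => n n' nn; apply: le_ereal_inf => _ [C [h1 h2 h3] <-].
  by exists C => //; split => // c /h2; exact: leq_trans.
have : (K%:E <= bowen_S_lim (phi_level phi alpha) t e)%E.
  by apply: lime_ge => //; apply: nearW.
by rewrite ht lee_fin leNgt K0.
Qed.

End moran.

(** * Invariant measures of prescribed exponent *)

Section empirical_means.
Context {R : realType} {X : sft R}.
Local Notation Sigma := (shift_space X).
Implicit Types (x y z : Sigma).

Lemma ultra_bounded_cvg (T : Type) (U : set_system T) (f : T -> R) (B : R) : UltraFilter U ->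
  (forall t, `|f t| <= B) -> exists l : R, f @ U --> l.
Proof.
move=> UU fB; have PU : ProperFilter U := @ultra_proper _ _ UU.
have [l [_ cl]] : `[- B, B]%classic `&` cluster (f @ U) !=set0.
  apply: (@segment_compact R (- B) B); apply: (@filterE _ U) => t /=.
  by rewrite in_itv /= -ler_norml.
exists l => W Wl; have [//|UW] := in_ultra_setVsetC (f @^-1` W) UU.
have [y [nWy Wy]] := cl (~` W) W UW Wl.
by case: (nWy Wy).
Qed.

Definition empirical (V : seq Sigma) (L : nat) (f : Sigma -> R) : R :=
  (size V * L)%N%:R^-1 * \sum_(z <- V) \sum_(t < L) f (shift t%:Z z).

Lemma empiricalD V L f g : empirical V L (fun x => f x + g x) = empirical V L f + empirical V L g.
Proof.
rewrite /empirical -mulrDr -big_split; congr (_ * _); apply: eq_bigr => z _.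
by rewrite -big_split.
Qed.

Lemma empiricalZ V L a f : empirical V L (fun x => a * f x) = a * empirical V L f.
Proof.
rewrite /empirical mulrCA; congr (_ * _); rewrite mulr_sumr; apply: eq_bigr => z _.
by rewrite mulr_sumr.
Qed.

Lemma empirical_sum (J : Type) (s : seq J) V L (F : J -> Sigma -> R) :
  empirical V L (fun x => \sum_(j <- s) F j x) = \sum_(j <- s) empirical V L (F j).
Proof.
rewrite /empirical -mulr_sumr [in RHS]exchange_big; congr (_ * _); apply: eq_bigr => z _.
by rewrite exchange_big.
Qed.

Lemma empirical_le V L f g : (forall x, f x <= g x) -> empirical V L f <= empirical V L g.
Proof.
by move=> fg; rewrite ler_wpM2l ?invr_ge0//; apply: ler_sum => z _; apply: ler_sum => t _.
Qed.

Lemma empirical_cst V L a : V != [::] -> (0 < L)%N -> empirical V L (fun=> a) = a.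
Proof.
move=> V0 L0; have VL : (0 < size V * L)%N by rewrite muln_gt0 L0 andbT; case: (V) V0.
apply: (mulfI (x := (size V * L)%:R)); first by rewrite pnatr_eq0 -lt0n.
rewrite /empirical mulVKf ?pnatr_eq0 -?lt0n// natrM -mulrA.
elim: (V) => [|z V' IH] /=; first by rewrite big_nil mul0r.
by rewrite big_cons IH sumr_const card_ord -[a *+ L]mulr_natl -[(size V').+1%:R]natr1; ring.
Qed.

Lemma empirical_orbit_le V L f B : V != [::] -> (0 < L)%N ->
  (forall z, z \in V -> \sum_(t < L) f (shift t%:Z z) <= B) -> empirical V L f <= B / L%:R.
Proof.
move=> V0 L0 fB; have S0 : 0 < (size V)%:R :> R by rewrite ltr0n; case: (V) V0.
rewrite /empirical natrM invfM mulrAC ler_pM2r ?invr_gt0 ?ltr0n// mulrC ler_pdivrMr// mulrC.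
exact: sum_le_size.
Qed.

Lemma empirical_shift V L (f : Sigma -> R) B : V != [::] -> (0 < L)%N -> (forall x, `|f x| <= B) ->
  `|empirical V L (f \o shift 1) - empirical V L f| <= 2 * B / L%:R.
Proof.
move=> V0 L0 fB; have L0' : 0 < L%:R :> R by rewrite ltr0n.
have S0 : 0 < (size V)%:R :> R by rewrite ltr0n; case: (V) V0.
rewrite /empirical -mulrBr -sumrB normrM ger0_norm ?invr_ge0// natrM invfM mulrC.
rewrite mulrA ler_pM2r ?invr_gt0// ler_pdivrMr// mulrC.
apply: le_trans (ler_norm_sum _ _ _) _; apply: sum_le_size => z _.
have -> : \sum_(t < L) (f \o shift 1) (shift t%:Z z) - \sum_(t < L) f (shift t%:Z z) =
    f (shift L%:Z z) - f z.
  elim: (L) => [|n IH]; first by rewrite !big_ord0 shift0 !subrr.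
  rewrite !big_ord_recr /= shift_shift -PoszD add1n.
  by move: IH; move: (f (shift n%:Z z)) (f (shift n.+1%:Z z)) => p q; lra.
apply: le_trans (ler_normB _ _) _; have := fB z; have := fB (shift L%:Z z); lra.
Qed.

(** Along an ultrafilter all bounded sequences converge, so the limit is defined on all sets at
    once. The orbits have length [L k > k], so the boundary terms that obstruct invariance
    disappear. *)
Lemma empirical_limit (V : nat -> seq Sigma) (L : nat -> nat) :
  (forall k, V k != [::]) -> (forall k, (k < L k)%N) ->
  exists m, invariant_mean setT m /\ forall (I : finType) (c : Sigma -> I) (g : I -> R) B,
    (forall e : R, 0 < e -> exists k0, forall k, (k0 <= k)%N -> empirical (V k) (L k) (g \o c) <= B + e) ->
    expect m c g <= B.
Proof.
move=> V0 kL; have L0 k : (0 < L k)%N by exact: leq_ltn_trans (kL k).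
have [U [UU ooU]] := @ultraFilterLemma nat \oo _.
have PU : ProperFilter U := @ultra_proper _ _ UU.
pose E f k := empirical (V k) (L k) f.
have EB f (B : R) : (forall x, `|f x| <= B) -> forall k, `|E f k| <= B.
  move=> fB k; have fB' x : - B <= f x <= B by rewrite -ler_norml.
  rewrite ler_norml -[B](empirical_cst B (V0 k) (L0 k)) -mulN1r -empiricalZ.
  by apply/andP; split; apply: empirical_le => x; have /andP[] := fB' x; rewrite ?mulN1r.
pose ind (A : set Sigma) x : R := \1_A x.
have indB A x : `|ind A x| <= 1 by rewrite /ind indicE; case: (_ \in _); rewrite ?normr1 ?normr0.
have cv A : exists l : R, E (ind A) @ U --> l by exact: (ultra_bounded_cvg UU (EB _ _ (indB A))).
pose m A := sval (cid (cv A)); have mE A : E (ind A) @ U --> m A := svalP (cid (cv A)).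
have Uuniq (u : nat -> R) (l l' : R) : u @ U --> l -> u @ U --> l' -> l = l'.
  by move=> h h'; exact: (cvg_unique (@norm_hausdorff _ R^o) h h').
exists m; split.
  have inv1 A : m (shift 1 @^-1` A) = m A.
    apply/eqP; rewrite -subr_eq0; apply/eqP.
    have h1 : (fun k => E (ind (shift 1 @^-1` A)) k - E (ind A) k) @ U --> m (shift 1 @^-1` A) - m A.
      by apply: cvgB; exact: mE.
    apply: Uuniq h1 _; apply/cvgrPdist_le => e e0; apply: ooU.
    have [n hn] := exists_nat_ge (2 / e); exists n => // k /= nk.
    rewrite sub0r normrN; apply: le_trans (empirical_shift (V0 k) (L0 k) (indB A)) _.
    rewrite mulr1 ler_pdivrMr ?ltr0n// mulrC -ler_pdivrMr//.
    by apply: hn; apply: leq_trans nk (ltnW (kL k)).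
  split => //.
  - move=> A; apply: (@cvgr_to_ge _ _ _ _ _ _ _ (mE A)); apply: nearW => k.
    by rewrite -(empirical_cst 0 (V0 k) (L0 k)); apply: empirical_le => x; rewrite /ind indicE.
  - apply: (Uuniq (E (ind setT))); first exact: mE.
    rewrite [E _](_ : _ = fun=> 1); first exact: cvg_cst.
    apply/funext => k; rewrite -[RHS](empirical_cst 1 (V0 k) (L0 k)) /E; congr empirical.
    by apply/funext => x; rewrite /ind indicT.
  - move=> A B _ _ AB; apply: (Uuniq (E (ind (A `|` B)))); first exact: mE.
    rewrite [E _](_ : _ = fun k => E (ind A) k + E (ind B) k); first by apply: cvgD; exact: mE.
    apply/funext => k; rewrite -empiricalD; congr empirical; apply/funext => x; rewrite /ind !indicE.
    rewrite in_setU; case: (boolP (x \in A)) => xA; case: (boolP (x \in B)) => xB //=; rewrite ?addr0 ?add0r//.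
    by exfalso; have : (A `&` B) x; [split; exact: set_mem|rewrite AB].
  - by apply: (@shift_invariant_int _ _ setT) => // A _; exact: inv1.
move=> I c g B hB; have cE : E (g \o c) @ U --> expect m c g.
  have -> : E (g \o c) = (fun k => \sum_i g i * E (ind (c @^-1` [set i])) k).
    apply/funext => k; under eq_bigr do rewrite -empiricalZ.
    rewrite -empirical_sum; congr empirical; apply/funext => x /=.
    rewrite (bigD1 (c x))//= /ind indicE mem_set// mulr1 big1 ?addr0// => i ix.
    by rewrite indicE memNset ?mulr0//= => xi; rewrite xi eqxx in ix.
  rewrite /expect; elim: (index_enum I) => [|i s IH].
    by rewrite big_nil; under eq_fun do rewrite big_nil; exact: cvg_cst.
  rewrite big_cons; under eq_fun do rewrite big_cons.
  by apply: cvgD => //; apply: cvgMr; exact: mE.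
apply/ler_addgt0Pr => e /hB [k0 hk]; apply: (@cvgr_to_le _ _ _ _ _ _ _ cE).
by apply: ooU; exists k0.
Qed.

End empirical_means.

Lemma sum_blocks (V : zmodType) Q l (F : nat -> V) :
  \sum_(t < Q * l) F t = \sum_(i < Q) \sum_(r < l) F (r + i * l)%N.
Proof.
elim: Q => [|Q IH]; first by rewrite !big_ord0.
rewrite mulSnr big_split_ord /= IH big_ord_recr /=; congr (_ + _).
by apply: eq_bigr => r _; rewrite addnC.
Qed.

Lemma tail_sum_le (R : numDomainType) m l (b : R) : 0 <= b ->
  \sum_(t < m) (if (t + l <= m)%N then 0 else b) <= l%:R * b.
Proof.
move=> b0; have le_b t : (if (t + l <= m)%N then 0 else b) <= b by case: ifP.
have [lm|ml] := leqP l m.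
  have [p mE] : exists p, (m = p + l)%N by exists (m - l)%N; rewrite subnK.
  subst m; rewrite big_split_ord /= big1 ?add0r; last first.
    by move=> t _; have := ltn_ord t; case: ifP => // /negP h h'; case: h; lia.
  rewrite -[X in X%:R]card_ord mulr_natl -sumr_const; apply: ler_sum => t _; exact: le_b.
apply: (@le_trans _ _ (m%:R * b)); last by rewrite ler_wpM2r// ler_nat ltnW.
by rewrite -[X in X%:R]card_ord mulr_natl -sumr_const; apply: ler_sum => t _; exact: le_b.
Qed.

(** * Limit means along the tree of a single stage *)

Section stage_means.
Context {R : realType} {X : sft R}.
Local Notation Sigma := (shift_space X).
Implicit Types (x y z : Sigma).
Variables (phi : nat -> Sigma -> R) (C0 C1 c0 : R) (D : nat).
Hypothesis pot : potential phi C0 C1 c0 D.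

Lemma stage_orbits a e n M : stage phi a e n M -> forall k, exists V : seq Sigma,
  [/\ size V = (M ^ k)%N, uniq (map (word (k * n)) V) & forall z, z \in V ->
      `|phi (k * n)%N z - k%:R * a| <= k%:R * e /\
      forall i x, (i < k)%N -> word n x = word n (shift (i * n)%N%:Z z) -> phi n x <= a + e].
Proof.
move=> st; elim=> [|k [V [sV uV hV]]].
  exists [:: point]; split => // z _; split; last by move=> i.
  by have := pot_le pot 0 z; rewrite !mul0r subr0 mulr0 mul0n.
pose ch z := sval (cid (st z (k * n)%N)); have hch z := svalP (cid (st z (k * n)%N)).
exists (flatten (map ch V)); split.
- rewrite size_flatten /shape -map_comp expnSr -sV.
  elim: (V) => //= z s IH; rewrite IH mulSn.
  by have [+ _ _] := hch z; rewrite -/(ch z) => ->.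
- apply: (@uniq_map_flatten _ _ _ (word (k * n))) => //.
  + by move=> y y'; apply: eq_word_le; rewrite leq_mul2r leqnSn orbT.
  + move=> z y _ yz; have [_ _ /(_ y yz)[h _ _]] := hch z.
    by apply/eq_wordP => i iL; apply: h.
  + by move=> z _; have [_ + _] := hch z; rewrite mulSnr.
move=> y /flattenP[_ /mapP[z zV ->] yz]; have [h1 h2] := hV z zV.
have [_ _ /(_ y yz)[h3 h4 h5]] := hch z; split.
  rewrite mulSnr -natr1 !mulrDl !mul1r; move: h1 h4; rewrite !ler_norml => /andP[? ?] /andP[? ?].
  by apply/andP; split; lra.
move=> i x; rewrite ltnS leq_eqVlt => /predU1P[->|ik] /eq_wordP xy; first by apply: h5; apply/eq_wordP.
apply: (h2 i) => //; apply/eq_wordP => t tn; rewrite xy// !coord_shift h3//.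
have : ((i.+1 * n) <= k * n)%N by rewrite leq_mul2r ik orbT.
by rewrite mulSn; move: tn; clear; lia.
Qed.

(** For each phase [r < l], subadditivity along the times congruent to [r] modulo [l] bounds
    [phi (Q * l)]. The [l] phases together run through all times. *)
Lemma orbit_sum_ge (z : Sigma) l Q : (0 < l)%N ->
  l%:R * phi (Q * l)%N z - 2 * C1 * l%:R ^+ 2 <= \sum_(t < Q * l) phi l (shift t%:Z z).
Proof.
move=> l0; have C10 := pot_C1_ge0 pot.
have phase r : (r < l)%N -> phi (Q * l)%N z - 2 * C1 * l%:R <=
    \sum_(i < Q) phi l (shift (r + i * l)%N%:Z z).
  move=> rl; have rl' : r%:R <= l%:R :> R by rewrite ler_nat ltnW.
  have h1 : phi (Q * l)%N z - C1 * l%:R <= phi (r + Q * l)%N z.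
    rewrite [in leRHS]addnC; apply: le_trans (pot_extend pot _ r z).
    by rewrite lerD2l lerN2 ler_wpM2l.
  have h2 q : phi (r + q * l)%N z <= C1 * r%:R + \sum_(i < q) phi l (shift (r + i * l)%N%:Z z).
    elim: q => [|q IH].
      by rewrite big_ord0 addr0 mul0n addn0; have := pot_le pot r z; rewrite ler_norml => /andP[].
    rewrite mulSnr addnA big_ord_recr /= addrA; apply: le_trans (pot_subadd pot _ _ _) _.
    by rewrite lerD2r.
  by have := h2 Q; have : C1 * r%:R <= C1 * l%:R by [rewrite ler_wpM2l]; lra.
rewrite (sum_blocks Q l (fun t => phi l (shift t%:Z z))) exchange_big /=.
have -> : l%:R * phi (Q * l)%N z - 2 * C1 * l%:R ^+ 2 =
    \sum_(r < l) (phi (Q * l)%N z - 2 * C1 * l%:R).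
  by rewrite sumr_const card_ord -[RHS]mulr_natl; ring.
by apply: ler_sum => r _; exact: phase.
Qed.

(** A window of length [w * n] contains [w.-1] whole segments, which the last clause of [stage]
    bounds whatever precedes them; its two incomplete ends cost at most [2 * C1 * n]. At most
    [w * n] windows overrun the orbit. *)
Lemma orbit_sum_le a e n K w (z : Sigma) : (0 < n)%N -> (0 < w)%N ->
  (forall i x, (i < K)%N -> word n x = word n (shift (i * n)%N%:Z z) -> phi n x <= a + e) ->
  \sum_(t < K * n) phi (w * n)%N (shift t%:Z z) <=
  (K * n)%:R * (2 * C1 * n%:R + (w.-1)%:R * (a + e)) +
  (w * n)%:R * (C1 * (w * n)%:R + `|2 * C1 * n%:R + (w.-1)%:R * (a + e)|).
Proof.
move=> n0 w0 hz; have C10 := pot_C1_ge0 pot; set B := 2 * C1 * _ + _; set l := (w * n)%N.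
have blocks i q : (i + q <= K)%N -> phi (q * n)%N (shift (i * n)%N%:Z z) <= q%:R * (a + e).
  elim: q => [|q IH] iq.
    by have := pot_le pot 0 (shift (i * n)%N%:Z z); rewrite mul0r mulr0 normr_le0 mul0n => /eqP ->.
  rewrite mulSnr; apply: le_trans (pot_subadd pot _ _ _) _.
  rewrite -natr1 mulrDl mul1r; apply: lerD; first by apply: IH; lia.
  apply: (hz (i + q)%N); first by lia.
  by rewrite shift_shift -PoszD -mulnDl addnC.
have bound t : (t < K * n)%N -> phi l (shift t%:Z z) <=
    B + (if (t + l <= K * n)%N then 0 else C1 * l%:R + `|B|).
  move=> tK; case: ifP => tl; last first.
    have := pot_le pot l (shift t%:Z z); rewrite ler_norml => /andP[_ h].
    by have := lerNnormlW (lexx `|B|); lra.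
  pose i := (t %/ n)%N; pose r := (t %% n)%N.
  have tE : t = (i * n + r)%N by exact: divn_eq.
  have rn : (r < n)%N by rewrite ltn_pmod.
  have iwK : (i.+1 + w.-1 <= K)%N.
    rewrite addSnnS prednK//; rewrite -(leq_pmul2r n0) mulnDl.
    by apply: leq_trans tl; rewrite leq_add2r tE leq_addr.
  have lE : l = ((n - r) + (w.-1 * n + r))%N.
    by rewrite /l -{1}(prednK w0) mulSn; move: rn; clear; lia.
  rewrite lE; apply: le_trans (pot_subadd pot _ _ _) _.
  have := pot_subadd pot (w.-1 * n) r (shift (n - r)%N%:Z (shift t%:Z z)).
  have := pot_le pot (n - r) (shift t%:Z z).
  have := pot_le pot r (shift (w.-1 * n)%N%:Z (shift (n - r)%N%:Z (shift t%:Z z))).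
  have := blocks i.+1 w.-1 iwK.
  have -> : shift (n - r)%N%:Z (shift t%:Z z) = shift (i.+1 * n)%N%:Z z.
    rewrite shift_shift; congr (shift _ z); rewrite tE mulSn; move: rn; clear; lia.
  have : C1 * (n - r)%:R <= C1 * n%:R by rewrite ler_wpM2l// ler_nat leq_subr.
  have : C1 * r%:R <= C1 * n%:R by rewrite ler_wpM2l// ler_nat ltnW.
  by rewrite !ler_norml /B addr0 => h1 h2 h3 /andP[_ h4] /andP[_ h5]; lra.
apply: (@le_trans _ _ (\sum_(t < K * n) (B + (if (t + l <= K * n)%N then 0 else C1 * l%:R + `|B|)))).
  by apply: ler_sum => t _; exact: bound.
have b0 : 0 <= C1 * l%:R + `|B| by rewrite addr_ge0// mulr_ge0.
rewrite big_split /= sumr_const card_ord -[B *+ _]mulr_natl lerD2l.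
exact: tail_sum_le.
Qed.

Lemma gibbs_uniform (T : eqType) (V : seq T) (nu : T -> R) : (forall v, v \in V -> 0 < nu v) ->
  \sum_(v <- V) nu v <= 1 -> (size V)%:R * ln (size V)%:R <= \sum_(v <- V) - ln (nu v).
Proof.
move=> nu0 nu1; have [->|V0] := eqVneq V [::]; first by rewrite mul0r big_nil.
have S0 : 0 < (size V)%:R :> R by rewrite ltr0n; case: (V) V0.
rewrite -subr_le0.
have -> : (size V)%:R * ln (size V)%:R - \sum_(v <- V) - ln (nu v) =
    \sum_(v <- V) (ln (size V)%:R + ln (nu v)).
  rewrite big_split /= sumrN opprK; congr (_ + _).
  by rewrite big_const_seq count_predT iter_addr_0 mulr_natl.
apply: (@le_trans _ _ (\sum_(v <- V) ((size V)%:R * nu v - 1))).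
  rewrite big_seq [leRHS]big_seq; apply: ler_sum => v /nu0 n0.
  by rewrite -lnM ?posrE// ln_le_sub1// mulr_gt0.
rewrite big_split /= -mulr_sumr sumrN subr_le0.
have -> : \sum_(v <- V) 1 = (size V)%:R :> R.
  by rewrite big_const_seq count_predT iter_addr_0.
by rewrite ler_piMr// ltW.
Qed.

(** For each phase [r < l] an orbit of [V] is determined by its first [r] letters and the following
    [Q] words of length [l]. The product weight on these data sums to at most 1, so Gibbs'
    inequality applies to the uniform law on [V]. Summing over the phases makes every time occur. *)
Lemma orbit_entropy (V : seq Sigma) l Q (p : l.-tuple 'I_(sft_card X) -> R) : (0 < l)%N ->
  uniq (map (word (Q * l)) V) -> (forall w, 0 < p w) -> \sum_w p w <= 1 ->
  l%:R * ((size V)%:R * ln (size V)%:R) <=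
  (size V)%:R * (l%:R ^+ 2 * ln (sft_card X)%:R) +
  \sum_(z <- V) \sum_(t < Q * l) - ln (p (word l (shift t%:Z z))).
Proof.
move=> l0 uV p0 p1; set s := sft_card X.
have s0 : 0 < s%:R :> R by rewrite ltr0n; exact: (@card_gt0 R X).
have lns : 0 <= ln (s%:R : R) by rewrite ln_ge0// ler1n -(ltr0n R).
have phase r : (r < l)%N -> (size V)%:R * ln (size V)%:R <= (size V)%:R * (l%:R * ln s%:R) +
    \sum_(z <- V) \sum_(i < Q) - ln (p (word l (shift (r + i * l)%N%:Z z))).
  move=> rl; pose key z := (word r z, [tuple word l (shift (r + i * l)%N%:Z z) | i < Q]).
  pose f (u : r.-tuple 'I_s * Q.-tuple (l.-tuple 'I_s)) : R :=
    (s%:R ^+ r)^-1 * \prod_(i < Q) p (tnth u.2 i).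
  have pr0 u : 0 < \prod_(i < Q) p (tnth u i) by apply: prodr_gt0 => i _; exact: p0.
  have f0 u : 0 < f u by rewrite mulr_gt0// invr_gt0 exprn_gt0.
  have ukey : uniq (map key V).
    apply: uniq_map_coarse uV => y y' _ _ /= kE; apply/eq_wordP => t tQ.
    have [tr|rt] := ltnP t r.
      by have /eq_wordP := congr1 fst kE; apply.
    have tE : (t - r = (t - r) %/ l * l + (t - r) %% l)%N := divn_eq _ _.
    have iQ : ((t - r) %/ l < Q)%N by rewrite ltn_divLR//; apply: leq_ltn_trans tQ; exact: leq_subr.
    have := congr1 (fun u => tnth u.2 (Ordinal iQ)) kE; rewrite !tnth_mktuple /=.
    move=> /eq_wordP /(_ ((t - r) %% l)%N (ltn_pmod _ l0)); rewrite !coord_shift -!PoszD.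
    have -> : ((t - r) %% l + (r + (t - r) %/ l * l) = t)%N.
      move: tE rt; set a := (_ %/ _ * _)%N; set b := (_ %% _)%N; clearbody a b.
      by clear; lia.
    exact.
  have f1 : \sum_(z <- V) f (key z) <= 1.
    rewrite -(big_map key xpredT f); apply: (@le_trans _ _ (\sum_u f u)).
      by apply: (sum_uniq_le (P := xpredT)) => // u; exact: ltW.
    rewrite -(pair_bigA _ (fun a b => f (a, b)))/= /f /=.
    under eq_bigr do rewrite -mulr_sumr (sum_tuple_prod (fun _ w => p w)).
    rewrite -mulr_suml sumr_const card_tuple card_ord -[X in X * _]mulr_natl natrX mulfV ?mul1r; last first.
      by rewrite expf_neq0// gt_eqF.
    by apply: Num.Theory.prodr_ile1 => i _; rewrite p1 andbT sumr_ge0// => w _; exact: ltW.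
  apply: le_trans (@gibbs_uniform _ V (f \o key) (fun z _ => f0 (key z)) f1) _.
  apply: (@le_trans _ _ (\sum_(z <- V) (l%:R * ln s%:R +
      \sum_(i < Q) - ln (p (word l (shift (r + i * l)%N%:Z z)))))); last first.
    by rewrite big_split /= lerD2r; apply: sum_le_size.
  apply: ler_sum => z _; rewrite /f /= lnM ?posrE ?invr_gt0 ?exprn_gt0// lnV ?posrE ?exprn_gt0//.
  rewrite lnXn// opprD opprK -[X in X + _ <= _]mulr_natl; apply: lerD; first by rewrite ler_wpM2r// ler_nat ltnW.
  rewrite ln_prod// -sumrN; apply: ler_sum => i _; rewrite tnth_mktuple//.
have -> : \sum_(z <- V) \sum_(t < Q * l) - ln (p (word l (shift t%:Z z))) =
    \sum_(r < l) \sum_(z <- V) \sum_(i < Q) - ln (p (word l (shift (r + i * l)%N%:Z z))).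
  rewrite [RHS]exchange_big; apply: eq_bigr => z _.
  by rewrite (sum_blocks Q l (fun t => - ln (p (word l (shift t%:Z z))))) exchange_big.
have : \sum_(r < l) (size V)%:R * ln (size V)%:R <= \sum_(r < l) ((size V)%:R * (l%:R * ln s%:R) +
    \sum_(z <- V) \sum_(i < Q) - ln (p (word l (shift (r + i * l)%N%:Z z)))).
  by apply: ler_sum => r _; exact: phase.
rewrite big_split /= !sumr_const card_ord -[X in X <= _]mulr_natl -[X in _ <= X + _]mulr_natl.
by rewrite expr2 -mulrA [in X in _ -> _ <= X + _]mulrCA.
Qed.

Lemma div_eventually_le (L : nat -> nat) (b d : R) : (forall k, (k < L k)%N) -> 0 < d ->
  exists k0, forall k, (k0 <= k)%N -> b / (L k)%:R <= d.
Proof.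
move=> kL d0; have [k0 hk] := exists_nat_ge (b / d); exists k0 => k kk.
rewrite ler_pdivrMr ?ltr0n ?(leq_ltn_trans _ (kL k))// mulrC -ler_pdivrMr//.
by apply: hk; apply: leq_trans kk (ltnW (kL k)).
Qed.

Lemma stage_mean a e n M : stage phi a e n M -> (0 < n)%N -> (0 < M)%N ->
  exists m, [/\ invariant_mean setT m,
    forall be : R, (fun l : nat => l%:R^-1 * mean_phi m phi l) @ \oo --> be ->
      a - e <= be * n%:R <= a + e &
    forall l, (0 < l)%N -> l%:R * ln M%:R <= n%:R * label_entropy m (word l)].
Proof.
move=> st n0 M0; have n0' : 0 < n%:R :> R by rewrite ltr0n.
have C10 := pot_C1_ge0 pot; have C00 := pot_C0_ge0 pot.
(* With a factorial number of segments, every [l > 0] eventually divides the length [L k], so the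
   orbit splits into words of length [l] without remainder. *)
pose V k := sval (cid (stage_orbits st (k.+1)`!)); have hV k := svalP (cid (stage_orbits st (k.+1)`!)).
pose L k := ((k.+1)`! * n)%N.
have kL k : (k < L k)%N by apply: leq_trans (leq_pmulr _ n0); exact: fact_geq.
have L0 k : (0 < L k)%N by exact: leq_ltn_trans (kL k).
have LR k : 0 < (L k)%:R :> R by rewrite ltr0n.
have V0 k : V k != [::].
  have [sV _ _] := hV k; rewrite -/(V k) in sV.
  by rewrite -size_eq0 sV -lt0n expn_gt0 M0.
have lL l k : (0 < l)%N -> (l <= k)%N -> L k = (L k %/ l * l)%N.
  by move=> l0 lk; rewrite divnK// dvdn_mulr// dvdn_fact// l0 leqW.
have [m [im hm]] := empirical_limit V0 kL; exists m.
have lw l : label setT (@word R X l) by move=> w.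
have rep_le l x : `|phi l (rep (word l x)) - phi l x| <= C0.
  by rewrite (pot_dist pot)// word_rep ?word_lang.
have lower l : (0 < l)%N -> l%:R * (a - e) - n%:R * C0 <= n%:R * mean_phi m phi l.
  move=> l0; have : expect m (word l) (fun w => -1 * phi l (rep w)) <= C0 - l%:R * (a - e) / n%:R.
    apply: hm => d d0; have [k0 hk0] := div_eventually_le (2 * C1 * l%:R ^+ 2) kL d0.
    exists (maxn l k0) => k; rewrite geq_max => /andP[lk /hk0 hk].
    apply: (@le_trans _ _ (empirical (V k) (L k) (fun x => C0 + - phi l x))).
      by apply: empirical_le => x /=; have := rep_le l x; rewrite ler_norml => /andP[]; lra.
    rewrite empiricalD (empirical_cst _ (V0 k) (L0 k)) -addrA lerD2l.
    apply: (@le_trans _ _ ((- (l%:R * ((k.+1)`!%:R * (a - e))) + 2 * C1 * l%:R ^+ 2) / (L k)%:R)).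
      apply: empirical_orbit_le => // z zV; rewrite sumrN lerNl opprD opprK.
      have := orbit_sum_ge z (L k %/ l) l0; rewrite -(lL l k l0 lk); apply: le_trans.
      rewrite lerD2r ler_wpM2l//; have [_ _ /(_ z zV)[+ _]] := hV k.
      by rewrite -/(L k) ler_norml mulrBr => /andP[+ _]; lra.
    rewrite mulrDl lerD//; rewrite le_eqVlt; apply/orP; left; apply/eqP.
    by rewrite /L natrM; field; rewrite !gt_eqF// ltr0n fact_gt0.
  rewrite expectZ mulN1r -(ler_pM2l n0') => h; rewrite -/(mean_phi m phi l) in h.
  have nE : n%:R * (C0 - l%:R * (a - e) / n%:R) = n%:R * C0 - l%:R * (a - e).
    by field; rewrite gt_eqF.
  by rewrite nE in h; lra.
have upper w : (0 < w)%N -> mean_phi m phi (w * n)%N <= 2 * C1 * n%:R + (w.-1)%:R * (a + e) + C0.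
  move=> w0; apply: hm => d d0; set B := 2 * C1 * n%:R + _; set l := (w * n)%N.
  have [k0 hk0] := div_eventually_le (l%:R * (C1 * l%:R + `|B|)) kL d0.
  exists k0 => k /hk0 hk.
  apply: (@le_trans _ _ (empirical (V k) (L k) (fun x => C0 + phi l x))).
    by apply: empirical_le => x /=; have := rep_le l x; rewrite ler_norml => /andP[_]; lra.
  rewrite empiricalD (empirical_cst _ (V0 k) (L0 k)) [B + _]addrC -addrA lerD2l.
  apply: (@le_trans _ _ (((L k)%:R * B + l%:R * (C1 * l%:R + `|B|)) / (L k)%:R)).
    apply: empirical_orbit_le => // z zV; apply: (orbit_sum_le n0 w0) => i x.
    by have [_ _ /(_ z zV)[_]] := hV k; apply.
  by rewrite mulrDl mulrAC mulfV ?gt_eqF// mul1r lerD2l.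
split => //.
- move=> be cbe; apply/andP; split.
    have c2 : (fun l : nat => n%:R * (l%:R^-1 * mean_phi m phi l) + l%:R^-1 * (n%:R * C0)) @ \oo -->
        n%:R * be + 0 * (n%:R * C0).
      by apply: cvgD; [apply: cvgMr|apply: cvgMl; exact: cvg_invn].
    rewrite (_ : be * n%:R = n%:R * be + 0 * (n%:R * C0)); last by rewrite mul0r addr0 mulrC.
    apply: (cvgr_to_ge c2).
    exists 1%N => // l /= l0; have l0' : 0 < l%:R :> R by rewrite ltr0n.
    rewrite mulrCA -mulrDr mulrC ler_pdivlMr// mulrC; have := lower l l0; lra.
  have csub : (fun w : nat => (w.+1 * n)%N%:R^-1 * mean_phi m phi (w.+1 * n)%N) @ \oo --> be.
    apply: cvg_comp cbe; apply/cvgnyPge => A; exists A => // w /= Aw.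
    by apply: leq_trans (leq_pmulr _ n0); apply: leqW.
  have c2 : (fun w : nat => ((w.+1 * n)%N%:R^-1 * mean_phi m phi (w.+1 * n)%N) * n%:R -
      w.+1%:R^-1 * (2 * C1 * n%:R + C0 - (a + e))) @ \oo -->
      be * n%:R - 0 * (2 * C1 * n%:R + C0 - (a + e)).
    by apply: cvgB; [apply: cvgMl|apply: cvgMl; exact: cvg_harmonic].
  rewrite (_ : be * n%:R = be * n%:R - 0 * (2 * C1 * n%:R + C0 - (a + e))); last by rewrite mul0r subr0.
  apply: (cvgr_to_le c2).
  apply: nearW => w; have w0 : 0 < w.+1%:R :> R by [].
  have -> : (w.+1 * n)%N%:R^-1 * mean_phi m phi (w.+1 * n) * n%:R = w.+1%:R^-1 * mean_phi m phi (w.+1 * n).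
    by rewrite mulnC natrM invfM mulrC !mulrA mulfV ?gt_eqF// mul1r.
  rewrite -mulrBr mulrC ler_pdivrMr//.
  have := upper w.+1 isT; rewrite -pred_Sn; have : w.+1%:R = w%:R + 1 :> R by rewrite natr1.
  move=> ->; lra.
- move=> l l0; apply/ler_addgt0Pr => d d0; have dn0 : 0 < d / n%:R by rewrite divr_gt0.
  pose de := 1 - expR (- (d / n%:R)).
  have de0 : 0 < de.
    by rewrite subr_gt0 expR_lt1 oppr_lt0.
  have de1 : 0 < 1 - de by rewrite /de subKr expR_gt0.
  pose S := #|{: l.-tuple 'I_(sft_card X)}|.
  have S0 : 0 < S%:R :> R by rewrite ltr0n; apply/card_gt0P; exists (word l point).
  (* The law of [word l] under the limit mean itself, mixed with a little of the uniform law to be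
     positive. With this weight the bound of [orbit_entropy] passes to the limit and becomes a bound
     on the entropy, up to [d / n]. *)
  pose p w := (1 - de) * pr m (word l) w + de / S%:R.
  have p0 w : 0 < p w.
    by apply: ltr_wpDl; [apply: mulr_ge0; [exact: ltW|exact: (pr_ge0 im)]|rewrite divr_gt0].
  have p1 : \sum_w p w <= 1.
    rewrite big_split /= -mulr_sumr (pr_sum im (lw l)) sumr_const -/S -[X in _ + X]mulr_natr.
    by rewrite mulfVK ?gt_eqF// mulr1 subrK.
  have hp : expect m (word l) (fun w => ln (p w)) <= - (l%:R * ln M%:R / n%:R).
    apply: hm => d' d'0; have [k0 hk0] := div_eventually_le (l%:R ^+ 2 * ln (sft_card X)%:R) kL d'0.
    exists (maxn l k0) => k; rewrite geq_max => /andP[lk /hk0 hk].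
    have [sV uV _] := hV k; rewrite -/(V k) in sV uV.
    have := @orbit_entropy (V k) l (L k %/ l) p l0; rewrite -(lL l k l0 lk) => /(_ uV p0 p1).
    have SV : 0 < (size (V k))%:R :> R by rewrite sV ltr0n expn_gt0 M0.
    have lnV : ln (size (V k))%:R = (k.+1)`!%:R * ln M%:R :> R.
      by rewrite sV natrX lnXn ?ltr0n// mulr_natl.
    rewrite lnV; set T := \sum_(z <- V k) _ => hT.
    have TE : T = - \sum_(z <- V k) \sum_(t < L k) ln (p (word l (shift t%:Z z))).
      by rewrite -sumrN; apply: eq_bigr => z _; rewrite sumrN.
    rewrite /empirical /= -[X in _ * X]opprK -TE natrM mulrC ler_pdivrMr ?mulr_gt0//.
    move: hk; rewrite ler_pdivrMr// => hk.
    have := ler_wpM2l (ltW SV) hk.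
    have -> : (- (l%:R * ln M%:R / n%:R) + d') * ((size (V k))%:R * (L k)%:R) =
      (size (V k))%:R * (d' * (L k)%:R) - l%:R * ((size (V k))%:R * ((k.+1)`!%:R * ln M%:R)).
      by rewrite /L natrM; field; rewrite gt_eqF.
    by lra.
  have hH : - label_entropy m (word l) <= expect m (word l) (fun w => ln (p w) + d / n%:R).
    rewrite /label_entropy opprK; apply: ler_sum => w _.
    have := pr_ge0 im (word l) w; rewrite le_eqVlt => /predU1P[<-|q0]; first by rewrite mul0r mulr0.
    rewrite mulrC ler_pM2r//.
    have : ln ((1 - de) * pr m (word l) w) <= ln (p w).
      rewrite ler_ln ?posrE ?p0//; first by rewrite lerDl divr_ge0// ltW.
      exact: mulr_gt0.
    by rewrite lnM ?posrE// /de subKr expRK; lra.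
  rewrite expectD (expect_cst im _ (lw l)) in hH.
  have := le_trans hH (lerD hp (lexx _)); rewrite -(ler_pM2l n0').
  have -> : n%:R * (- (l%:R * ln M%:R / n%:R) + d / n%:R) = - (l%:R * ln M%:R) + d.
    by field; rewrite gt_eqF.
  lra.
Qed.

End stage_means.

(** * From finitely additive means to Borel measures *)

Definition cylinder_space {R : realType} (X : sft R) : Type := shift_space X.

HB.instance Definition _ (R : realType) (X : sft R) := Pointed.on (cylinder_space X).

Section cylinder_sets.
Context {R : realType} {X : sft R}.
Local Notation Sigma := (shift_space X).
Implicit Types (x y z : Sigma).

Definition cylinder_set : set (set (cylinder_space X)) :=
  [set A : set Sigma | exists k, forall x y, agree x y k -> A x -> A y].

Lemma cylinder_set0 : cylinder_set set0.
Proof. by exists 0%N. Qed.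

Lemma cylinder_setU A B : cylinder_set A -> cylinder_set B -> cylinder_set (A `|` B).
Proof.
move=> [k hA] [l hB]; exists (maxn k l) => x y xy [Ax|Bx]; [left|right].
  by apply: hA Ax; apply: agreeW xy; exact: leq_maxl.
by apply: hB Bx; apply: agreeW xy; exact: leq_maxr.
Qed.

Lemma cylinder_setC A : cylinder_set A -> cylinder_set (~` A).
Proof. by move=> [k hA]; exists k => x y; rewrite agree_sym => xy nAx /(hA _ _ xy). Qed.

HB.instance Definition _ := isAlgebraOfSets.Build default_measure_display (cylinder_space X)
  cylinder_set0 cylinder_setU cylinder_setC.

Lemma cylinder_compact (A : set Sigma) : cylinder_set A -> compact A.
Proof.
move=> cA; apply: (@subclosed_compact _ A setT) => //; last exact: compact_shift_space.
rewrite -openC; have [k hk] := cylinder_setC cA.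
by apply/open_agreeP => x nAx; exists k => y xy; exact: hk xy nAx.
Qed.

Variable m : set Sigma -> R.
Hypothesis im : invariant_mean setT m.

Lemma mean_bigsetU (F : nat -> set Sigma) n : trivIset setT F ->
  m (\big[setU/set0]_(i < n) F i) = \sum_(i < n) m (F i).
Proof.
move=> tF; elim: n => [|n IH]; first by rewrite !big_ord0 (im_0 im).
rewrite !big_ord_recr /= (im_add im)// ?IH//.
apply/seteqP; split => // x [+ Fn]; rewrite -bigcup_mkord => -[i /= ni Fi].
have := tF i n I I; rewrite /setI => /(_ (ex_intro _ x (conj Fi Fn))) ini.
by rewrite ini ltnn in ni.
Qed.

Let mu0 (A : set (cylinder_space X)) : \bar R := (m A)%:E.

Let mu0_set0 : mu0 set0 = 0%E. Proof. by rewrite /mu0 (im_0 im). Qed.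

Let mu0_ge0 A : (0 <= mu0 A)%E. Proof. by rewrite lee_fin (im_ge0 im). Qed.

(** Cylinder sets are compact and open, so a disjoint sequence of them whose union is a cylinder set
    is empty from some index on. *)
Let mu0_sigma_additive : semi_sigma_additive mu0.
Proof.
move=> F mF tF mUF.
have [D' _ hD'] : finite_subset_cover [set: nat] (F : nat -> set Sigma) (\bigcup_n F n).
  move: (cylinder_compact mUF); rewrite compact_cover => /(_ nat setT F); apply => // i _.
  by have [k hk] := mF i; apply/open_agreeP => x Fx; exists k => y xy; exact: hk xy Fx.
pose N := (\max_(i <- finmap.enum_fset D') i).+1.
have UN n : (N <= n)%N -> \big[setU/set0]_(i < n) F i = \bigcup_n F n.
  move=> Nn; rewrite -bigcup_mkord; apply/seteqP; split => x; first by move=> [i _ Fi]; exists i.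
  move=> /hD' [i iD Fi]; exists i => //=; apply: leq_trans Nn; rewrite ltnS.
  by rewrite (big_rem i) ?leq_maxl.
apply: cvg_near_cst; exists N => // n /= Nn.
by rewrite big_mkord sumEFin -(mean_bigsetU _ tF) UN.
Qed.

Let mu1 : {measure set (cylinder_space X) -> \bar R} :=
  HB.pack mu0 (isMeasure.Build _ _ _ mu0 mu0_set0 mu0_ge0 mu0_sigma_additive).

Definition mean_extension (A : set (borel_space X)) : \bar R := measure_extension mu1 A.

Lemma open_bigcup_cylinder (U : set Sigma) : open U ->
  exists2 V : nat -> set Sigma, (forall k, cylinder_set (V k)) & U = \bigcup_k V k.
Proof.
move=> oU; exists (fun k => [set x | forall y, agree x y k -> U y]).
  by move=> k; exists k => x y xy Vx z yz; apply: Vx; exact: agree_trans yz.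
apply/seteqP; split => x; last by move=> [k _]; apply.
by move: oU => /open_agreeP/[apply] -[k hk]; exists k.
Qed.

Lemma borel_sub_cylinder (A : set Sigma) : measurable (A : set (borel_space X)) ->
  <<s cylinder_set >> (A : set (cylinder_space X)).
Proof.
apply: smallest_sub; first exact: smallest_sigma_algebra.
move=> U /open_bigcup_cylinder[V cV ->]; apply: sigma_algebra_bigcup => k.
exact: sub_sigma_algebra.
Qed.

Let mean_extension_cylinder A : cylinder_set A -> mean_extension A = (m A)%:E.
Proof. by move=> cA; rewrite /mean_extension /measure_extension measurable_mu_extE. Qed.

Let mean_extension_set0 : mean_extension set0 = 0%E. Proof. exact: measure0. Qed.

Let mean_extension_ge0 A : (0 <= mean_extension A)%E. Proof. exact: measure_ge0. Qed.

Let mean_extension_sigma_additive : semi_sigma_additive mean_extension.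
Proof.
move=> F mF tF mUF; apply: (@measure_semi_sigma_additive _ _ _ (measure_extension mu1)) => //.
  by move=> i; exact: borel_sub_cylinder.
exact: borel_sub_cylinder.
Qed.

Let mean_extension_setT : mean_extension setT = 1%E.
Proof. by rewrite mean_extension_cylinder ?(im_1 im)//; exists 0%N. Qed.

HB.instance Definition _ := isMeasure.Build _ _ _ mean_extension
  mean_extension_set0 mean_extension_ge0 mean_extension_sigma_additive.

HB.instance Definition _ := Measure_isProbability.Build _ _ _ mean_extension mean_extension_setT.

Lemma mean_measure : exists mu : probability (borel_space X) R, invariant_measure mu /\
  forall k (A : set Sigma), (forall x y, agree x y k -> A x -> A y) -> measure_mean mu A = m A.
Proof.
exists mean_extension; split; last first.
  move=> k A hA; have cA : cylinder_set (A : set (cylinder_space X)) by exists k.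
  exact: (congr1 fine (mean_extension_cylinder cA)).
move=> B mB.
have mf : measurable_fun setT (shift 1 : borel_space X -> borel_space X).
  by move=> _ A mA; rewrite setTI; exact: shift_borel.
have cI : setI_closed (cylinder_set : set (set (borel_space X))).
  by move=> A1 A2 h1 h2; exact: (@measurableI _ (cylinder_space X)).
have cT : cylinder_set setT by exists 0%N.
have cs (A : set Sigma) : cylinder_set A -> cylinder_set (shift 1 @^-1` A).
  by move=> [k hA]; exists (k + 1)%N => x y xy; apply: hA; exact: agree_shift.
pose nu : {measure set (borel_space X) -> \bar R} := measure_function_pushforward__canonical__measure_function_Measure mean_extension mf.
have mE : measurable = <<s (cylinder_set : set (set (borel_space X))) >> :> set (set (borel_space X)).
  apply/seteqP; split => A; first exact: borel_sub_cylinder.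
  apply: smallest_sub; first exact: sigma_algebra_measurable.
  by move=> U [k hk]; exact: agree_borel hk.
apply: (@measure_unique _ _ (borel_space X) _ (fun=> setT) mE cI (fun=> cT) _ nu mean_extension) => //.
- by apply/seteqP; split => // x _; exists 0%N.
- move=> A cA; have := mean_extension_cylinder (cs _ cA); rewrite (im_shift im)// => h.
  exact: etrans h (esym (mean_extension_cylinder cA)).
- move=> k; apply: (@le_lt_trans _ _ 1%E); last exact: ltry.
  by rewrite -mean_extension_setT /nu /= /pushforward preimage_setT.
Qed.

End cylinder_sets.

(** * Convex combinations of means *)

Section mixtures.
Context {R : realType} {X : sft R}.
Local Notation Sigma := (shift_space X).
Implicit Types (x y z : Sigma).
Variables (phi : nat -> Sigma -> R) (C0 C1 c0 : R) (D : nat).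
Hypothesis pot : potential phi C0 C1 c0 D.

Definition mixture (th : R) (m1 m2 : set Sigma -> R) A := th * m1 A + (1 - th) * m2 A.

Lemma mixture_mean M th m1 m2 : 0 < th < 1 -> invariant_mean M m1 -> invariant_mean M m2 ->
  invariant_mean M (mixture th m1 m2).
Proof.
move=> /andP[th0 th1] [U1 I1 g1 T1 a1 sM1 s1 d1] [U2 I2 g2 T2 a2 sM2 s2 d2].
have th1' : 0 < 1 - th by rewrite subr_gt0.
split => //.
- by move=> A; rewrite addr_ge0// mulr_ge0// ltW.
- by rewrite /mixture T1 T2 !mulr1 subrKC.
- by move=> A B MA MB AB; rewrite /mixture a1// a2//; ring.
- by move=> j A MA; rewrite /mixture s1// s2.
Qed.

Lemma mixture_expect th m1 m2 (I : finType) (c : Sigma -> I) g :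
  expect (mixture th m1 m2) c g = th * expect m1 c g + (1 - th) * expect m2 c g.
Proof.
rewrite /expect !mulr_sumr -big_split; apply: eq_bigr => i _ /=.
by rewrite /pr /mixture; ring.
Qed.

(** Concavity of entropy: Gibbs' inequality for each component against the law of the mixture. *)
Lemma mixture_entropy M th m1 m2 (I : finType) (c : Sigma -> I) : 0 < th < 1 ->
  invariant_mean M m1 -> invariant_mean M m2 -> label M c ->
  th * label_entropy m1 c + (1 - th) * label_entropy m2 c <= label_entropy (mixture th m1 m2) c.
Proof.
move=> th01 im1 im2 lc; have im := mixture_mean th01 im1 im2.
have /andP[th0 th1] := th01; have th1' : 0 < 1 - th by rewrite subr_gt0.
set mm := mixture th m1 m2 in im *.
have -> : label_entropy mm c = th * - expect m1 c (fun i => ln (pr mm c i)) +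
    (1 - th) * - expect m2 c (fun i => ln (pr mm c i)).
  rewrite !mulrN -opprD -mixture_expect; congr (- _); apply: eq_bigr => i _.
  by rewrite mulrC.
have nu0 i : 0 <= pr mm c i by exact: (pr_ge0 im).
have nu1 : \sum_i pr mm c i <= 1 by rewrite (pr_sum im).
apply: lerD; rewrite ler_pM2l//.
  apply: (gibbs im1 id lc nu0 _ nu1) => i p0; apply: ltr_wpDr; last exact: mulr_gt0.
  by rewrite mulr_ge0 ?(ltW th1')// (im_ge0 im2).
apply: (gibbs im2 id lc nu0 _ nu1) => i p0; apply: ltr_wpDl; last exact: mulr_gt0.
by rewrite mulr_ge0 ?(ltW th0)// (im_ge0 im1).
Qed.

Lemma rich_mean b s e : rich phi b s -> 0 < e -> exists m, [/\ @invariant_mean R X setT m,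
    forall be : R, (fun l : nat => l%:R^-1 * mean_phi m phi l) @ \oo --> be -> `|be - b| <= e &
    forall l, (0 < l)%N -> (s - e) * l%:R <= label_entropy m (word l)].
Proof.
move=> r e0; have [n [M [n0 st hM]]] := r e e0.
have n0' : 0 < n%:R :> R by rewrite ltr0n.
have M0 : (0 < M)%N by rewrite -(ltr0n R); exact: lt_le_trans (expR_gt0 _) hM.
have [m [im hbe hH]] := stage_mean pot st n0 M0; exists m; split => //.
  move=> be /hbe /andP[h1 h2]; rewrite ler_norml; apply/andP; split.
    by rewrite -(ler_pM2r n0') mulrBl; move: h1; lra.
  by rewrite -(ler_pM2r n0') mulrBl; move: h2; lra.
move=> l l0; rewrite -(ler_pM2l n0'); apply: le_trans (hH l l0).
have : (s - e) * n%:R <= ln M%:R by rewrite -[leLHS]expRK ler_ln ?posrE ?expR_gt0 ?ltr0n.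
by move=> /(ler_wpM2l (ler0n R l)); apply: le_trans; rewrite le_eqVlt; apply/orP; left; apply/eqP; ring.
Qed.

(** The exponent of a limit mean is known only up to [e]. Moving [alpha] by a proportion [tau]
    towards [b1] and towards [b2] costs at most [(s - s') / 2] in entropy. With [e] smaller than
    both displacements, the two means have exponents strictly on either side of [alpha]. *)
Lemma rich_mean_exact alpha s s' b1 b2 : rich phi alpha s -> rich phi b1 0 -> rich phi b2 0 ->
  b1 < alpha -> alpha < b2 -> s' < s -> exists m, [/\ @invariant_mean R X setT m,
    (fun l : nat => l%:R^-1 * mean_phi m phi l) @ \oo --> alpha &
    forall l, (0 < l)%N -> s' * l%:R <= label_entropy m (word l)].
Proof.
move=> ra r1 r2 h1 h2 ss; pose tau := (s - s') / (2 * (`|s| + (s - s'))).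
have d0 : 0 < s - s' by rewrite subr_gt0.
have D0 : 0 < 2 * (`|s| + (s - s')) by rewrite mulr_gt0// ltr_wpDl.
have tau0 : 0 < tau by rewrite divr_gt0.
have tau1 : tau < 1 by rewrite ltr_pdivrMr// mul1r; have := normr_ge0 s; lra.
have taus : tau * s <= (s - s') / 2.
  apply: (@le_trans _ _ (tau * `|s|)); first by rewrite ler_wpM2l ?(ltW tau0)// ler_norm.
  rewrite /tau mulrAC ler_pdivrMr// -mulrA; apply: ler_wpM2l; first exact: ltW.
  by have := normr_ge0 s; lra.
have tau01 : 0 <= tau <= 1 by rewrite !ltW.
have near b : rich phi b 0 -> rich phi (alpha - tau * (alpha - b)) (s - (s - s') / 2).
  move=> rb; have := rich_convex pot tau01 rb ra; rewrite mulr0 add0r.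
  have -> : tau * b + (1 - tau) * alpha = alpha - tau * (alpha - b) by ring.
  by apply: rich_le; lra.
pose g1 := tau * (alpha - b1); pose g2 := tau * (b2 - alpha).
have g10 : 0 < g1 by rewrite mulr_gt0// subr_gt0.
have g20 : 0 < g2 by rewrite mulr_gt0// subr_gt0.
pose e := Num.min (Num.min (g1 / 2) (g2 / 2)) ((s - s') / 2).
have e0 : 0 < e by rewrite !lt_min !divr_gt0.
have e1 : e <= g1 / 2 by rewrite !ge_min lexx.
have e2 : e <= g2 / 2 by rewrite !ge_min lexx orbT.
have e3 : e <= (s - s') / 2 by rewrite ge_min lexx orbT.
have [m1 [im1 hb1 hH1]] := rich_mean (near b1 r1) e0.
have [m2 [im2 hb2 hH2]] := rich_mean (near b2 r2) e0.
have c1 := mean_phi_cvg im1 pot; have c2 := mean_phi_cvg im2 pot.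
set be1 := lim _ in c1; set be2 := lim _ in c2.
have := hb1 _ c1; have := hb2 _ c2; rewrite -/be1 -/be2 !ler_norml => /andP[k1 k2] /andP[k3 k4].
have lt1 : be1 < alpha by move: k4 e1 g10; rewrite /g1; lra.
have lt2 : alpha < be2 by move: k1 e2 g20; rewrite /g2; lra.
pose th := (be2 - alpha) / (be2 - be1).
have b0 : 0 < be2 - be1 by lra.
have th01 : 0 < th < 1.
  apply/andP; split; first by apply: divr_gt0; [rewrite subr_gt0|exact: b0].
  by rewrite /th ltr_pdivrMr// mul1r; lra.
exists (mixture th m1 m2); split; first exact: mixture_mean.
- have -> : (fun l : nat => l%:R^-1 * mean_phi (mixture th m1 m2) phi l) =
      (fun l : nat => th * (l%:R^-1 * mean_phi m1 phi l) + (1 - th) * (l%:R^-1 * mean_phi m2 phi l)).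
    by apply/funext => l; rewrite /mean_phi mixture_expect; ring.
  have -> : alpha = th * be1 + (1 - th) * be2 by rewrite /th; field; rewrite gt_eqF.
  by apply: cvgD; apply: cvgMr.
- move=> l l0; have lw : label setT (@word R X l) by move=> w.
  apply: le_trans (mixture_entropy th01 im1 im2 lw).
  have := hH1 l l0; have := hH2 l l0; have /andP[th0 th1] := th01.
  have l0' : 0 <= l%:R :> R by [].
  have hs : s' * l%:R <= (s - (s - s') / 2 - e) * l%:R by rewrite ler_wpM2r//; lra.
  move=> /(le_trans hs) q2 /(le_trans hs) q1.
  have p1 : th * (s' * l%:R) <= th * label_entropy m1 (word l) by rewrite ler_wpM2l// ltW.
  have p2 : (1 - th) * (s' * l%:R) <= (1 - th) * label_entropy m2 (word l).
    by rewrite ler_wpM2l// subr_ge0 ltW.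
  lra.
Qed.

Lemma rich_measure alpha s s' b1 b2 : rich phi alpha s -> rich phi b1 0 -> rich phi b2 0 ->
  b1 < alpha -> alpha < b2 -> s' < s -> exists mu : probability (borel_space X) R,
    [/\ invariant_measure mu, phi_mean mu phi = alpha & (s'%:E <= measure_entropy mu)%E].
Proof.
move=> ra r1 r2 h1 h2 ss; have [m [im cm hH]] := rich_mean_exact ra r1 r2 h1 h2 ss.
have [mu [inv muE]] := mean_measure im; exists mu.
have prE l w : pr (measure_mean mu) (@word R X l) w = pr m (word l) w.
  apply: (muE l) => x y xy /= <-; apply/eq_wordP => i il; apply/esym/xy; lia.
split => //.
  apply/cvg_lim => //; rewrite (_ : (fun n : nat => _) = (fun l : nat => l%:R^-1 * mean_phi m phi l))//.
  by apply/funext => l; congr (_ * _); apply: eq_bigr => w _; rewrite prE.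
pose c (x : Sigma) := coord x 0.
have itE n : itinerary c n = word n.
  apply/funext => x; apply: eq_from_tnth => i; rewrite !tnth_mktuple.
  by rewrite /c coord_shift add0r.
have mc i : measurable (c @^-1` [set i] : set (borel_space X)).
  apply: (@agree_borel _ _ 1%N) => x y xy /= <-; apply/esym/xy; lia.
have im' := measure_invariant_mean inv.
have cv := @itinerary_entropy_cvg _ _ _ _ im' _ c mc.
apply: le_trans (ereal_sup_ubound _); last by exists (sft_card X), c; split; [exact: mc|reflexivity].
rewrite lee_fin; rewrite (_ : (fun n : nat => _) =
  (fun n : nat => n%:R^-1 * label_entropy (measure_mean mu) (itinerary c n))); last first.
  by apply/funext => n; rewrite partition_entropyE.
apply: limr_ge => //; exists 1%N => // n /= n0; have n0' : 0 < n%:R :> R by rewrite ltr0n.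
rewrite mulrC ler_pdivlMr// itE; apply: le_trans (hH n n0) _.
by rewrite /label_entropy; under [in leRHS]eq_bigr do rewrite prE.
Qed.

End mixtures.

(** * Equality of the three quantities *)

Section level_sets.
Context {R : realType} {X : sft R}.
Local Notation Sigma := (shift_space X).
Variables (phi : nat -> Sigma -> R) (C0 C1 c0 : R) (D : nat).
Hypothesis pot : potential phi C0 C1 c0 D.
Variable alpha : R.
Hypothesis alpha_int :
  interior [set phi_mean mu phi | mu in [set mu | @invariant_measure R X mu]] alpha.

Let I := ereal_inf [set (topological_pressure phi q - alpha * q)%:E | q in [set: R]].

(** There are invariant measures with exponents [alpha - e / 2] and [alpha + e / 2]. Their rich
    pairs of entropy 0 may be off by up to [e / 4] and still lie on the right side of [alpha]. *)
Lemma spectrum_rich : exists b1 b2, [/\ b1 < alpha, rich phi b1 0, alpha < b2 & rich phi b2 0].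
Proof.
have [e /= e0 he] := (nbhs_ballP _ _).1 alpha_int; have e2 : 0 < e / 2 by rewrite divr_gt0.
have ball_e b : `|alpha - b| < e -> exists2 mu, @invariant_measure R X mu & phi_mean mu phi = b.
  by move=> hb; have [|mu inv muE] := he b; [rewrite -ball_normE|exists mu].
have [|mu1 inv1 mu1E] := ball_e (alpha - e / 2).
  by rewrite subKr gtr0_norm//; lra.
have [|mu2 inv2 mu2E] := ball_e (alpha + e / 2).
  by rewrite opprD addNKr normrN gtr0_norm//; lra.
have [_ /(_ (alpha - e / 4))] := mean_phi_rich pot (measure_invariant_mean inv1) (phi_mean_cvg pot inv1).
rewrite mu1E => -[|b1 hb1 r1]; first lra.
have [/(_ (alpha + e / 4)) + _] := mean_phi_rich pot (measure_invariant_mean inv2) (phi_mean_cvg pot inv2).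
rewrite mu2E => -[|b2 hb2 r2]; first lra.
by exists b1, b2; split => //; lra.
Qed.

Lemma infimum_rich s : (s%:E < I)%E -> rich phi alpha s.
Proof.
move=> sI; have [b1 [b2 [h1 r1 h2 r2]]] := spectrum_rich.
apply: (rich_interior pot h1 r1 h2 r2) => q; rewrite -lte_fin; apply: lt_le_trans sI _.
by apply: ereal_inf_lbound; exists q.
Qed.

(** A measure of exponent [alpha] exists, and its entropy, which is nonnegative, is a lower bound
    for every [P q - alpha * q]. Hence the infimum is finite and can be approached by real numbers
    [s] from below. *)
Lemma infimum_ge0 : (0 <= I)%E.
Proof.
have [e /= e0 he] := (nbhs_ballP _ _).1 alpha_int.
have [|mu inv muE] := he alpha; first exact: ballxx.
apply: le_ereal_inf_tmp => _ [q _ <-]; rewrite EFinB leeBrDr// add0e.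
have := variational_le pot inv q; rewrite muE mulrC; apply: le_trans.
rewrite leeDr//; have im := measure_invariant_mean inv.
pose c (x : Sigma) : 'I_1 := ord0.
have mc i : measurable (c @^-1` [set i] : set (borel_space X)).
  by apply: (@agree_borel _ _ 0%N).
apply: le_trans (ereal_sup_ubound _); last by exists 1%N, c; split; [exact: mc|reflexivity].
have cv := @itinerary_entropy_cvg _ _ _ _ im _ c mc.
rewrite lee_fin (_ : (fun n : nat => _) =
  (fun n : nat => n%:R^-1 * label_entropy (measure_mean mu) (itinerary c n))); last first.
  by apply/funext => n; rewrite partition_entropyE.
apply: limr_ge => //; apply: nearW => n; rewrite mulr_ge0 ?invr_ge0//.
by apply: (label_entropy_ge0 im); exact: (label_itinerary im).
Qed.

Lemma infimum_fin_num : I \is a fin_num.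
Proof.
rewrite ge0_fin_numE ?infimum_ge0//.
by apply: le_lt_trans (ltry (topological_pressure phi 0 - alpha * 0)); apply: ereal_inf_lbound; exists 0.
Qed.

Lemma htop_eps_infimum (e : R) : 0 < e <= 1 -> htop_eps (phi_level phi alpha) e = I.
Proof.
move=> e01; have /andP[e0 _] := e01; apply/eqP; rewrite eq_le; apply/andP; split.
  by apply: le_ereal_inf_tmp => _ [q _ <-]; exact: (htop_eps_le pot).
have fI := fineK infimum_fin_num.
rewrite -fI; apply/lee_subgt0Pr => d d0; rewrite -EFinB.
have r : rich phi alpha (fine I - d / 2).
  by apply: infimum_rich; rewrite -[ltRHS]fI lte_fin; lra.
by apply: (htop_eps_ge pot r) => //; lra.
Qed.

Lemma htop_infimum : htop (phi_level phi alpha) = I.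
Proof.
rewrite /htop; apply: lim_near_cst; first exact: ereal_hausdorff.
near=> e; apply: htop_eps_infimum; apply/andP; split.
  by near: e; exact: nbhs_right_gt.
by near: e; exact: nbhs_right_le.
Unshelve. all: by end_near. Qed.

Lemma entropy_sup_infimum : ereal_sup [set measure_entropy mu | mu in
  [set mu : probability (borel_space X) R | invariant_measure mu /\ phi_mean mu phi = alpha]] = I.
Proof.
apply/eqP; rewrite eq_le; apply/andP; split.
  apply: ge_ereal_sup => _ [mu [inv muE] <-]; apply: le_ereal_inf_tmp => _ [q _ <-].
  rewrite EFinB leeBrDr//; have := variational_le pot inv q.
  by rewrite muE mulrC.
have [b1 [b2 [h1 r1 h2 r2]]] := spectrum_rich.
have fI := infimum_fin_num.
rewrite -(fineK fI); apply/lee_subgt0Pr => e e0; rewrite -EFinB.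
have r : rich phi alpha (fine I - e / 2).
  by apply: infimum_rich; rewrite -[ltRHS](fineK fI) lte_fin; lra.
have lt : fine I - e < fine I - e / 2 by lra.
have [mu [inv muE hmu]] := rich_measure pot r r1 r2 h1 h2 lt.
by apply: le_trans hmu _; apply: ereal_sup_ubound; exists mu.
Qed.

End level_sets.

Theorem theoremB (R : realType) (X : sft R) (k : nat) (r : R)
    (A : shift_space X -> 'M[R]_k)
    (k_gt0 : (0 < k)%N) (r_gt0 : 0 < r)
    (mixing : topologically_mixing X) (A_typical : typical r A)
    (alpha : R) (alpha_int : interior (lyapunov_spectrum A) alpha) :
  htop (level_set A alpha) =
    ereal_sup [set measure_entropy mu | mu in
      [set mu : probability (borel_space X) R |
        invariant_measure mu /\ lyapunov A mu = alpha]] /\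
  ereal_sup [set measure_entropy mu | mu in
      [set mu : probability (borel_space X) R |
        invariant_measure mu /\ lyapunov A mu = alpha]] =
    ereal_inf [set (pressure A q - (alpha * q)%:E)%E | q in [set: R]].
Proof.
have [C0 [C1 [c [D pot]]]] := log_norm_potential k_gt0 r_gt0 mixing A_typical.
have [[uA _ _] _] := A_typical.
have lyapE (mu : probability (borel_space X) R) : invariant_measure mu ->
    lyapunov A mu = phi_mean mu (log_norm A).
  by move=> inv; rewrite -(phi_meanE pot inv).
have specE : lyapunov_spectrum A =
    [set phi_mean mu (log_norm A) | mu in [set mu | @invariant_measure R X mu]].
  by apply: eq_imagel => mu inv; exact: lyapE.
rewrite specE in alpha_int.
have -> : [set mu : probability (borel_space X) R | invariant_measure mu /\ lyapunov A mu = alpha] =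
    [set mu | invariant_measure mu /\ phi_mean mu (log_norm A) = alpha].
  by apply/seteqP; split => mu [inv muE]; split => //; [rewrite -lyapE|rewrite lyapE].
have -> : [set (pressure A q - (alpha * q)%:E)%E | q in [set: R]] =
    [set (topological_pressure (log_norm A) q - alpha * q)%:E | q in [set: R]].
  by apply: eq_imagel => q _; rewrite (pressureE q k_gt0 uA pot) EFinB.
rewrite (entropy_sup_infimum pot alpha_int); split => //.
exact: (htop_infimum pot alpha_int).
Qed.
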